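(* Assume the global noise law, the edge condition, and the holomorphic subspace local law (all defined in the context). Let $J\subset(b,\infty)$ be a compact finite union of intervals that is stable, with stable contour $\Gamma$, and assume weighted compatibility on a compact neighborhood of $\Gamma$. Then, with probability tending to one, $\partial J$ contains no singular value of $W_n$ and the number of singular values of $W_n$ in $J$ equals the number of indices $i$ with $\rho(\theta_{n,i})\in J$; moreover $$\|U_n^*\widehat\Pi^{\mathrm L}_n(J)U_n-K_{\mathrm L,n}(J)\|_{\mathrm{op}}\to0,\qquad \|V_n^*\widehat\Pi^{\mathrm R}_n(J)V_n-K_{\mathrm R,n}(J)\|_{\mathrm{op}}\to0,\qquad \|U_n^*\widehat C_n(J)V_n-K_{\mathrm{LR},n}(J)\|_{\mathrm{op}}\to0$$ in probability. Equivalently, if $\widehat{\mathcal P}_n(J)$ denotes the spectral projector of $\mathcal W_n$ onto its (positive) eigenvalues in $J$, then $$\mathcal E_n^*\widehat{\mathcal P}_n(J)\mathcal E_n-\frac12\begin{pmatrix}K_{\mathrm L,n}(J)&K_{\mathrm{LR},n}(J)\\ K_{\mathrm{LR},n}(J)&K_{\mathrm R,n}(J)\end{pmatrix}\longrightarrow0$$ in operator norm, in probability.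
   Context: Setting. $\mathbb F\in\{\mathbb R,\mathbb C\}$; for each $n$, $m=m(n)\ge n$ is an integer and $n/m\to c\in(0,1]$. $X_n$ is a random $n\times m$ matrix over $\mathbb F$; $P_n$ is an $n\times m$ matrix of rank $r_n$ (deterministic, or random on the same probability space; neither independence from $X_n$ nor any rank restriction is assumed); $W_n=X_n+P_n$. With $\mathrm{St}(N,r)=\{Q\in\mathbb F^{N\times r}:Q^*Q=I_r\}$, fix a thin singular value decomposition $P_n=U_n\Theta_nV_n^*$, $U_n\in\mathrm{St}(n,r_n)$, $V_n\in\mathrm{St}(m,r_n)$, $\Theta_n=\operatorname{diag}(\theta_{n,1},\dots,\theta_{n,r_n})$, $\theta_{n,1}\ge\dots\ge\theta_{n,r_n}>0$. $\varepsilon_n\downarrow0$ means a nonnegative sequence tending to $0$. Global noise law. There is a compactly supported probability measure $\mu$ on $[0,\infty)$ such that the empirical spectral measure of $X_nX_n^*$ converges weakly to $\mu$ in probability and $\|X_n\|_{\mathrm{op}}\to b:=\sqrt{\sup\operatorname{supp}\mu}$ in probability. Transforms. For $\zeta\in\mathbb C\setminus[-b,b]$: $\phi(\zeta)=\int\frac{\zeta}{\zeta^2-x}\,\mu(dx)$, $\widetilde\phi(\zeta)=c\,\phi(\zeta)+\frac{1-c}{\zeta}$, $d(\zeta)=\phi(\zeta)\widetilde\phi(\zeta)$. On $(b,\infty)$, $d$ is positive and strictly decreasing. Edge condition. $d(b+):=\lim_{z\downarrow b}d(z)\in(0,\infty)$. Put $\theta_\star=d(b+)^{-1/2}$; $\rho(\theta)=d^{-1}(\theta^{-2})$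 (inverse of $d$ on $(b,\infty)$) for $\theta>\theta_\star$ and $\rho(\theta)=b$ for $0\le\theta\le\theta_\star$. The numbers $\rho(\theta_{n,i})$ are the deterministic locations. Overlap weights. For $\theta>\theta_\star$ and $\rho=\rho(\theta)$: $\kappa_{\mathrm L}(\theta)=-\frac{2\phi(\rho)}{\theta^2d'(\rho)}$, $\kappa_{\mathrm R}(\theta)=-\frac{2\widetilde\phi(\rho)}{\theta^2d'(\rho)}$, $\kappa_{\mathrm{LR}}(\theta)=-\frac{2}{\theta^3d'(\rho)}$; all three are $0$ for $\theta\le\theta_\star$. For $\bullet\in\{\mathrm L,\mathrm R,\mathrm{LR}\}$, $K_{\bullet,n}(J)=\operatorname{diag}\big(\kappa_\bullet(\theta_{n,i})\mathbf 1_{\{\rho(\theta_{n,i})\in J\}}\big)_{i=1}^{r_n}$. Linearization. $\mathcal X_n=\begin{pmatrix}0&X_n\\ X_n^*&0\end{pmatrix}$, $\mathcal W_n=\begin{pmatrix}0&W_n\\ W_n^*&0\end{pmatrix}$, $\mathcal E_n=\begin{pmatrix}U_n&0\\0&V_n\end{pmatrix}$, $\mathcal K_n=\begin{pmatrix}0&\Theta_n\\\Theta_n&0\end{pmatrix}$, $\mathcal G_n(\zeta)=\mathcal E_n^*(\zeta I-\mathcal X_n)^{-1}\mathcal E_n$, $\mathcal M(\zeta)=\begin{pmatrix}\phi(\zeta)I_{r_n}&0\\0&\widetilde\phi(\zeta)I_{r_n}\end{pmatrix}$. Holomorphic subspace local law. For every compact $K\subset\mathbb C\setminus[-b,b]$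 there is a deterministic $\varepsilon_n(K)\downarrow0$ such that, with probability tending to one, $\sup_{\zeta\in K}\|\mathcal G_n(\zeta)-\mathcal M(\zeta)\|_{\mathrm{op}}\le\varepsilon_n(K)$. Weighted compatibility on a compact $K\subset\mathbb C\setminus[-b,b]$: $\sup_{\zeta\in K}\big(\|(\mathcal G_n(\zeta)-\mathcal M(\zeta))\mathcal K_n\|_{\mathrm{op}}+\|\mathcal K_n(\mathcal G_n(\zeta)-\mathcal M(\zeta))\|_{\mathrm{op}}\big)\to0$ in probability. (Suprema are $+\infty$ if $\mathcal G_n$ is undefined somewhere on $K$.) Empirical projectors. Let $\widehat u_{n,j},\widehat v_{n,j}$ be paired left/right singular vectors of $W_n$ for $\sigma_j(W_n)$. For Borel $J\subset(0,\infty)$: $\widehat\Pi^{\mathrm L}_n(J)=\sum_{j:\sigma_j(W_n)\in J}\widehat u_{n,j}\widehat u_{n,j}^*$, $\widehat\Pi^{\mathrm R}_n(J)=\sum_{j:\sigma_j(W_n)\in J}\widehat v_{n,j}\widehat v_{n,j}^*$, $\widehat C_n(J)=\sum_{j:\sigma_j(W_n)\in J}\widehat u_{n,j}\widehat v_{n,j}^*$. Stability. Let $\Gamma$ (fixed, independent of $n$) be a positively oriented finite union of rectifiable Jordan curves and $\Omega_\Gamma$ the union of their interiors. $\Gamma$ is stable for $(\Theta_n)$ if $\overline{\Omega_\Gamma}$ is a compact subset of $\mathbb C\setminus[-b,b]$, it encloses a specified subset of the positive scalar roots $\rho(\theta_{n,i})$ ($\theta_{n,i}>\theta_\star$), and $\sup_n\sup_{\zeta\in\Gamma}\|(I_{2r_n}-\mathcal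 M(\zeta)\mathcal K_n)^{-1}\|_{\mathrm{op}}<\infty$. A compact finite union $J\subset(b,\infty)$ of intervals (of positive length) is stable if the deterministic locations stay a fixed positive distance from $\partial J$ and there is a stable contour $\Gamma$ with $\Omega_\Gamma\cap\mathbb R=\operatorname{int}J$ whose enclosed positive roots are exactly those lying in $J$. If $\Theta_n$ is random, stability means that a deterministic $\Gamma$ can be chosen for which the boundary separation and the inverse bound (with fixed constants) hold on events of probability tending to one, and the conclusions are understood on those events. *)

(* Defs.v *)
From HB Require Import structures.
From mathcomp Require Export all_boot all_order all_algebra.
From mathcomp Require Export spectral complex.
From mathcomp Require Export all_classical all_reals all_analysis.

Set Implicit Arguments.
Unset Strict Implicit.
Unset Printing Implicit Defensive.

Export Order.TTheory GRing.Theory Num.Theory.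
Export numFieldNormedType.Exports.
Local Open Scope classical_set_scope.
Local Open Scope ring_scope.
Local Open Scope sesquilinear_scope.
Local Open Scope complex_scope.

(* R[i] with its norm topology: the library attaches the topology of a
   numFieldType to the alias _^o, so sets of complex numbers are typed here. *)
Notation Cplx R := ((complex R)^o) (only parsing).

Section Scalars.
Context {R : realType}.

Definition cabs (z : R[i]) : R := complex.Re `|z|.

(* Matrices over F in {reals, complexes} are matrices over R[i] all of whose
   entries lie in [scalars F]. *)
Inductive base_field := Reals | Complexes.

Definition scalars (F : base_field) : {pred R[i]} :=
  if F is Reals then Num.real else predT.

Definition re_mx p q (A : 'M[R]_(p, q)) : 'M[R[i]]_(p, q) :=
  map_mx (real_complex R) A.

Definition l2norm p (x : 'cV[R[i]]_p) : R :=
  Num.sqrt (\sum_i cabs (x i 0) ^+ 2).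

Definition opnorm p q (A : 'M[R[i]]_(p, q)) : R :=
  sup [set l2norm (A *m x) | x in [set x : 'cV[R[i]]_q | l2norm x <= 1]].

Definition stiefel N k (Q : 'M[R[i]]_(N, k)) : Prop := Q^t* *m Q = 1%:M.

(* A = L diag(s) Q^* with orthonormal columns and nonincreasing s.  With s > 0
   this is the thin SVD (and k is the rank); with k = n <= m and s >= 0 the s j
   are the n singular values, and the columns of L and Q paired left/right
   singular vectors. *)
Definition is_svd (F : base_field) n m k (A : 'M[R[i]]_(n, m))
    (L : 'M[R[i]]_(n, k)) (s : 'rV[R]_k) (Q : 'M[R[i]]_(m, k)) : Prop :=
  [/\ L \is a mxOver (scalars F) /\ Q \is a mxOver (scalars F),
      stiefel L, stiefel Q,
      (forall i j : 'I_k, (i <= j)%N -> s 0 j <= s 0 i) &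
      A = L *m re_mx (diag_mx s) *m Q^t*].

(* Real parts of the diagonal of the spectral theorem: for Hermitian A, the
   eigenvalues with multiplicity. *)
Definition eigenvals n (A : 'M[R[i]]_n) : seq R :=
  [seq complex.Re (spectral_diag A 0 i) | i <- enum 'I_n].

Definition esd n (A : 'M[R[i]]_n) : {measure set (measurableTypeR R) -> \bar R} :=
  mscale (n%:R^-1)%:nng (msum (fun k => \d_(nth 0 (eigenvals A) k : measurableTypeR R)) n).

(* 1_J(A) for Hermitian A: A = S^-1 diag(lambda) S with S = spectralmx A. *)
Definition spectral_proj n (A : 'M[R[i]]_n) (J : set R) : 'M[R[i]]_n :=
  invmx (spectralmx A)
  *m diag_mx (\row_i (complex.Re (spectral_diag A 0 i) \in J)%:R)
  *m spectralmx A.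

End Scalars.

Section Modes.
Context {R : realType} {d : nat -> measure_display}
  {T : forall n, measurableType (d n)} (Pr : forall n, probability (T n) R).

Definition random_mx d' (S : measurableType d') p q (A : S -> 'M[R[i]]_(p, q)) :=
  forall i j, measurable_fun setT (fun w => complex.Re (A w i j)) /\
              measurable_fun setT (fun w => complex.Im (A w i j)).

(* The events involve suprema over uncountable sets and arbitrary choices of
   singular vectors, so no measurability is built in: the inner probability
   tends to one. *)
Definition with_prob_to_one (E : forall n, set (T n)) : Prop :=
  exists A : forall n, set (T n),
    [/\ forall n, measurable (A n), forall n, A n `<=` E n &
        (fun n => Pr n (A n)) @ \oo --> 1%E].

Definition cvg_in_probability (Y : forall n, T n -> R) (l : R) : Prop :=
  forall e : R, 0 < e ->
    with_prob_to_one (fun n => [set w | `|Y n w - l| <= e]).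

End Modes.

Section Transforms.
Context {R : realType} (mu : probability (measurableTypeR R) R) (c : R).

Definition msupport : set R :=
  [set x | forall U : set R, open U -> U x -> (0 < mu U)%E].

Definition edge : R := Num.sqrt (sup msupport).

(* C \ [-b, b] *)
Definition off_cut : set (Cplx R) :=
  [set z | ~ (complex.Im z = 0 /\ - edge <= complex.Re z <= edge)].

Definition cintegral (f : R -> R[i]) : R[i] :=
  (\int[mu]_x complex.Re (f x)) +i* (\int[mu]_x complex.Im (f x)).

Definition phi (z : R[i]) : R[i] := cintegral (fun x => z / (z ^+ 2 - x%:C)).

Definition phit (z : R[i]) : R[i] := c%:C * phi z + (1 - c)%:C / z.

Definition dtr (z : R[i]) : R[i] := phi z * phit z.

(* The (real) values of the transforms at real points of (b, +oo). *)
Definition phi_re (x : R) : R := complex.Re (phi x%:C).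
Definition phit_re (x : R) : R := complex.Re (phit x%:C).
Definition d_re (x : R) : R := complex.Re (dtr x%:C).

Definition d_edge : R := lim (d_re x @[x --> edge^'+]).

Definition edge_condition : Prop :=
  cvg (d_re x @[x --> edge^'+]) /\ 0 < d_edge.

Definition theta_star : R := (Num.sqrt d_edge)^-1.

Definition rho (t : R) : R :=
  if theta_star < t then xget edge [set z | edge < z /\ d_re z = (t ^+ 2)^-1]
  else edge.

Definition kappaL (t : R) : R :=
  if theta_star < t then - (2 * phi_re (rho t)) / (t ^+ 2 * derive1 d_re (rho t))
  else 0.

Definition kappaR (t : R) : R :=
  if theta_star < t then - (2 * phit_re (rho t)) / (t ^+ 2 * derive1 d_re (rho t))
  else 0.

Definition kappaLR (t : R) : R :=
  if theta_star < t then - 2 / (t ^+ 3 * derive1 d_re (rho t)) else 0.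

Definition Kdiag (kappa : R -> R) (J : set R) r (th : 'rV[R]_r) : 'M[R[i]]_r :=
  re_mx (diag_mx (\row_i (kappa (th 0 i) * (rho (th 0 i) \in J)%:R))).

Definition Mmx (r : nat) (z : R[i]) : 'M[R[i]]_(r + r) :=
  block_mx (phi z)%:M 0 0 (phit z)%:M.

End Transforms.

Section Linearization.
Context {R : realType}.

Definition lin n m (A : 'M[R[i]]_(n, m)) : 'M[R[i]]_(n + m) :=
  block_mx 0 A (A^t*) 0.

Definition Emx n m r (U : 'M[R[i]]_(n, r)) (V : 'M[R[i]]_(m, r)) :
  'M[R[i]]_(n + m, r + r) := block_mx U 0 0 V.

Definition Kmx r (th : 'rV[R]_r) : 'M[R[i]]_(r + r) :=
  block_mx 0 (re_mx (diag_mx th)) (re_mx (diag_mx th)) 0.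

Definition resolvent_defined n m (X : 'M[R[i]]_(n, m)) (z : R[i]) : Prop :=
  z%:M - lin X \in unitmx.

Definition Gmx n m r (X : 'M[R[i]]_(n, m)) (U : 'M[R[i]]_(n, r))
    (V : 'M[R[i]]_(m, r)) (z : R[i]) : 'M[R[i]]_(r + r) :=
  (Emx U V)^t* *m invmx (z%:M - lin X) *m Emx U V.

Definition PiL n k (J : set R) (s : 'rV[R]_k) (u : 'M[R[i]]_(n, k)) :
    'M[R[i]]_n :=
  \sum_(j | s 0 j \in J) col j u *m (col j u)^t*.

Definition Chat n m k (J : set R) (s : 'rV[R]_k) (u : 'M[R[i]]_(n, k))
    (v : 'M[R[i]]_(m, k)) : 'M[R[i]]_(n, m) :=
  \sum_(j | s 0 j \in J) col j u *m (col j v)^t*.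

End Linearization.

Section Contours.
Context {R : realType}.
Implicit Types (g : R -> Cplx R) (J : set R).

Definition curve_trace g : set (Cplx R) := g @` `[0, 1].

Definition jordan_curve g : Prop :=
  [/\ {within `[0, 1], continuous g}, g 0 = g 1 &
      forall s t, 0 <= s < 1 -> 0 <= t < 1 -> g s = g t -> s = t].

Definition rectifiable g : Prop :=
  exists L : R, forall s : seq R, itv_partition 0 1 s ->
    \sum_(0 <= k < size s)
      cabs (g (nth 1 (0 :: s) k.+1) - g (nth 1 (0 :: s) k)) <= L.

(* The bounded component of the complement of the curve. *)
Definition jordan_interior g : set (Cplx R) :=
  [set z | ~ curve_trace g z /\ bounded_set (connected_component (~` curve_trace g) z)].

(* A continuous argument of g - z increases by 2 pi, i.e. g winds once
   counterclockwise around every interior point. *)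
Definition positively_oriented g : Prop :=
  forall z, jordan_interior g z ->
    exists a : R -> R,
      [/\ {within `[0, 1], continuous a},
          forall t, 0 <= t <= 1 ->
            g t - z = (cabs (g t - z))%:C * (cos (a t) +i* sin (a t)) &
          a 1 - a 0 = 2 * pi].

Definition Gamma_set k (gam : 'I_k -> R -> Cplx R) : set (Cplx R) :=
  \bigcup_i curve_trace (gam i).

Definition Omega_set k (gam : 'I_k -> R -> Cplx R) : set (Cplx R) :=
  \bigcup_i jordan_interior (gam i).

Definition contour k (gam : 'I_k -> R -> Cplx R) : Prop :=
  forall i, [/\ jordan_curve (gam i), rectifiable (gam i) &
                positively_oriented (gam i)].

Definition boundary J : set R := closure J `\` interior J.

Definition compact_union_of_intervals J : Prop :=
  compact J /\
  exists s : seq (interval R),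
    (forall i, i \in s -> exists x y, [/\ x < y, x \in i & y \in i]) /\
    J = \bigcup_(i in [set` s]) [set` i].

End Contours.

Section Assumptions.
Context {R : realType} {d : nat -> measure_display}
  {T : forall n, measurableType (d n)} (Pr : forall n, probability (T n) R)
  (m : nat -> nat) (mu : probability (measurableTypeR R) R) (c : R).
Unset Implicit Arguments.
Context (X : forall n, T n -> 'M[R[i]]_(n, m n)) (r : forall n, T n -> nat)
  (U : forall n (w : T n), 'M[R[i]]_(n, r n w))
  (V : forall n (w : T n), 'M[R[i]]_(m n, r n w))
  (theta : forall n (w : T n), 'rV[R]_(r n w)).
Set Implicit Arguments.

Definition global_noise_law : Prop :=
  [/\ mu [set x | x < 0] = 0%E, compact (msupport mu),
      (forall f : R -> R, continuous f -> bounded_fun f ->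
         cvg_in_probability Pr
           (fun n w => \int[esd (X n w *m (X n w)^t*)]_x f x) (\int[mu]_x f x)) &
      cvg_in_probability Pr (fun n w => opnorm (X n w)) (edge mu)].

(* A supremum over K that is +oo when the resolvent is undefined somewhere on K
   is bounded by e iff, for all z in K, the resolvent is defined and the bound
   holds. *)
Definition subspace_local_law : Prop :=
  forall K : set (Cplx R), compact K -> K `<=` off_cut mu ->
    exists eps : nat -> R,
      [/\ forall n, 0 <= eps n, eps @ \oo --> (0 : R) &
          with_prob_to_one Pr (fun n => [set w | forall z, K z ->
            resolvent_defined (X n w) z /\
            opnorm (Gmx (X n w) (U n w) (V n w) z - Mmx mu c (r n w) z) <= eps n])].

Definition weighted_compatibility (K : set (Cplx R)) : Prop :=
  forall e : R, 0 < e ->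
    with_prob_to_one Pr (fun n => [set w | forall z, K z ->
      resolvent_defined (X n w) z /\
      opnorm ((Gmx (X n w) (U n w) (V n w) z - Mmx mu c (r n w) z) *m Kmx (theta n w)) +
      opnorm (Kmx (theta n w) *m (Gmx (X n w) (U n w) (V n w) z - Mmx mu c (r n w) z))
        <= e]).

(* The curves and the constants delta, B are deterministic; theta may be random.
   For deterministic theta the event is everything or empty, so it is required
   to be everything for all large n, as is the case when the bounds hold
   uniformly in n. *)
Definition stable (J : set R) k (gam : 'I_k -> R -> Cplx R) : Prop :=
  [/\ contour gam,
      compact (closure (Omega_set gam)) /\
        closure (Omega_set gam) `<=` off_cut mu,
      [set x : R | Omega_set gam x%:C] = interior J &
      exists delta B : R, 0 < delta /\
        with_prob_to_one Pr (fun n => [set w |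
          [/\ forall i x, boundary J x ->
                delta <= `|rho mu c (theta n w 0 i) - x|,
              forall i, theta_star mu c < theta n w 0 i ->
                (Omega_set gam (rho mu c (theta n w 0 i))%:C <->
                 J (rho mu c (theta n w 0 i))) &
              forall z, Gamma_set gam z ->
                1%:M - Mmx mu c (r n w) z *m Kmx (theta n w) \in unitmx /\
                opnorm (invmx (1%:M - Mmx mu c (r n w) z *m Kmx (theta n w)))
                  <= B]])].

End Assumptions.

(* Main.v *)
(* The linearisation A of W is the linearisation of X plus E K E^*, so the
   compressed resolvent H = E^* (z - A)^-1 E solves (1 - G K) H = G.  Its limit
   H0 = (1 - M K)^-1 M decouples into 2 x 2 blocks of determinant
   1 - theta^2 d(z), which stay away from 0, relative to 1 + theta^2, off the
   real axis and, on the real axis, at a distance from the roots rho(theta).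
   The weighted bound on (G - M) K passes from the contour to its interior by
   the maximum principle.  Hence A has no eigenvalue near the boundary of J and
   H is close to H0.  Away from the boundary of J, the indicator of J is
   approximated by a Riemann sum over J of Poisson kernels of small width eta,
   so the spectral projector of A is a combination of resolvents at finitely
   many points y + i eta; each block of H0 has a simple pole at rho(theta), whose
   residue is half of the kappas.  Singular values are counted by comparing
   ranks: E^* is bounded below on the range of the projector, and the limit is a
   rank one block for each i with rho(theta_i) in J. *)
Require Import Defs.
From mathcomp Require Import ring lra.
Set Implicit Arguments.
Unset Strict Implicit.
Unset Printing Implicit Defensive.
Local Open Scope classical_set_scope.
Local Open Scope ring_scope.
Local Open Scope sesquilinear_scope.
Local Open Scope complex_scope.

(** The ranks and the values theta are unbounded, so every estimate must be uniform in both. This is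
    why determinants are bounded below relative to 1 + theta^2: then (1 - M K)^-1 and K (1 - M K)^-1
    both stay bounded, though K does not. The off-diagonal entries of H0 need one more remark: theta
    d / (1 - theta^2 d) and theta^-1 / (1 - theta^2 d) differ by the real number theta^-1, and only
    imaginary parts enter the Poisson kernels. Nonreal points are convenient because the norm of (z
    - A)^-1 is at most |Im z|^-1 there, whatever the spectrum of A, so the identity for H bounds H -
    H0 at once. All thresholds are chosen before the dimensions, the rank and the matrices. The
    width eta and the nodes depend only on the target precision and on the limiting data; the
    tolerance in the local laws is chosen after them, because the bounds at the nodes degenerate as
    eta tends to 0. Probability enters only at the end, through events on which all the estimates
    hold with a given tolerance. *)

Local Notation Re := complex.Re.
Local Notation Im := complex.Im.

(** * Euclidean and operator norms *)

Section Modulus.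
Context {R : realType}.
Implicit Types z w : R[i].

Lemma cabsC z : (cabs z)%:C = `|z|.
Proof. by rewrite /cabs normc_def. Qed.

Lemma cabsE z : cabs z = Num.sqrt (Re z ^+ 2 + Im z ^+ 2).
Proof. by rewrite /cabs normc_def. Qed.

Lemma cabs_ge0 z : 0 <= cabs z.
Proof. by rewrite cabsE sqrtr_ge0. Qed.

Lemma sqr_cabs z : cabs z ^+ 2 = Re z ^+ 2 + Im z ^+ 2.
Proof. by rewrite cabsE sqr_sqrtr // addr_ge0 ?sqr_ge0. Qed.

Lemma cabsM z w : cabs (z * w) = cabs z * cabs w.
Proof. by apply: complexI; rewrite rmorphM /= !cabsC normrM. Qed.

Lemma cabsV z : cabs z^-1 = (cabs z)^-1.
Proof. by apply: complexI; rewrite fmorphV /= !cabsC normfV. Qed.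

Lemma cabsN z : cabs (- z) = cabs z.
Proof. by rewrite /cabs normrN. Qed.

Lemma cabsB z w : cabs (z - w) = cabs (w - z).
Proof. by rewrite -cabsN opprB. Qed.

Lemma ler_cabsD z w : cabs (z + w) <= cabs z + cabs w.
Proof. by rewrite -lecR rmorphD /= !cabsC ler_normD. Qed.

Lemma ler_cabsB z w : cabs z - cabs w <= cabs (z - w).
Proof. by rewrite lerBlDr (le_trans _ (ler_cabsD _ _)) // subrK. Qed.

Lemma cabs0 : cabs (0 : R[i]) = 0.
Proof. by rewrite /cabs normr0. Qed.

Lemma cabs1 : cabs (1 : R[i]) = 1.
Proof. by rewrite /cabs normr1. Qed.

Lemma cabsR (x : R) : cabs x%:C = `|x|.
Proof. by rewrite cabsE /= expr0n addr0 sqrtr_sqr. Qed.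

Lemma cabsX z n : cabs (z ^+ n) = cabs z ^+ n.
Proof. by elim: n => [|n IH]; rewrite ?expr0 ?cabs1 // !exprS cabsM IH. Qed.

Lemma cabs_eq0 z : (cabs z == 0) = (z == 0).
Proof. by rewrite -(inj_eq (@complexI R)) cabsC normr_eq0. Qed.

Lemma cabs_gt0 z : (0 < cabs z) = (z != 0).
Proof. by rewrite lt_def cabs_ge0 cabs_eq0 andbT. Qed.

Lemma normRe_le z : `|Re z| <= cabs z.
Proof. by rewrite -lecR cabsC normc_ge_Re. Qed.

Lemma normIm_le z : `|Im z| <= cabs z.
Proof. by rewrite cabsE -sqrtr_sqr ler_wsqrtr // lerDr sqr_ge0. Qed.

Lemma Re_le z : Re z <= cabs z.
Proof. exact: le_trans (ler_norm _) (normRe_le z). Qed.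

Lemma cabs_le_ReIm z : cabs z <= `|Re z| + `|Im z|.
Proof.
rewrite -[leRHS]ger0_norm ?addr_ge0 // -sqrtr_sqr cabsE ler_wsqrtr //.
rewrite sqrrD !real_normK ?num_real // -addrA [X in _ <= _ + X]addrC addrA.
by rewrite lerDl mulrn_wge0 // mulr_ge0.
Qed.

Lemma mulcJ z : z * (z^*)%R = (cabs z ^+ 2)%:C.
Proof. by rewrite -normCK rmorphXn /= cabsC. Qed.

Lemma ReD z w : Re (z + w) = Re z + Re w. Proof. by case: z w => [? ?] []. Qed.
Lemma ImD z w : Im (z + w) = Im z + Im w. Proof. by case: z w => [? ?] []. Qed.
Lemma ReN z : Re (- z) = - Re z. Proof. by case: z. Qed.
Lemma ImN z : Im (- z) = - Im z. Proof. by case: z. Qed.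
Lemma ReZ (a : R) z : Re (a%:C * z) = a * Re z.
Proof. by case: z => [? ?] /=; rewrite mul0r subr0. Qed.
Lemma ImZ (a : R) z : Im (a%:C * z) = a * Im z.
Proof. by case: z => [? ?] /=; rewrite mul0r addr0. Qed.
Lemma ReM z w : Re (z * w) = Re z * Re w - Im z * Im w.
Proof. by case: z w => [? ?] []. Qed.
Lemma ImM z w : Im (z * w) = Re z * Im w + Im z * Re w.
Proof. by case: z w => [? ?] []. Qed.

Lemma Re_sum (I : Type) (s : seq I) (P : pred I) (F : I -> R[i]) :
  Re (\sum_(i <- s | P i) F i) = \sum_(i <- s | P i) Re (F i).
Proof. exact: (big_morph _ ReD). Qed.

End Modulus.

Section EuclideanNorm.
Context {R : realType}.
Local Notation C := R[i].

Lemma sqr_inj (x y : R) : 0 <= x -> 0 <= y -> x ^+ 2 = y ^+ 2 -> x = y.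
Proof. by move=> x0 y0; apply: (@pexpIrn R 2). Qed.

Lemma adjmx_mul p q k (A : 'M[C]_(p, q)) (B : 'M[C]_(q, k)) :
  (A *m B)^t* = B^t* *m A^t*.
Proof. by rewrite trmx_mul map_mxM. Qed.

Definition inner p (x y : 'cV[C]_p) : C := (x^t* *m y) 0 0.

Lemma innerE p (x y : 'cV[C]_p) : inner x y = \sum_i ((x i 0)^* * y i 0)%R.
Proof. by rewrite /inner mxE; apply: eq_bigr => i _; rewrite !mxE. Qed.

Lemma inner_mulmx p q (A : 'M[C]_(p, q)) x y :
  inner x (A *m y) = inner (A^t* *m x) y.
Proof. by rewrite /inner adjmx_mul trmxCK mulmxA. Qed.

Lemma innerDr p (x y z : 'cV[C]_p) : inner x (y + z) = inner x y + inner x z.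
Proof. by rewrite /inner mulmxDr mxE. Qed.

Lemma innerDl p (x y z : 'cV[C]_p) : inner (x + y) z = inner x z + inner y z.
Proof. by rewrite /inner linearD /= map_mxD mulmxDl mxE. Qed.

Lemma innerZr p (x y : 'cV[C]_p) a : inner x (a *: y) = a * inner x y.
Proof. by rewrite /inner -scalemxAr mxE. Qed.

Lemma sqr_l2normE p (x : 'cV[C]_p) : l2norm x ^+ 2 = \sum_i cabs (x i 0) ^+ 2.
Proof. by rewrite sqr_sqrtr ?sumr_ge0 // => i _; exact: sqr_ge0. Qed.

Lemma sqr_l2norm p (x : 'cV[C]_p) : (l2norm x ^+ 2)%:C = inner x x.
Proof.
rewrite sqr_l2normE innerE rmorph_sum; apply: eq_bigr => i _.
by rewrite /= -mulcJ mulrC.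
Qed.

Lemma l2norm_ge0 p (x : 'cV[C]_p) : 0 <= l2norm x.
Proof. exact: sqrtr_ge0. Qed.

Lemma l2norm0 p : l2norm (0 : 'cV[C]_p) = 0.
Proof.
apply/eqP; rewrite -sqrf_eq0 sqr_l2normE big1 // => i _.
by rewrite mxE cabs0 expr0n.
Qed.

Lemma l2norm_eq0 p (x : 'cV[C]_p) : l2norm x = 0 -> x = 0.
Proof.
move=> h; apply/matrixP => i j; rewrite ord1 [RHS]mxE.
have := sqr_l2normE x; rewrite h expr0n /= => /esym/eqP.
rewrite psumr_eq0 => [/allP /(_ i)|k _]; last exact: sqr_ge0.
by rewrite mem_index_enum => /(_ isT); rewrite sqrf_eq0 cabs_eq0 => /eqP.
Qed.

Lemma l2norm_gt0 p (x : 'cV[C]_p) : x != 0 -> 0 < l2norm x.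
Proof.
by move=> h; rewrite lt_def l2norm_ge0 andbT; apply: contra_neq h => /l2norm_eq0.
Qed.

Lemma CauchySchwarz_inner p (x y : 'cV[C]_p) :
  cabs (inner x y) <= l2norm x * l2norm y.
Proof.
(* [dotmx] acts on row vectors and conjugates its second argument, hence the transposes and the
   swap. *)
have e (u v : 'cV[C]_p) : inner u v = dotmx v^T u^T.
  by rewrite innerE dotmxE [RHS]mxE; apply: eq_bigr => i _; rewrite !mxE mulrC.
rewrite -[leRHS]ger0_norm ?mulr_ge0 ?l2norm_ge0 // -[leLHS]ger0_norm ?cabs_ge0 //.
rewrite -ler_sqr ?nnegrE // !real_normK ?num_real // exprMn.
rewrite -lecR.
have -> : (cabs (inner x y) ^+ 2)%:C = `|dotmx y^T x^T| ^+ 2.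
  by rewrite rmorphXn /= cabsC e.
have -> : (l2norm x ^+ 2 * l2norm y ^+ 2)%:C = dotmx y^T y^T * dotmx x^T x^T.
  by rewrite -!e -!sqr_l2norm -rmorphM mulrC.
by have [] := CauchySchwarz (@dotmx C p) y^T x^T.
Qed.

Lemma ler_l2normD p (x y : 'cV[C]_p) : l2norm (x + y) <= l2norm x + l2norm y.
Proof.
rewrite -[leRHS]ger0_norm ?addr_ge0 ?l2norm_ge0 // -[leLHS]ger0_norm ?l2norm_ge0 //.
rewrite -ler_sqr ?nnegrE // !real_normK ?num_real //.
have n2 (u : 'cV[C]_p) : l2norm u ^+ 2 = Re (inner u u) by rewrite -sqr_l2norm.
have -> : l2norm (x + y) ^+ 2
  = l2norm x ^+ 2 + l2norm y ^+ 2 + Re (inner x y) + Re (inner y x).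
  rewrite !n2 innerDr !innerDl !ReD addrACA -[RHS]addrA [RHS]addrACA.
  by congr (_ + _); exact: addrC.
have h1 := le_trans (Re_le _) (CauchySchwarz_inner x y).
have h2 := le_trans (Re_le _) (CauchySchwarz_inner y x).
by rewrite sqrrD; lra.
Qed.

Lemma l2normZ p (x : 'cV[C]_p) a : l2norm (a *: x) = cabs a * l2norm x.
Proof.
apply: sqr_inj; rewrite ?mulr_ge0 ?cabs_ge0 ?l2norm_ge0 //.
rewrite exprMn !sqr_l2normE mulr_sumr; apply: eq_bigr => i _.
by rewrite mxE cabsM exprMn.
Qed.

Lemma l2normN p (x : 'cV[C]_p) : l2norm (- x) = l2norm x.
Proof. by rewrite -scaleN1r l2normZ cabsN cabs1 mul1r. Qed.

Lemma l2norm_isometry p q (Q : 'M[C]_(p, q)) (x : 'cV[C]_q) :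
  stiefel Q -> l2norm (Q *m x) = l2norm x.
Proof.
move=> hQ; apply: sqr_inj; rewrite ?l2norm_ge0 //.
by apply: complexI; rewrite !sqr_l2norm inner_mulmx mulmxA hQ mul1mx.
Qed.

End EuclideanNorm.

Section OperatorNorm.
Context {R : realType}.
Local Notation C := R[i].

(** Makes the [sup] in [opnorm] meaningful. Every coordinate of a vector of the unit ball has
    modulus at most 1, so the sum of the norms of the columns is an upper bound. *)
Lemma opnorm_has_sup p q (A : 'M[C]_(p, q)) :
  has_sup [set l2norm (A *m x) | x in [set x : 'cV[C]_q | l2norm x <= 1]].
Proof.
split; first by exists (l2norm (A *m 0)), 0 => //=; rewrite l2norm0.
exists (\sum_j l2norm (col j A)) => _ [x /= x1 <-].
have -> : A *m x = \sum_j x j 0 *: col j A.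
  apply/matrixP => i j; rewrite ord1 mxE summxE; apply: eq_bigr => k _.
  by rewrite !mxE mulrC.
have : l2norm (\sum_j x j 0 *: col j A) <= \sum_j l2norm (x j 0 *: col j A).
  elim/big_ind2: _ => [|u v a b hu ha|//]; first by rewrite l2norm0.
  exact: le_trans (ler_l2normD _ _) (lerD hu ha).
move=> /le_trans; apply; apply: ler_sum => j _; rewrite l2normZ.
rewrite ler_piMl ?l2norm_ge0 // (le_trans _ x1) //.
rewrite -[leLHS]ger0_norm ?cabs_ge0 // -sqrtr_sqr ler_wsqrtr //.
by rewrite (bigD1 j) //= lerDl sumr_ge0 // => i _; rewrite sqr_ge0.
Qed.

Lemma opnormP p q (A : 'M[C]_(p, q)) x : l2norm (A *m x) <= opnorm A * l2norm x.
Proof.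
have [->|x0] := eqVneq x 0; first by rewrite mulmx0 !l2norm0 mulr0.
have xp := l2norm_gt0 x0.
rewrite -ler_pdivrMr //; apply: ub_le_sup; first by have [] := opnorm_has_sup A.
exists ((l2norm x)^-1%:C *: x); last first.
  by rewrite -scalemxAr l2normZ cabsR gtr0_norm ?invr_gt0 // mulrC.
by rewrite /= l2normZ cabsR gtr0_norm ?invr_gt0 // mulVf ?gt_eqF.
Qed.

Lemma opnorm_le p q (A : 'M[C]_(p, q)) c : 0 <= c ->
  (forall x, l2norm (A *m x) <= c * l2norm x) -> opnorm A <= c.
Proof.
move=> c0 h; apply: ge_sup; first by have [] := opnorm_has_sup A.
move=> _ [x /= x1 <-]; apply: le_trans (h x) _.
by rewrite ler_piMr.
Qed.

Lemma opnorm_ge0 p q (A : 'M[C]_(p, q)) : 0 <= opnorm A.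
Proof.
apply: ub_le_sup; first by have [] := opnorm_has_sup A.
by exists 0; rewrite /= ?mulmx0 l2norm0.
Qed.

Lemma opnorm0 p q : opnorm (0 : 'M[C]_(p, q)) = 0.
Proof.
apply/eqP; rewrite eq_le opnorm_ge0 andbT; apply: opnorm_le => // x.
by rewrite mul0mx l2norm0 mul0r.
Qed.

Lemma ler_opnormD p q (A B : 'M[C]_(p, q)) : opnorm (A + B) <= opnorm A + opnorm B.
Proof.
apply: opnorm_le => [|x]; first by rewrite addr_ge0 ?opnorm_ge0.
by rewrite mulmxDl mulrDl (le_trans (ler_l2normD _ _)) // lerD ?opnormP.
Qed.

Lemma ler_opnorm_sum p q (I : Type) (s : seq I) (P : pred I)
    (F : I -> 'M[C]_(p, q)) :
  opnorm (\sum_(i <- s | P i) F i) <= \sum_(i <- s | P i) opnorm (F i).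
Proof.
elim/big_ind2: _ => [|u v x y hu hx|//]; first by rewrite opnorm0.
exact: le_trans (ler_opnormD _ _) (lerD hu hx).
Qed.

Lemma ler_opnormM p q k (A : 'M[C]_(p, q)) (B : 'M[C]_(q, k)) :
  opnorm (A *m B) <= opnorm A * opnorm B.
Proof.
apply: opnorm_le => [|x]; first by rewrite mulr_ge0 ?opnorm_ge0.
rewrite -mulmxA -mulrA (le_trans (opnormP _ _)) //.
by rewrite ler_wpM2l ?opnorm_ge0 ?opnormP.
Qed.

Lemma opnormM_le p q k (A : 'M[C]_(p, q)) (B : 'M[C]_(q, k)) a b :
  opnorm A <= a -> opnorm B <= b -> opnorm (A *m B) <= a * b.
Proof.
move=> ha hb; apply: le_trans (ler_opnormM _ _) _.
by apply: ler_pM => //; exact: opnorm_ge0.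
Qed.

Lemma opnormZ_le p q (A : 'M[C]_(p, q)) a : opnorm (a *: A) <= cabs a * opnorm A.
Proof.
apply: opnorm_le => [|x]; first by rewrite mulr_ge0 ?cabs_ge0 ?opnorm_ge0.
by rewrite -scalemxAl l2normZ -mulrA ler_wpM2l ?cabs_ge0 ?opnormP.
Qed.

Lemma opnormN p q (A : 'M[C]_(p, q)) : opnorm (- A) = opnorm A.
Proof.
have h (B : 'M[C]_(p, q)) : opnorm (- B) <= opnorm B.
  by rewrite -scaleN1r (le_trans (opnormZ_le _ _)) // cabsN cabs1 mul1r.
apply: le_anti; apply/andP; split; first exact: h.
by have := h (- A); rewrite opprK; exact.
Qed.

Lemma opnorm_isometry p q (Q : 'M[C]_(p, q)) : stiefel Q -> opnorm Q <= 1.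
Proof. by move=> hQ; apply: opnorm_le => // x; rewrite l2norm_isometry ?mul1r. Qed.

(** The square of the norm of A^* x is the inner product of x with A A^* x, hence at most |x| times
    the norm of A times |A^* x|; one factor |A^* x| cancels. *)
Lemma opnorm_adj p q (A : 'M[C]_(p, q)) : opnorm (A^t*) <= opnorm A.
Proof.
apply: opnorm_le => [|x]; first exact: opnorm_ge0.
have [->|y0] := eqVneq (A^t* *m x) 0.
  by rewrite l2norm0 mulr_ge0 ?opnorm_ge0 ?l2norm_ge0.
have yp := l2norm_gt0 y0; rewrite -(ler_pM2r yp) -expr2.
have -> : l2norm (A^t* *m x) ^+ 2 = Re (inner x (A *m (A^t* *m x))).
  by rewrite inner_mulmx -sqr_l2norm.
apply: le_trans (Re_le _) _; apply: le_trans (CauchySchwarz_inner _ _) _.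
by rewrite mulrAC mulrC ler_wpM2r ?l2norm_ge0 ?opnormP.
Qed.

Lemma opnorm_diag_le n (s : 'rV[C]_n) c : 0 <= c ->
  (forall i, cabs (s 0 i) <= c) -> opnorm (diag_mx s) <= c.
Proof.
move=> c0 h; apply: opnorm_le => // x.
rewrite -[leRHS]ger0_norm ?mulr_ge0 ?l2norm_ge0 // -[leLHS]ger0_norm ?l2norm_ge0 //.
rewrite -ler_sqr ?nnegrE // !real_normK ?num_real // exprMn !sqr_l2normE mulr_sumr.
apply: ler_sum => i _; rewrite mul_diag_mx mxE cabsM exprMn.
by rewrite ler_wpM2r ?sqr_ge0 // ler_sqr ?nnegrE ?cabs_ge0.
Qed.

End OperatorNorm.

(** * Functional calculus of Hermitian matrices *)

(* Unification would otherwise unfold the spectral theorem. *)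
Opaque spectralmx spectral_diag.

Section FunctionalCalculus.
Context {R : realType}.
Local Notation C := R[i].

Definition spec n (A : 'M[C]_n) (i : 'I_n) : R := Re (spectral_diag A 0 i).

Definition diag_conj n (S : 'M[C]_n) (s : 'rV[C]_n) := invmx S *m diag_mx s *m S.

Lemma diag_conjD n (S : 'M[C]_n) s t :
  diag_conj S s + diag_conj S t = diag_conj S (s + t).
Proof. by rewrite /diag_conj -mulmxDl -mulmxDr -raddfD. Qed.

Lemma diag_conjZ n (S : 'M[C]_n) a s : a *: diag_conj S s = diag_conj S (a *: s).
Proof. by rewrite /diag_conj scalemxAl scalemxAr -linearZ. Qed.

Lemma diag_conj_cst n (S : 'M[C]_n) a : S \in unitmx ->
  diag_conj S (const_mx a) = a%:M.
Proof.
move=> hS; rewrite /diag_conj diag_const_mx -mulmxA mul_scalar_mx -scalemxAr.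
by rewrite mulVmx // scalemx1.
Qed.

Lemma diag_conjM n (S : 'M[C]_n) s t : S \in unitmx ->
  diag_conj S s *m diag_conj S t = diag_conj S (\row_i (s 0 i * t 0 i)).
Proof.
by move=> hS; rewrite /diag_conj -mulmx_diag !mulmxA mulmxK.
Qed.

Lemma diag_conj_adj n (S : 'M[C]_n) s : S \is unitarymx ->
  (diag_conj S s)^t* = diag_conj S (map_mx Num.conj_op s).
Proof.
move=> hS; rewrite /diag_conj !adjmx_mul invmx_unitary // trmxCK mulmxA.
by rewrite tr_diag_mx map_diag_mx.
Qed.

Lemma opnorm_diag_conj_le n (S : 'M[C]_n) (s : 'rV[C]_n) (c : R) : S \is unitarymx -> 0 <= c ->
  (forall i, cabs (s 0 i) <= c) -> opnorm (diag_conj S s) <= c.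
Proof.
move=> hS c0 h; rewrite /diag_conj invmx_unitary //.
have h1 : stiefel (S^t*) by rewrite /stiefel trmxCK; exact/unitarymxP.
have h2 : stiefel S by rewrite /stiefel -invmx_unitary // mulVmx ?unitarymx_unit.
rewrite -[c]mulr1 -[c]mul1r; apply: opnormM_le; last exact/opnorm_isometry.
apply: opnormM_le; first exact/opnorm_isometry.
exact: opnorm_diag_le.
Qed.

(** The functional calculus in the eigenbasis. The algebraic rules below hold for any [A], as they
    only use that [spectralmx A] is unitary; that the identity function gives back [A] requires [A]
    to be Hermitian. *)
Definition fcalc n (A : 'M[C]_n) (g : R -> C) : 'M[C]_n :=
  diag_conj (spectralmx A) (\row_i g (spec A i)).

Lemma eq_fcalc n (A : 'M[C]_n) f g :
  (forall i, f (spec A i) = g (spec A i)) -> fcalc A f = fcalc A g.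
Proof.
by move=> h; apply: (congr1 (diag_conj _)); apply/rowP => i; rewrite !mxE.
Qed.

Lemma fcalcD n (A : 'M[C]_n) f g :
  fcalc A f + fcalc A g = fcalc A (fun x => f x + g x).
Proof.
by rewrite diag_conjD; apply: (congr1 (diag_conj _)); apply/rowP => i; rewrite !mxE.
Qed.

Lemma fcalcZ n (A : 'M[C]_n) a f :
  a *: fcalc A f = fcalc A (fun x => a * f x).
Proof.
by rewrite diag_conjZ; apply: (congr1 (diag_conj _)); apply/rowP => i; rewrite !mxE.
Qed.

Lemma fcalcB n (A : 'M[C]_n) f g :
  fcalc A f - fcalc A g = fcalc A (fun x => f x - g x).
Proof.
rewrite -scaleN1r fcalcZ fcalcD; apply: eq_fcalc => i.
by rewrite mulN1r.
Qed.

Lemma fcalc_cst n (A : 'M[C]_n) a : fcalc A (fun=> a) = a%:M.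
Proof.
by rewrite -(diag_conj_cst a (spectral_unit A)); apply: (congr1 (diag_conj _)); apply/rowP => i; rewrite !mxE.
Qed.

Lemma fcalc_sum n (A : 'M[C]_n) (I : Type) (s : seq I) (P : pred I)
    (f : I -> R -> C) :
  \sum_(i <- s | P i) fcalc A (f i) = fcalc A (fun x => \sum_(i <- s | P i) f i x).
Proof.
elim: s => [|i s IH].
  rewrite big_nil (@eq_fcalc _ A _ (fun=> 0)) => [|k]; last by rewrite big_nil.
  by rewrite fcalc_cst raddf0.
rewrite big_cons; case: ifP => Pi.
  by rewrite IH fcalcD; apply: eq_fcalc => k; rewrite big_cons Pi.
by rewrite IH; apply: eq_fcalc => k; rewrite big_cons Pi.
Qed.

Lemma fcalcM n (A : 'M[C]_n) f g :
  fcalc A f *m fcalc A g = fcalc A (fun x => f x * g x).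
Proof.
rewrite /fcalc (diag_conjM _ _ (spectral_unit A)).
apply: (congr1 (diag_conj _)).
by apply/rowP => i; rewrite !mxE.
Qed.

Lemma fcalc_adj n (A : 'M[C]_n) f :
  (fcalc A f)^t* = fcalc A (fun x => (f x)^*)%R.
Proof.
rewrite /fcalc (diag_conj_adj _ (spectral_unitarymx A)).
apply: (congr1 (diag_conj _)).
by apply/rowP => i; rewrite !mxE.
Qed.

Lemma opnorm_fcalc_le n (A : 'M[C]_n) f c : 0 <= c ->
  (forall i, cabs (f (spec A i)) <= c) -> opnorm (fcalc A f) <= c.
Proof.
move=> c0 h; apply: opnorm_diag_conj_le => // [|i]; last by rewrite mxE.
exact: spectral_unitarymx.
Qed.

Section Hermitian.
Context {n : nat} (A : 'M[C]_n) (hA : A^t* = A).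

Let hermA : A \is hermsymmx.
Proof. by apply/is_hermitianmxP; rewrite expr0 scale1r hA. Qed.

Lemma fcalc_id : fcalc A (fun x => x%:C) = A.
Proof.
have /orthomx_spectralP {2}-> := hermitian_normalmx hermA.
apply: (congr1 (diag_conj _)); apply/rowP => i; rewrite mxE.
have /mxOverP /(_ 0 i) := hermitian_spectral_diag_real hermA.
exact: RRe_real.
Qed.

Lemma subr_fcalc z : z%:M - A = fcalc A (fun x => z - x%:C).
Proof. by rewrite -[in LHS]fcalc_id -(fcalc_cst A z) fcalcB. Qed.

Lemma resolvent_inverse z : (forall i, z != (spec A i)%:C) ->
  (z%:M - A) *m fcalc A (fun x => (z - x%:C)^-1) = 1%:M.
Proof.
move=> h; rewrite subr_fcalc fcalcM -(fcalc_cst A); apply: eq_fcalc => i.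
by rewrite mulfV // subr_eq0.
Qed.

Lemma resolvent_unit z : (forall i, z != (spec A i)%:C) -> z%:M - A \in unitmx.
Proof. by move=> /resolvent_inverse /mulmx1_unit []. Qed.

Lemma resolventE z : (forall i, z != (spec A i)%:C) ->
  invmx (z%:M - A) = fcalc A (fun x => (z - x%:C)^-1).
Proof.
move=> h; rewrite -[LHS]mulmx1 -(resolvent_inverse h) mulmxA.
by rewrite mulVmx ?resolvent_unit // mul1mx.
Qed.

(** Evaluates f(A) on eigenvectors given independently of [spectralmx], such as singular vectors. In
    the eigenbasis the hypothesis says that an entry (i, j) vanishes unless the i-th eigenvalue
    equals [s 0 j], and there the two values of f agree. *)
Lemma fcalc_eigen p (Z : 'M[C]_(n, p)) (s : 'rV[R]_p) f :
  A *m Z = Z *m diag_mx (\row_j (s 0 j)%:C) ->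
  fcalc A f *m Z = Z *m diag_mx (\row_j f (s 0 j)).
Proof.
move=> hZ; pose S := spectralmx A; pose Y := S *m Z.
have ZY : Z = invmx S *m Y by rewrite mulKmx ?spectral_unit.
have hY : diag_mx (\row_i (spec A i)%:C) *m Y = Y *m diag_mx (\row_j (s 0 j)%:C).
  have SA : S *m A = diag_mx (\row_i (spec A i)%:C) *m S.
    rewrite -{1}fcalc_id /fcalc /diag_conj -mulmxA.
    exact: mulKVmx (spectral_unit A) _.
  by rewrite /Y -mulmxA -hZ !mulmxA SA.
rewrite /fcalc /diag_conj -[LHS]mulmxA -/S -/Y [in RHS]ZY; clearbody Y.
rewrite -!mulmxA; apply: (congr1 (mulmx _)).
apply/matrixP => i j; have /matrixP /(_ i j) := hY.
rewrite mul_diag_mx mul_mx_diag mul_diag_mx mul_mx_diag !mxE.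
have [-> _|y0] := eqVneq (Y i j) 0; first by rewrite mulr0 mul0r.
by rewrite mulrC => /(mulfI y0) /complexI ->; rewrite mulrC.
Qed.

Lemma spec_eigenvector i :
  exists2 v : 'cV[C]_n, v != 0 & A *m v = (spec A i)%:C *: v.
Proof.
exists (col i (invmx (spectralmx A))).
  apply/eqP => h; have := congr1 (fun B => spectralmx A *m B) h.
  rewrite mulmx0 colE mulmxA mulmxV ?spectral_unit // mul1mx => /matrixP /(_ i 0).
  by rewrite !mxE !eqxx => /eqP; rewrite oner_eq0.
rewrite -{1}fcalc_id /fcalc /diag_conj colE -!mulmxA.
rewrite [spectralmx A *m _]mulmxA mulmxV ?spectral_unit // mul1mx scalemxAr.
apply: (congr1 (mulmx _)).
apply/matrixP => k j; rewrite ord1 mul_diag_mx !mxE.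
by case: eqP => [->|_]; rewrite ?mulr0.
Qed.

Lemma unit_spec z : z%:M - A \in unitmx -> forall i, z != (spec A i)%:C.
Proof.
move=> h i; apply/eqP => zE; have [v v0 hv] := spec_eigenvector i.
move/eqP: v0; apply; rewrite -[v](mulKmx h) mulmxBl hv zE mul_scalar_mx.
by rewrite subrr mulmx0.
Qed.

Lemma nonreal_spec z : Im z != 0 -> forall i, z != (spec A i)%:C.
Proof. by move=> h i; apply: contra_neq h => ->. Qed.

Lemma opnorm_resolvent_le z : Im z != 0 -> opnorm (invmx (z%:M - A)) <= `|Im z|^-1.
Proof.
move=> h; rewrite resolventE; last exact: nonreal_spec.
apply: opnorm_fcalc_le => [|i]; first by rewrite invr_ge0.
have hz : cabs (z - (spec A i)%:C) >= `|Im z|.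
  by apply: le_trans (normIm_le _); rewrite ImD ImN /= subr0.
have z0 : 0 < `|Im z| by rewrite normr_gt0.
by rewrite cabsV lef_pV2 // posrE (lt_le_trans z0).
Qed.

End Hermitian.

End FunctionalCalculus.

Section BlockNorm.
Context {R : realType}.
Local Notation C := R[i].

Lemma sqr_l2norm_col_mx p q (x : 'cV[C]_p) (y : 'cV[C]_q) :
  l2norm (col_mx x y) ^+ 2 = l2norm x ^+ 2 + l2norm y ^+ 2.
Proof.
rewrite !sqr_l2normE big_split_ord /=.
by congr (_ + _); apply: eq_bigr => i _; rewrite ?col_mxEu ?col_mxEd.
Qed.

Lemma opnorm_row_mx p q1 q2 (A : 'M[C]_(p, q1)) (B : 'M[C]_(p, q2)) :
  opnorm (row_mx A B) <= opnorm A + opnorm B.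
Proof.
apply: opnorm_le => [|x]; first by rewrite addr_ge0 ?opnorm_ge0.
have hx := @sqr_l2norm_col_mx q1 q2.
rewrite -[x]vsubmxK mul_row_col mulrDl.
apply: le_trans (ler_l2normD _ _) _; apply: lerD;
  (apply: le_trans (opnormP _ _) _; rewrite ler_wpM2l ?opnorm_ge0 //);
  rewrite -[leRHS]ger0_norm ?l2norm_ge0 // -[leLHS]ger0_norm ?l2norm_ge0 //;
  by rewrite -ler_sqr ?nnegrE // !real_normK ?num_real // hx ?lerDl ?lerDr sqr_ge0.
Qed.

Lemma opnorm_col_mx p1 p2 q (A : 'M[C]_(p1, q)) (B : 'M[C]_(p2, q)) :
  opnorm (col_mx A B) <= opnorm A + opnorm B.
Proof.
rewrite -[col_mx A B]trmxCK; apply: le_trans (opnorm_adj _) _.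
rewrite tr_col_mx map_row_mx; apply: le_trans (opnorm_row_mx _ _) _.
by apply: lerD; exact: opnorm_adj.
Qed.

Lemma opnorm_block_mx p1 p2 q1 q2 (A : 'M[C]_(p1, q1)) (B : 'M[C]_(p1, q2))
    (A' : 'M[C]_(p2, q1)) (B' : 'M[C]_(p2, q2)) :
  opnorm (block_mx A B A' B') <= opnorm A + opnorm B + (opnorm A' + opnorm B').
Proof.
by apply: le_trans (opnorm_col_mx _ _) _; apply: lerD; exact: opnorm_row_mx.
Qed.

Lemma stiefel_col_mx10 p q : stiefel (col_mx 1%:M 0 : 'M[C]_(p + q, p)).
Proof.
by rewrite /stiefel tr_col_mx map_row_mx mul_row_col trmx1 map_mx1 mul1mx mulmx0 addr0.
Qed.

Lemma stiefel_col_mx01 p q : stiefel (col_mx 0 1%:M : 'M[C]_(p + q, q)).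
Proof.
by rewrite /stiefel tr_col_mx map_row_mx mul_row_col trmx1 map_mx1 mul1mx mulmx0 add0r.
Qed.

Lemma opnorm_submx_le p q p' q' (L : 'M[C]_(p', p)) (Q : 'M[C]_(q', q))
    (A : 'M[C]_(p', q')) :
  stiefel L -> stiefel Q -> opnorm (L^t* *m A *m Q) <= opnorm A.
Proof.
move=> hL hQ; rewrite -[leRHS]mulr1 -[opnorm A]mul1r.
apply: opnormM_le; last exact: opnorm_isometry.
by apply: opnormM_le => //; exact: le_trans (opnorm_adj _) (opnorm_isometry hL).
Qed.

(** Each block is a compression of the whole matrix by coordinate isometries, and compressions do
    not increase the norm. *)
Lemma opnorm_ulsub p1 p2 q1 q2 (A : 'M[C]_(p1, q1)) (B : 'M[C]_(p1, q2))
    (A' : 'M[C]_(p2, q1)) (B' : 'M[C]_(p2, q2)) :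
  [/\ opnorm A <= opnorm (block_mx A B A' B'),
      opnorm B <= opnorm (block_mx A B A' B') &
      opnorm B' <= opnorm (block_mx A B A' B')].
Proof.
have h := opnorm_submx_le (block_mx A B A' B').
have e := (tr_col_mx, map_row_mx, trmx1, map_mx1, trmx0, map_mx0, mul_row_block,
  mul1mx, mul0mx, addr0, add0r, mul_row_col, mulmx1, mulmx0).
split.
- by have := h _ _ _ _ (stiefel_col_mx10 _ _) (stiefel_col_mx10 _ _); rewrite !e.
- by have := h _ _ _ _ (stiefel_col_mx10 _ _) (stiefel_col_mx01 _ _); rewrite !e.
- by have := h _ _ _ _ (stiefel_col_mx01 _ _) (stiefel_col_mx01 _ _); rewrite !e.
Qed.

End BlockNorm.

Section DiagonalBlocks.
Context {R : realType} {r : nat}.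
Local Notation C := R[i].
Implicit Types a b c d : 'I_r -> C.

(** Up to a permutation of the indices this is a direct sum of r matrices of size 2 x 2, so products
    and inverses are computed separately for each index. *)
Definition dblock a b c d : 'M[C]_(r + r) :=
  block_mx (diag_mx (\row_i a i)) (diag_mx (\row_i b i))
           (diag_mx (\row_i c i)) (diag_mx (\row_i d i)).

Lemma eq_dblock a b c d a' b' c' d' : a =1 a' -> b =1 b' -> c =1 c' -> d =1 d' ->
  dblock a b c d = dblock a' b' c' d'.
Proof. by move=> /funext-> /funext-> /funext-> /funext->. Qed.

Lemma dblockD a b c d a' b' c' d' :
  dblock a b c d + dblock a' b' c' d' =
  dblock (fun i => a i + a' i) (fun i => b i + b' i) (fun i => c i + c' i)
         (fun i => d i + d' i).
Proof.
rewrite /dblock add_block_mx -!raddfD.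
by congr block_mx; congr diag_mx; apply/rowP => i; rewrite !mxE.
Qed.

Lemma dblockZ (x : C) a b c d :
  x *: dblock a b c d =
  dblock (fun i => x * a i) (fun i => x * b i) (fun i => x * c i) (fun i => x * d i).
Proof.
rewrite /dblock scale_block_mx -!linearZ.
by congr block_mx; congr diag_mx; apply/rowP => i; rewrite !mxE.
Qed.

Lemma dblockB a b c d a' b' c' d' :
  dblock a b c d - dblock a' b' c' d' =
  dblock (fun i => a i - a' i) (fun i => b i - b' i) (fun i => c i - c' i)
         (fun i => d i - d' i).
Proof.
rewrite -scaleN1r dblockZ dblockD.
by apply: eq_dblock => i; rewrite mulN1r.
Qed.

Lemma dblockM a b c d a' b' c' d' :
  dblock a b c d *m dblock a' b' c' d' =
  dblock (fun i => a i * a' i + b i * c' i) (fun i => a i * b' i + b i * d' i)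
         (fun i => c i * a' i + d i * c' i) (fun i => c i * b' i + d i * d' i).
Proof.
rewrite /dblock mulmx_block !mulmx_diag -!raddfD.
by congr block_mx; congr diag_mx; apply/rowP => i; rewrite !mxE.
Qed.

Lemma dblock0 : dblock (fun=> 0) (fun=> 0) (fun=> 0) (fun=> 0) = 0.
Proof.
rewrite /dblock (_ : \row_ _ 0 = 0); last by apply/rowP => i; rewrite !mxE.
by rewrite raddf0 block_mx0.
Qed.

Lemma dblock_sum (I : Type) (s : seq I) (P : pred I) (a b c d : I -> 'I_r -> C) :
  \sum_(k <- s | P k) dblock (a k) (b k) (c k) (d k) =
  dblock (fun i => \sum_(k <- s | P k) a k i) (fun i => \sum_(k <- s | P k) b k i)
         (fun i => \sum_(k <- s | P k) c k i) (fun i => \sum_(k <- s | P k) d k i).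
Proof.
elim: s => [|k s IH].
  by rewrite big_nil -dblock0; apply: eq_dblock => i; rewrite big_nil.
rewrite big_cons; case: ifP => Pk; last first.
  by rewrite IH; apply: eq_dblock => i; rewrite big_cons Pk.
by rewrite IH dblockD; apply: eq_dblock => i; rewrite big_cons Pk.
Qed.

Lemma dblock1 : dblock (fun=> 1) (fun=> 0) (fun=> 0) (fun=> 1) = 1%:M.
Proof.
rewrite /dblock (_ : \row_ _ 1 = const_mx 1); last by apply/rowP => i; rewrite !mxE.
rewrite (_ : \row_ _ 0 = 0); last by apply/rowP => i; rewrite !mxE.
by rewrite diag_const_mx raddf0 -scalar_mx_block.
Qed.

Lemma opnorm_dblock_le a b c d (x : R) : 0 <= x ->
  (forall i, [/\ cabs (a i) <= x, cabs (b i) <= x, cabs (c i) <= x & cabs (d i) <= x]) ->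
  opnorm (dblock a b c d) <= 4 * x.
Proof.
move=> x0 h; apply: le_trans (opnorm_block_mx _ _ _ _) _.
have h4 u v w y : u <= x -> v <= x -> w <= x -> y <= x -> u + v + (w + y) <= 4 * x.
  by move=> *; lra.
by apply: h4; apply: opnorm_diag_le => // i; rewrite mxE; have [] := h i.
Qed.

Lemma Mmx_dblock (mu : probability (measurableTypeR R) R) (c : R) z :
  Mmx mu c r z = dblock (fun=> phi mu z) (fun=> 0) (fun=> 0) (fun=> phit mu c z).
Proof.
rewrite /Mmx /dblock -!diag_const_mx -(raddf0 (@diag_mx _ r)).
by congr block_mx; congr diag_mx; apply/rowP => i; rewrite !mxE.
Qed.

Lemma Kmx_dblock (th : 'rV[R]_r) :
  Kmx th = dblock (fun=> 0) (fun i => (th 0 i)%:C) (fun i => (th 0 i)%:C) (fun=> 0).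
Proof.
rewrite /Kmx /dblock /re_mx map_diag_mx -(raddf0 (@diag_mx _ r)).
by congr block_mx; congr diag_mx; apply/rowP => i; rewrite !mxE.
Qed.

Lemma Kdiag_block (mu : probability (measurableTypeR R) R) (c : R) f g h J (th : 'rV[R]_r) :
  (2^-1 : C) *: block_mx (Kdiag mu c f J th) (Kdiag mu c g J th)
                   (Kdiag mu c g J th) (Kdiag mu c h J th) =
  let k (f : R -> R) i :=
    (2^-1 * (f (th 0 i) * (rho mu c (th 0 i) \in J)%:R))%:C in
  dblock (k f) (k g) (k g) (k h).
Proof.
have -> : (2^-1 : C) = (2^-1 : R)%:C by rewrite fmorphV /= rmorph_nat.
rewrite /Kdiag /re_mx scale_block_mx /dblock !map_diag_mx -!linearZ /=.
have e (f0 : R -> R) : diag_mx ((2^-1)%:C *: map_mx (real_complex R)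
    (\row_i (f0 (th 0 i) * (rho mu c (th 0 i) \in J)%:R))) =
    diag_mx (\row_i (2^-1 * (f0 (th 0 i) * (rho mu c (th 0 i) \in J)%:R))%:C).
  by apply: (congr1 (@diag_mx _ _)); apply/rowP => i; rewrite !mxE -rmorphM.
by rewrite !e.
Qed.

(* The inverse of 1 - M K for M = diag(p, q): every 2 x 2 block has
   determinant 1 - theta^2 p q. *)
Definition Linv (p q : C) (th : 'rV[R]_r) : 'M[C]_(r + r) :=
  let u i := (1 - (th 0 i ^+ 2)%:C * (p * q))^-1 in
  dblock u (fun i => p * (th 0 i)%:C * u i) (fun i => q * (th 0 i)%:C * u i) u.

Lemma LinvK p q (th : 'rV[R]_r) :
  (forall i, 1 - (th 0 i ^+ 2)%:C * (p * q) != 0) ->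
  Linv p q th *m
    (1%:M - dblock (fun=> p) (fun=> 0) (fun=> 0) (fun=> q) *m Kmx th) = 1%:M.
Proof.
move=> h; rewrite Kmx_dblock -dblock1 dblockM dblockB dblockM.
apply: eq_dblock => i /=; have := h i; set t := (th 0 i)%:C;
  rewrite rmorphXn /= -/t => hu; by field.
Qed.

Lemma LinvM p q (th : 'rV[R]_r) :
  let u i := (1 - (th 0 i ^+ 2)%:C * (p * q))^-1 in
  Linv p q th *m dblock (fun=> p) (fun=> 0) (fun=> 0) (fun=> q) =
  dblock (fun i => p * u i) (fun i => (th 0 i)%:C * (p * q) * u i)
    (fun i => (th 0 i)%:C * (p * q) * u i) (fun i => q * u i).
Proof. by rewrite dblockM; apply: eq_dblock => i /=; ring. Qed.

(** The entries involve theta at most to the power 2, which a lower bound of 1 - theta^2 p q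
    relative to 1 + theta^2 compensates. *)
Lemma KmxLinv p q (th : 'rV[R]_r) :
  let u i := (1 - (th 0 i ^+ 2)%:C * (p * q))^-1 in
  Kmx th *m Linv p q th =
  dblock (fun i => (th 0 i ^+ 2)%:C * q * u i) (fun i => (th 0 i)%:C * u i)
    (fun i => (th 0 i)%:C * u i) (fun i => (th 0 i ^+ 2)%:C * p * u i).
Proof.
rewrite Kmx_dblock dblockM; apply: eq_dblock => i /=; rewrite ?rmorphXn /=; ring.
Qed.

End DiagonalBlocks.

(** * Resolvents of perturbed matrices *)

Section LinearizationTheory.
Context {R : realType}.
Local Notation C := R[i].

Lemma lin_adj n m (A : 'M[C]_(n, m)) : (lin A)^t* = lin A.
Proof. by rewrite /lin tr_block_mx map_block_mx trmxCK !trmx0 !map_mx0. Qed.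

Lemma opnorm_lin_le n m (A : 'M[C]_(n, m)) : opnorm (lin A) <= opnorm A.
Proof.
apply: opnorm_le => [|x]; first exact: opnorm_ge0.
rewrite -[leRHS]ger0_norm ?mulr_ge0 ?opnorm_ge0 ?l2norm_ge0 //.
rewrite -[leLHS]ger0_norm ?l2norm_ge0 //.
rewrite -ler_sqr ?nnegrE // !real_normK ?num_real // -[x]vsubmxK /lin.
rewrite mul_block_col !mul0mx add0r addr0 exprMn !sqr_l2norm_col_mx mulrDr addrC.
apply: lerD; rewrite -exprMn ler_sqr ?nnegrE ?mulr_ge0 ?opnorm_ge0 ?l2norm_ge0 //.
  apply: le_trans (opnormP _ _) _.
  by rewrite ler_wpM2r ?l2norm_ge0 ?opnorm_adj.
exact: opnormP.
Qed.

Lemma stiefel_Emx n m r (U : 'M[C]_(n, r)) (V : 'M[C]_(m, r)) :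
  stiefel U -> stiefel V -> stiefel (Emx U V).
Proof.
move=> hU hV; rewrite /stiefel /Emx tr_block_mx map_block_mx !trmx0 !map_mx0.
by rewrite mulmx_block !mul0mx !mulmx0 !addr0 add0r hU hV -scalar_mx_block.
Qed.

Lemma lin_perturb n m r (X : 'M[C]_(n, m)) (U : 'M[C]_(n, r)) (th : 'rV[R]_r)
    (V : 'M[C]_(m, r)) :
  lin (X + U *m re_mx (diag_mx th) *m V^t*) =
  lin X + Emx U V *m Kmx th *m (Emx U V)^t*.
Proof.
rewrite /lin /Emx /Kmx tr_block_mx map_block_mx !trmx0 !map_mx0 !mulmx_block.
rewrite !(mul0mx, mulmx0, addr0, add0r) add_block_mx !(addr0, add0r).
have eK : (re_mx (diag_mx th))^t* = re_mx (diag_mx th).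
  rewrite /re_mx map_diag_mx tr_diag_mx map_diag_mx.
  by apply: (congr1 (@diag_mx _ _)); apply/rowP => i; rewrite !mxE; exact: conjc_real.
by rewrite linearD map_mxD /= !adjmx_mul trmxCK eK mulmxA.
Qed.

Section Resolvents.
Context {N k : nat} (A B : 'M[C]_N) (E : 'M[C]_(N, k)) (K : 'M[C]_k)
  (hA : A = B + E *m K *m E^t*).

Section FixedPoint.
Context (z : C) (uA : z%:M - A \in unitmx) (uB : z%:M - B \in unitmx).
Let RA := invmx (z%:M - A).
Let RB := invmx (z%:M - B).
Let G := E^t* *m RB *m E.

(** The resolvent identity RA = RB + RB E K E^* RA, compressed by E^* on the left. *)
Lemma adj_resolvent : E^t* *m RA = E^t* *m RB + G *m K *m (E^t* *m RA).
Proof.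
have h : (z%:M - B) *m RA = 1%:M + E *m K *m E^t* *m RA.
  rewrite -{1}(mulmxV uA) -/RA -mulmxDl; congr (_ *m RA).
  by rewrite hA opprD addrA subrK.
have -> : RA = RB *m ((z%:M - B) *m RA) by rewrite mulKmx.
by rewrite {1}h mulKmx // mulmxDr mulmx1 mulmxDr /G -!mulmxA.
Qed.

Context (M Li : 'M[C]_k) (hLi : Li *m (1%:M - M *m K) = 1%:M).

(** Subtracting M K E^* RA on both sides isolates 1 - M K; what multiplies the unknown on the right
    is then (G - M) K, the quantity controlled by weighted compatibility. *)
Lemma adj_resolvent_Linv :
  E^t* *m RA = Li *m (E^t* *m RB + (G - M) *m K *m (E^t* *m RA)).
Proof.
rewrite -[LHS]mul1mx -hLi -[LHS]mulmxA; apply: (congr1 (mulmx Li)).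
by rewrite mulmxBl mul1mx {1}adj_resolvent -addrA -mulmxBl -mulmxBl.
Qed.

Lemma compress_resolvent_sub :
  E^t* *m RA *m E - Li *m M =
  Li *m ((G - M) + (G - M) *m K *m (E^t* *m RA *m E)).
Proof.
have e : E^t* *m RA *m E = Li *m (G + (G - M) *m K *m (E^t* *m RA *m E)).
  by rewrite {1}adj_resolvent_Linv -[LHS]mulmxA mulmxDl -/G -mulmxA.
by rewrite {1}e mulmxDr addrAC -mulmxBr -mulmxDr.
Qed.

Lemma opnorm_compress_resolvent_sub (a t s h : R) :
  opnorm Li <= a -> opnorm (G - M) <= s -> opnorm ((G - M) *m K) <= t ->
  opnorm (E^t* *m RA *m E) <= h ->
  opnorm (E^t* *m RA *m E - Li *m M) <= a * (s + t * h).
Proof.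
move=> ha hs ht hh; rewrite compress_resolvent_sub; apply: opnormM_le => //.
apply: le_trans (ler_opnormD _ _) _; apply: lerD => //.
exact: opnormM_le.
Qed.

(** A bound on K E^* RA that does not see the size of K: after the previous identity K occurs only
    in the bounded products K Li and (G - M) K. It serves to bound E^* below on the range of a
    spectral projector. *)
Lemma opnorm_K_adj_resolvent (a t h hb : R) : stiefel E ->
  opnorm (K *m Li) <= a -> opnorm ((G - M) *m K) <= t ->
  opnorm RA <= h -> opnorm RB <= hb ->
  opnorm (K *m (E^t* *m RA)) <= a * (hb + t * h).
Proof.
move=> hE ha ht hh hhb; rewrite adj_resolvent_Linv mulmxA.
have E1 : opnorm (E^t*) <= 1 by exact: le_trans (opnorm_adj _) (opnorm_isometry hE).
apply: opnormM_le => //; apply: le_trans (ler_opnormD _ _) _; apply: lerD.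
  by rewrite -[hb]mul1r; exact: opnormM_le.
by apply: opnormM_le => //; rewrite -[h]mul1r; exact: opnormM_le.
Qed.

End FixedPoint.

(* An eigenvector v of A satisfies E^* v = G K E^* v, i.e.
   (1 - M K) E^* v = (G - M) K E^* v. *)
Lemma no_eigenvector (x : C) (M Li : 'M[C]_k) (a t : R) (v : 'cV[C]_N) :
  x%:M - B \in unitmx -> Li *m (1%:M - M *m K) = 1%:M ->
  opnorm Li <= a ->
  opnorm ((E^t* *m invmx (x%:M - B) *m E - M) *m K) <= t -> a * t < 1 ->
  A *m v = x *: v -> v = 0.
Proof.
move=> uB hLi ha ht hat hv.
set G := E^t* *m _ *m E in ht; pose y := E^t* *m v.
have hvB : v = invmx (x%:M - B) *m (E *m (K *m y)).
  rewrite -[LHS](mulKmx uB); congr (_ *m _).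
  rewrite mulmxBl mul_scalar_mx -hv hA mulmxDl /y !mulmxA.
  by rewrite addrAC subrr add0r.
have yE : y = G *m K *m y by rewrite {1}/y {1}hvB /G !mulmxA.
have yE2 : y = Li *m ((G - M) *m K *m y).
  rewrite -[LHS]mul1mx -hLi -[LHS]mulmxA; apply: (congr1 (mulmx Li)).
  by rewrite mulmxBl mul1mx {1}yE -mulmxBl -mulmxBl.
have : l2norm y <= a * t * l2norm y.
  rewrite {1}yE2 mulmxA; apply: le_trans (opnormP _ _) _.
  by rewrite ler_wpM2r ?l2norm_ge0 //; exact: opnormM_le.
move=> hy; have y0 : y = 0.
  apply: l2norm_eq0; apply: le_anti; rewrite l2norm_ge0 andbT.
  have : (1 - a * t) * l2norm y <= 0 by rewrite mulrBl mul1r subr_le0.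
  by rewrite pmulr_rle0 // subr_gt0.
by rewrite hvB y0 !mulmx0.
Qed.

End Resolvents.

End LinearizationTheory.

(** * Spectral projectors and singular values *)

Lemma spectral_proj_fcalc (R : realType) N (A : 'M[R[i]]_N) (B : set R) :
  spectral_proj A B = fcalc A (fun x => (x \in B)%:R).
Proof. by []. Qed.

Opaque spectral_proj.

Section SingularBlocks.
Context {R : realType}.
Local Notation C := R[i].

(** The 0/1 matrix S whose columns enumerate P satisfies S^T S = 1, while S S^T is the diagonal
    matrix in question. *)
Lemma rank_diag_indicator n (P : pred 'I_n) :
  \rank (diag_mx (\row_i ((P i)%:R : C))) = #|P|.
Proof.
pose S : 'M[C]_(n, #|P|) := \matrix_(i, j) (i == enum_val j)%:R.
have SS : S^T *m S = 1%:M.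
  apply/matrixP => i j; rewrite !mxE (bigD1 (enum_val i)) //= !mxE eqxx mul1r.
  rewrite big1 ?addr0 => [|k /negbTE kE]; last by rewrite !mxE kE mul0r.
  by rewrite (inj_eq enum_val_inj).
have -> : diag_mx (\row_i ((P i)%:R : C)) = S *m S^T.
  apply/matrixP => i j; rewrite !mxE; case: (boolP (P i)) => Pi; last first.
    rewrite mul0rn big1 // => k _; rewrite !mxE; case: eqP => [iE|_]; last by rewrite mul0r.
    by move: (enum_valP k); rewrite -iE unfold_in (negbTE Pi).
  rewrite (bigD1 (enum_rank_in Pi i)) //= !mxE enum_rankK_in // eqxx mul1r.
  rewrite big1 ?addr0 => [|k]; first by rewrite eq_sym.
  move=> kE; rewrite !mxE; case: eqP => [iE|_]; last by rewrite mul0r.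
  by move/eqP: kE; case; apply: enum_val_inj; rewrite enum_rankK_in // -iE.
apply/eqP; rewrite eqn_leq (leq_trans (mxrankM_maxl _ _) (rank_leq_col _)) /=.
have := mxrankM_maxl (S^T *m (S *m S^T)) S.
by rewrite -!mulmxA SS mulmx1 SS mxrank1 => /leq_trans; apply; exact: mxrankM_maxr.
Qed.

(** The columns of [cokermx] span the kernel of B D. If D killed all of them, the row space of D
    would lie in that of B D, against the ranks. *)
Lemma exists_kernel_vector a k (D : 'M[C]_a) (B : 'M[C]_(k, a)) :
  (\rank (B *m D) < \rank D)%N -> exists2 x : 'cV[C]_a, D *m x != 0 & B *m (D *m x) = 0.
Proof.
move=> h; pose X := cokermx (B *m D).
have [j hj] : exists j, D *m col j X != 0.
  apply: contrapT => /forallNP hX; move: h; rewrite ltnNge => /negP; apply.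
  apply: mxrankS; rewrite submxE; apply/eqP/matrixP => i j.
  have /negP := hX j; rewrite negbK colE mulmxA -colE => /eqP /matrixP /(_ i 0).
  by rewrite !mxE.
by exists (col j X) => //; rewrite mulmxA colE mulmxA mulmx_coker mul0mx.
Qed.

Context {n m : nat} (F : base_field) (W : 'M[C]_(n, m)) (u : 'M[C]_n)
  (s : 'rV[R]_n) (v : 'M[C]_(m, n)) (J : set R).
Hypotheses (hW : is_svd F W u s v) (hs : forall j, 0 <= s 0 j)
  (hJ : forall x, J x -> 0 < x).

Local Notation indJ := (diag_mx (\row_j ((s 0 j \in J)%:R : C))).

Lemma PiLE k p (t : 'rV[R]_k) (w : 'M[C]_(p, k)) :
  PiL J t w = w *m diag_mx (\row_j ((t 0 j \in J)%:R : C)) *m w^t*.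
Proof.
apply/matrixP => i j; rewrite /PiL summxE !mxE big_mkcond /=.
apply: eq_bigr => l _; rewrite mul_mx_diag !mxE big_ord1 !mxE.
by case: ifP => _; rewrite ?mulr1 // mulr0 mul0r.
Qed.

Lemma ChatE : Chat J s u v = u *m indJ *m v^t*.
Proof.
apply/matrixP => i j; rewrite /Chat summxE !mxE big_mkcond /=.
apply: eq_bigr => l _; rewrite mul_mx_diag !mxE big_ord1 !mxE.
by case: ifP => _; rewrite ?mulr1 // mulr0 mul0r.
Qed.

Let Wu : W^t* *m u = v *m diag_mx (\row_j (s 0 j)%:C).
Proof.
have [_ hu _ _ ->] := hW; rewrite !adjmx_mul trmxCK -!mulmxA hu mulmx1.
rewrite /re_mx map_diag_mx tr_diag_mx map_diag_mx; apply: (congr1 (mulmx v)).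
by apply: (congr1 (@diag_mx _ _)); apply/rowP => j; rewrite !mxE; exact: conjc_real.
Qed.

Let Wv : W *m v = u *m diag_mx (\row_j (s 0 j)%:C).
Proof.
have [_ _ hv _ ->] := hW; rewrite -!mulmxA hv mulmx1.
rewrite /re_mx map_diag_mx; apply: (congr1 (mulmx u)).
by apply: (congr1 (@diag_mx _ _)); apply/rowP => j; rewrite !mxE.
Qed.

Lemma lin_eigen_pos :
  lin W *m col_mx u v = col_mx u v *m diag_mx (\row_j (s 0 j)%:C).
Proof. by rewrite /lin mul_block_col !mul0mx add0r addr0 Wu Wv mul_col_mx. Qed.

Lemma lin_eigen_neg :
  lin W *m col_mx u (- v) = col_mx u (- v) *m diag_mx (\row_j (- s 0 j)%:C).
Proof.
rewrite /lin mul_block_col !mul0mx add0r addr0 mulmxN Wu Wv mul_col_mx mulNmx.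
have -> : diag_mx (\row_j (- s 0 j)%:C) = - diag_mx (\row_j (s 0 j)%:C) :> 'M[C]_n.
  rewrite -raddfN; apply: (congr1 (@diag_mx _ _)).
  by apply/rowP => j; rewrite !mxE rmorphN.
by rewrite !mulmxN opprK.
Qed.



Lemma spectral_proj_pos :
  spectral_proj (lin W) J *m col_mx u v = col_mx u v *m indJ.
Proof. by rewrite spectral_proj_fcalc (fcalc_eigen (lin_adj W) _ lin_eigen_pos). Qed.

Lemma spectral_proj_neg : spectral_proj (lin W) J *m col_mx u (- v) = 0.
Proof.
have h : lin W *m col_mx u (- v) = col_mx u (- v) *m
    diag_mx (\row_j ((\row_l - s 0 l) 0 j)%:C).
  rewrite lin_eigen_neg; congr (_ *m diag_mx _).
  by apply/rowP => j; rewrite !mxE.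
rewrite spectral_proj_fcalc (fcalc_eigen (lin_adj W) _ h).
rewrite (_ : \row__ _ = 0) ?raddf0 ?mulmx0 //; apply/rowP => j; rewrite !mxE.
rewrite memNset // => /hJ; rewrite oppr_gt0; apply/negP; rewrite -leNgt; exact: hs.
Qed.

(** The linearization has eigenvectors (u_j, v_j) for s_j and (u_j, - v_j) for - s_j, and the
    vectors (0, x) with x orthogonal to the columns of v lie in its kernel. Together they span the
    space, and since J is in (0, +oo) only the first family survives. The factor 1/2 comes from (u,
    0) and (0, v), which are half the sum and half the difference of the first two families. *)
Lemma spectral_proj_lin :
  spectral_proj (lin W) J =
  2^-1 *: block_mx (PiL J s u) (Chat J s u v) ((Chat J s u v)^t*) (PiL J s v).
Proof.
(* [u] is square, so u u^* = 1 as well; [v] only has orthonormal columns, which is why the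
   complement 1 - v v^* appears. *)
have [_ hu hv _ hWE] := hW; have hu' := mulmx1C hu.
set Q := spectral_proj _ _; pose Z := col_mx u v.
have twoV : (2^-1 : C) + 2^-1 = 1 by field.
have e1 : col_mx u 0 = 2^-1 *: (Z + col_mx u (- v)).
  by rewrite add_col_mx subrr scale_col_mx scaler0 scalerDr -scalerDl twoV scale1r.
have e2 : col_mx 0 v = 2^-1 *: (Z - col_mx u (- v)).
  rewrite opp_col_mx opprK add_col_mx subrr scale_col_mx scaler0.
  by rewrite scalerDr -scalerDl twoV scale1r.
have Qe1 : Q *m col_mx u 0 = 2^-1 *: (Z *m indJ).
  by rewrite e1 -scalemxAr mulmxDr spectral_proj_pos spectral_proj_neg addr0.
have Qe2 : Q *m col_mx 0 v = 2^-1 *: (Z *m indJ).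
  by rewrite e2 -scalemxAr mulmxBr spectral_proj_pos spectral_proj_neg subr0.
have QN : Q *m col_mx 0 (1%:M - v *m v^t*) = 0.
  have h : lin W *m col_mx 0 (1%:M - v *m v^t*) = col_mx 0 (1%:M - v *m v^t*) *m
      diag_mx (\row_j ((0 : 'rV[R]_m) 0 j)%:C).
    rewrite (_ : \row__ _ = 0) ?raddf0 ?mulmx0; last by apply/rowP => j; rewrite !mxE.
    rewrite /lin mul_block_col !mul0mx mulmx0 !addr0 add0r mulmxBr mulmx1 mulmxA Wv.
    have -> : u *m diag_mx (\row_j (s 0 j)%:C) *m v^t* = W.
      rewrite [RHS]hWE /re_mx map_diag_mx; congr (_ *m _ *m _).
      by apply: (congr1 (@diag_mx _ _)); apply/rowP => j; rewrite !mxE.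
    by rewrite subrr col_mx0.
  rewrite /Q spectral_proj_fcalc (fcalc_eigen (lin_adj W) _ h).
  rewrite (_ : \row__ _ = 0) ?raddf0 ?mulmx0 //; apply/rowP => j; rewrite !mxE.
  by rewrite memNset // => /hJ; rewrite ltxx.
have I1 : 1%:M = row_mx (col_mx u 0 *m u^t*) (col_mx 0 v *m v^t* + col_mx 0 (1%:M - v *m v^t*)).
  rewrite !mul_col_mx !mul0mx hu' add_col_mx addr0 addrC subrK scalar_mx_block.
  by rewrite block_mxEh.
rewrite -[LHS]mulmx1 I1 mul_mx_row mulmxDr !mulmxA Qe1 Qe2 QN addr0.
rewrite -!scalemxAl -scale_row_mx; congr (_ *: _).
rewrite !PiLE ChatE !adjmx_mul trmxCK tr_diag_mx map_diag_mx mulmxA.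
rewrite /Z !mul_col_mx block_mxEh.
have -> : diag_mx (map_mx Num.conj_op (\row_j ((s 0 j \in J)%:R : C))) = indJ.
  apply: (congr1 (@diag_mx _ _)); apply/rowP => j; rewrite !mxE; exact: conjC_nat.
by [].
Qed.

End SingularBlocks.

(** * Comparison of ranks through quadratic forms *)

Section Counting.
Context {R : realType}.
Local Notation C := R[i].

Lemma fcalc_psd N (A : 'M[C]_N) (g : R -> R) (v : 'cV[C]_N) :
  (forall i, 0 <= g (spec A i)) -> 0 <= Re (inner v (fcalc A (fun x => (g x)%:C) *m v)).
Proof.
move=> g0; pose B := fcalc A (fun x => (Num.sqrt (g x))%:C).
have BB : fcalc A (fun x => (g x)%:C) = B^t* *m B.
  rewrite fcalc_adj fcalcM; apply: eq_fcalc => i.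
  rewrite -[(_^*)%R]/(conjc _) conjc_real -rmorphM.
  by rewrite -expr2 sqr_sqrtr.
by rewrite BB -mulmxA inner_mulmx trmxCK -sqr_l2norm /= sqr_ge0.
Qed.

Context {N k : nat} (A B : 'M[C]_N) (E : 'M[C]_(N, k)) (K T : 'M[C]_k)
  (hA : A^t* = A) (hAB : A = B + E *m K *m E^t*) (hE : stiefel E) (J : set R).
Local Notation Q := (spectral_proj A J).

Lemma spectral_proj_idem : Q *m Q = Q.
Proof.
rewrite !spectral_proj_fcalc fcalcM; apply: eq_fcalc => i.
by case: (_ \in _); rewrite ?mulr1 ?mulr0.
Qed.

Lemma spectral_proj_adj : Q^t* = Q.
Proof.
rewrite !spectral_proj_fcalc fcalc_adj; apply: eq_fcalc => i; exact: conjC_nat.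
Qed.

(* The quadratic form of A is at least a on the range of Q, that of B at most
   its norm, so the perturbation must see every vector of the range. *)
Lemma compress_lower_bound (a bB ck : R) (v : 'cV[C]_N) :
  (forall x, J x -> a <= x) -> opnorm B <= bB ->
  opnorm (K *m (E^t* *m Q)) <= ck -> Q *m v = v ->
  (a - bB) * l2norm v <= ck * l2norm (E^t* *m v).
Proof.
move=> ha hB hk hv; have [->|v0] := eqVneq v 0.
  by rewrite mulmx0 !l2norm0 !mulr0.
have vp := l2norm_gt0 v0.
have hAv : a * l2norm v ^+ 2 <= Re (inner v (A *m v)).
  rewrite -subr_ge0.
  have -> : Re (inner v (A *m v)) - a * l2norm v ^+ 2 =
      Re (inner v (fcalc A (fun x => ((x - a) * (x \in J)%:R)%:C) *m v)).
    have -> : fcalc A (fun x => ((x - a) * (x \in J)%:R)%:C) = (A - a%:C%:M) *m Q.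
      rewrite -{2}(fcalc_id hA) -(fcalc_cst A) fcalcB spectral_proj_fcalc fcalcM.
      by apply: eq_fcalc => i; rewrite rmorphM rmorphB rmorph_nat.
    rewrite -mulmxA hv mulmxBl mul_scalar_mx innerDr -(scaleN1r (a%:C *: v)).
    rewrite scalerA innerZr ReD mulN1r -rmorphN ReZ -sqr_l2norm.
    by rewrite mulNr.
  apply: fcalc_psd => i; case: (boolP (_ \in J)) => [|_]; last by rewrite mulr0.
  by rewrite inE => /ha; rewrite mulr1 subr_ge0.
have : Re (inner v (A *m v)) <= bB * l2norm v ^+ 2 + l2norm (E^t* *m v) * (ck * l2norm v).
  rewrite hAB mulmxDl innerDr ReD; apply: lerD.
    apply: le_trans (Re_le _) _; apply: le_trans (CauchySchwarz_inner _ _) _.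
    rewrite expr2 mulrCA ler_wpM2l ?l2norm_ge0 //; apply: le_trans (opnormP _ _) _.
    by rewrite ler_wpM2r ?l2norm_ge0.
  rewrite -!mulmxA inner_mulmx; apply: le_trans (Re_le _) _.
  apply: le_trans (CauchySchwarz_inner _ _) _; rewrite ler_wpM2l ?l2norm_ge0 //.
  rewrite -{1}hv; have -> : K *m (E^t* *m (Q *m v)) = K *m (E^t* *m Q) *m v by rewrite !mulmxA.
  apply: le_trans (opnormP _ _) _.
  by rewrite ler_wpM2r ?l2norm_ge0.
move=> /(le_trans hAv) h; rewrite -(ler_pM2r vp) mulrBl mulrBl.
by move: h; set x := l2norm v; set y := l2norm _ => h; lra.
Qed.

(** K E^* Q is K E^* (z - A)^-1 followed by (z - A) Q, and the latter is bounded by the distances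
    from z to points of J. *)
Lemma opnorm_K_adj_proj (z : C) (c D : R) : (forall i, z != (spec A i)%:C) ->
  0 <= D -> opnorm (K *m (E^t* *m invmx (z%:M - A))) <= c ->
  (forall x, J x -> cabs (z - x%:C) <= D) ->
  opnorm (K *m (E^t* *m Q)) <= c * D.
Proof.
move=> hz D0 hc hD.
have -> : K *m (E^t* *m Q) = K *m (E^t* *m invmx (z%:M - A)) *m ((z%:M - A) *m Q).
  by rewrite mulmxA -!mulmxA mulKmx ?resolvent_unit.
apply: opnormM_le => //; rewrite subr_fcalc // spectral_proj_fcalc fcalcM.
apply: opnorm_fcalc_le => // i; case: (boolP (_ \in J)) => [|_]; last by rewrite mulr0 cabs0.
by rewrite inE mulr1; exact: hD.
Qed.

Context {p q : nat} (Z : 'M[C]_(N, p)) (sJ : pred 'I_p) (rJ : pred 'I_q)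
  (L1 : 'M[C]_(k, q)) (L2 : 'M[C]_(q, k)) (Y : 'M[C]_(k, q)).
Local Notation Ds := (diag_mx (\row_i ((sJ i)%:R : C))).
Local Notation Dr := (diag_mx (\row_i ((rJ i)%:R : C))).

Lemma indicator_idem a (P : pred 'I_a) :
  diag_mx (\row_i ((P i)%:R : C)) *m diag_mx (\row_i ((P i)%:R : C)) =
  diag_mx (\row_i ((P i)%:R : C)).
Proof.
rewrite mulmx_diag; apply: (congr1 (@diag_mx _ _)); apply/rowP => i; rewrite !mxE.
by case: (P i); rewrite ?mulr1 ?mulr0.
Qed.

(** With more indices in [sJ] than the rank of T allows, some nonzero v in the range of Q satisfies
    T E^* v = 0. For y = E^* v, the quadratic form of E^* Q E - T is then |Q E y|^2, which the lower
    bound on E^* makes at least c0^2 |y|^2. *)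
Lemma card_le_of_proj (c0 : R) : 0 < c0 ->
  Q *m Z = Z *m Ds -> (forall x : 'cV[C]_p, Z *m x = 0 -> x = 0) ->
  (forall v : 'cV[C]_N, Q *m v = v -> c0 * l2norm v <= l2norm (E^t* *m v)) ->
  T = L1 *m Dr *m L2 -> opnorm (E^t* *m Q *m E - T) < c0 ^+ 2 ->
  (#|sJ| <= #|rJ|)%N.
Proof.
move=> c0p hZ injZ hlow hT hn; rewrite leqNgt; apply/negP => lt.
have [|x x0 hx] := @exists_kernel_vector _ p k Ds (T *m E^t* *m Z).
  rewrite rank_diag_indicator; apply: leq_ltn_trans lt.
  rewrite hT -!mulmxA; apply: leq_trans (mxrankM_maxr _ _) _.
  by apply: leq_trans (mxrankM_maxl _ _) _; rewrite rank_diag_indicator.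
pose v := Z *m (Ds *m x).
have hv : Q *m v = v by rewrite /v !mulmxA hZ -!mulmxA (mulmxA Ds) indicator_idem.
have vp : 0 < l2norm v by apply: l2norm_gt0; apply: contra_neq x0 => /injZ.
have lowv := hlow _ hv; set y := E^t* *m v in lowv.
have yp : 0 < l2norm y by apply: lt_le_trans lowv; rewrite mulr_gt0.
have hTy : T *m y = 0 by rewrite /y /v; move: hx; rewrite !mulmxA.
pose w := Q *m (E *m y).
have hw : Re (inner y ((E^t* *m Q *m E - T) *m y)) = l2norm w ^+ 2.
  have wQ : w = Q *m w by rewrite /w (mulmxA Q Q) spectral_proj_idem.
  rewrite mulmxBl hTy subr0 -[_ *m E *m y]mulmxA -[_ *m Q *m _]mulmxA.
  by rewrite inner_mulmx trmxCK -/w {1}wQ inner_mulmx spectral_proj_adj -/w -sqr_l2norm.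
(* Since Q v = v, |y|^2 is the inner product of v with Q E y; dividing by |v|, which is at most |y|
   / c0, gives the lower bound on |Q E y|. *)
have hyw : l2norm y ^+ 2 <= l2norm v * l2norm w.
  have -> : l2norm y ^+ 2 = Re (inner v w).
    by rewrite /w inner_mulmx spectral_proj_adj hv inner_mulmx -/y -sqr_l2norm.
  exact: le_trans (Re_le _) (CauchySchwarz_inner _ _).
have hcy : c0 * l2norm y <= l2norm w.
  rewrite -(ler_pM2l vp); apply: le_trans hyw; rewrite mulrCA mulrA expr2.
  by rewrite ler_wpM2r ?l2norm_ge0.
have : (c0 * l2norm y) ^+ 2 <= opnorm (E^t* *m Q *m E - T) * l2norm y ^+ 2.
  apply: (@le_trans _ _ (l2norm w ^+ 2)).
    by rewrite ler_sqr ?nnegrE ?l2norm_ge0 // mulr_ge0 ?l2norm_ge0 ?ltW.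
  rewrite -hw; apply: le_trans (Re_le _) _; apply: le_trans (CauchySchwarz_inner _ _) _.
  by rewrite expr2 mulrCA ler_wpM2l ?l2norm_ge0 // opnormP.
by rewrite exprMn ler_pM2r ?exprn_gt0 // leNgt hn.
Qed.

(** The converse comparison: with too few indices in [sJ], E^* Q E kills a nonzero vector of a
    subspace on which the quadratic form of T is at least c0. *)
Lemma card_ge_of_proj (c0 : R) (Z' : 'M[C]_(p, N)) :
  Q = Z *m Ds *m Z' ->
  (forall x : 'cV[C]_q, Y *m (Dr *m x) = 0 -> Dr *m x = 0) ->
  (forall x : 'cV[C]_q, let y := Y *m (Dr *m x) in c0 * l2norm y ^+ 2 <= Re (inner y (T *m y))) ->
  opnorm (E^t* *m Q *m E - T) < c0 ->
  (#|rJ| <= #|sJ|)%N.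
Proof.
move=> hQ injY hlow hn; rewrite leqNgt; apply/negP => lt.
have [|x x0 hx] := @exists_kernel_vector _ q p Dr (Ds *m Z' *m E *m Y).
  rewrite rank_diag_indicator; apply: leq_ltn_trans lt.
  by rewrite -!mulmxA; apply: leq_trans (mxrankM_maxl _ _) _; rewrite rank_diag_indicator.
have {hlow} := hlow x; set y := Y *m _ => hlow.
have yp : 0 < l2norm y by apply: l2norm_gt0; apply: contra_neq x0 => /injY.
have hQy : E^t* *m Q *m E *m y = 0.
  rewrite hQ /y -!mulmxA.
  have -> : Ds *m (Z' *m (E *m (Y *m (Dr *m x)))) = 0 by move: hx; rewrite !mulmxA.
  by rewrite !mulmx0.
have : c0 * l2norm y ^+ 2 <= opnorm (E^t* *m Q *m E - T) * l2norm y ^+ 2.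
  apply: le_trans hlow _; apply: le_trans (Re_le _) _.
  have -> : inner y (T *m y) = inner y (- ((E^t* *m Q *m E - T) *m y)).
    by rewrite mulmxBl hQy sub0r opprK.
  apply: le_trans (CauchySchwarz_inner _ _) _; rewrite l2normN.
  by rewrite expr2 mulrCA ler_wpM2l ?l2norm_ge0 // opnormP.
by rewrite ler_pM2r ?exprn_gt0 // leNgt hn.
Qed.

End Counting.

(** * Plane topology and the maximum principle *)

Section PlaneTopology.
Context {R : realType}.
Local Notation T := (Cplx R).

(** The norm of the complex numbers, hence the radius of a ball, takes its values in [R[i]]; this
    passes to real radii. *)
Lemma cplx_nbhsP (z : T) (A : set T) :
  nbhs z A <-> exists2 e : R, 0 < e & forall w : T, cabs (w - z) < e -> A w.
Proof.
have ballE (w : T) (e : R) : ball z e%:C w <-> cabs (w - z) < e.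
  by rewrite -ball_normE /= -(cabsC (z - w)) ltcR cabsB.
split=> [/nbhs_ballP [e /= e0 h]|[e e0 h]].
  have eE : (Re e)%:C = e by apply: RRe_real; exact: gtr0_real.
  exists (Re e); first by rewrite -ltcR eE.
  by move=> w /ballE; rewrite eE; exact: h.
by apply/nbhs_ballP; exists e%:C => /=; [rewrite ltcR|move=> w /ballE; exact: h].
Qed.

Lemma cplx_within_continuous (f : T -> R) (A : set T) :
  (forall z, A z -> forall e, 0 < e ->
     exists2 dl, 0 < dl & forall w, cabs (w - z) < dl -> `|f w - f z| < e) ->
  {within A, continuous f}.
Proof.
move=> h; apply: continuous_in_subspaceT => z; rewrite inE => /h {}h.
move=> B /nbhs_ballP [e /= e0 hB]; have [dl d0 hd] := h e e0.
apply/cplx_nbhsP; exists dl => // w /hd hw; apply: hB.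
by rewrite -ball_normE /= distrC.
Qed.

Lemma cabs_within_continuous (A : set T) : {within A, continuous (@cabs R)}.
Proof.
apply: cplx_within_continuous => z _ e e0; exists e => // w; apply: le_lt_trans.
by rewrite ler_norml ler_cabsB lerNl opprB cabsB ler_cabsB.
Qed.

Lemma compact_cabs_le (A : set T) : compact A -> exists B : R, forall z, A z -> cabs z <= B.
Proof.
move=> cA; have [[a Aa]|A0] := pselect (A !=set0); last first.
  by exists 0 => z Az; case: A0; exists z.
have [|c _ hc] := compact_EVT_max (T := T) (f := @cabs R) _ cA (@cabs_within_continuous A).
  by exists a.
by exists (cabs c) => z Az; apply: hc; rewrite inE.
Qed.

Definition segment (z w : T) : set T := [set z + t%:C * (w - z) | t in `[0, 1]].

Lemma segment_ends (z w : T) : segment z w z /\ segment z w w.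
Proof.
split; first by exists 0; rewrite /= ?in_itv /= ?lexx ?ler01 // mul0r addr0.
by exists 1; rewrite /= ?in_itv /= ?lexx ?ler01 // mul1r addrC subrK.
Qed.

Lemma cplx_segment_connected (z w : T) : connected (segment z w).
Proof.
apply: connected_continuous_connected; first exact: segment_connected.
apply: continuous_subspaceT => t A /cplx_nbhsP [e e0 hA].
pose M := cabs (w - z) + 1.
have M0 : 0 < M by rewrite ltr_wpDl ?cabs_ge0.
apply/nbhs_ballP; exists (e / M) => /=; first by rewrite divr_gt0.
move=> s; rewrite -ball_normE /= => ts; apply: hA.
have -> : z + s%:C * (w - z) - (z + t%:C * (w - z)) = (s - t)%:C * (w - z).
  by rewrite rmorphB /= mulrBl opprD addrACA subrr add0r.
rewrite cabsM cabsR distrC; apply: (@le_lt_trans _ _ (`|t - s| * M)).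
  by rewrite ler_wpM2l // lerDl.
by rewrite -ltr_pdivlMr.
Qed.

Lemma segment_sub_disc (z w : T) (e : R) : cabs (w - z) < e ->
  forall v : T, segment z w v -> cabs (v - z) < e.
Proof.
move=> h v [t /=]; rewrite in_itv /= => /andP[t0 t1] <-.
rewrite addrC addKr cabsM cabsR ger0_norm //; apply: le_lt_trans h.
by rewrite ler_piMl ?cabs_ge0.
Qed.

Lemma curve_trace_compact g : jordan_curve g -> compact (@curve_trace R g).
Proof.
by case=> cg _ _; apply: continuous_compact => //; exact: segment_compact.
Qed.

Lemma cplx_hausdorff : hausdorff_space T.
Proof. exact: norm_hausdorff. Qed.

(** A disc that avoids the curve contains the segment from z to w, so both points lie in the same
    component of the complement. *)
Lemma jordan_interior_disc (g : R -> T) (z w : T) (e : R) :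
  (forall v : T, cabs (v - z) < e -> ~ curve_trace g v) -> cabs (w - z) < e ->
  jordan_interior g z <-> jordan_interior g w.
Proof.
move=> h wz; have sub : segment z w `<=` ~` curve_trace g.
  by move=> v /(segment_sub_disc wz); exact: h.
have [sz sw] := segment_ends z w.
have comp : connected_component (~` curve_trace g) z w.
  exact: (connected_component_max sz sub (@cplx_segment_connected z w) sw).
by rewrite /jordan_interior /= (same_connected_component comp);
  split=> -[_ hb]; split=> //; exact: sub.
Qed.

Context {k : nat} (gam : 'I_k -> R -> T) (hgam : contour gam).

Lemma off_trace_nbhs i (z : T) : ~ curve_trace (gam i) z ->
  nbhs z (~` curve_trace (gam i)).
Proof.
move=> hz; have [hj _ _] := hgam i.
have : closed (curve_trace (gam i)).
  exact: compact_closed cplx_hausdorff (curve_trace_compact hj).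
by rewrite -openC openE => /(_ z hz).
Qed.

Lemma off_Gamma_disc (z : T) : ~ Gamma_set gam z ->
  exists2 e : R, 0 < e & forall v : T, cabs (v - z) < e -> ~ Gamma_set gam v.
Proof.
move=> hz; have /cplx_nbhsP [e e0 he] : \forall v \near z, forall i, ~ curve_trace (gam i) v.
  have hh i : \forall v \near z, ~ curve_trace (gam i) v.
    by apply: off_trace_nbhs => hi; apply: hz; exists i.
  exact: (filter_forall _ hh).
by exists e => // v /he hv [i _]; exact: hv.
Qed.

Lemma Omega_set_disc (z w : T) (e : R) :
  (forall v : T, cabs (v - z) < e -> ~ Gamma_set gam v) -> cabs (w - z) < e ->
  Omega_set gam z <-> Omega_set gam w.
Proof.
move=> h wz; have h' i (v : T) : cabs (v - z) < e -> ~ curve_trace (gam i) v.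
  by move=> /h hv hi; apply: hv; exists i.
by split=> -[i _ hi]; exists i => //; apply/(jordan_interior_disc (h' i) wz).
Qed.

(** Off Gamma, membership in Omega is locally constant. *)
Lemma closure_Omega_sub (z : T) : closure (Omega_set gam) z ->
  Omega_set gam z \/ Gamma_set gam z.
Proof.
move=> cz; have [|/off_Gamma_disc [e e0 he]] := pselect (Gamma_set gam z); first by right.
left; have [|w [/= hw wz]] := cz [set w : T | cabs (w - z) < e].
  by apply/cplx_nbhsP; exists e.
exact/(Omega_set_disc he wz).
Qed.

Lemma Omega_open : open (Omega_set gam).
Proof.
rewrite openE => z [i _ hi]; have [/off_trace_nbhs /cplx_nbhsP [e e0 he] _] := hi.
apply/cplx_nbhsP; exists e => // w wz; exists i => //.
exact/(jordan_interior_disc he wz).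
Qed.

End PlaneTopology.

Section MaximumPrinciple.
Context {R : realType}.
Local Notation T := (Cplx R).
Local Notation C := R[i].
Implicit Types (F : T -> C) (z w : T).

(* A quantitative form of holomorphy at z: the second condition says that the
   values at the four points z + i^k t average to F z up to O(t^4). *)
Definition four_points F z (t : R) : C :=
  F (z + t%:C) + F (z - t%:C) + F (z + 'i * t%:C) + F (z - 'i * t%:C) - 4 * F z.

Definition holo_at F z : Prop := exists c dl : R,
  [/\ 0 <= c, 0 < dl,
      forall w, cabs (w - z) < dl -> cabs (F w - F z) <= c * cabs (w - z) &
      forall t : R, 0 < t < dl -> cabs (four_points F z t) <= c * t ^+ 4].

Lemma holo_atD F G z : holo_at F z -> holo_at G z -> holo_at (fun w => F w + G w) z.
Proof.
move=> [c [dl [c0 d0 F1 F2]]] [c' [dl' [c0' d0' G1 G2]]].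
exists (c + c'), (Num.min dl dl'); split; first exact: addr_ge0.
- by rewrite lt_min d0.
- move=> w; rewrite lt_min => /andP[/F1 h1 /G1 h2].
  rewrite opprD addrACA mulrDl; exact: le_trans (ler_cabsD _ _) (lerD h1 h2).
- move=> t /andP[t0]; rewrite lt_min => /andP[t1 t2].
  have -> : four_points (fun w => F w + G w) z t = four_points F z t + four_points G z t.
    by rewrite /four_points; ring.
  rewrite mulrDl; apply: le_trans (ler_cabsD _ _) _.
  by apply: lerD; [apply: F2; rewrite t0|apply: G2; rewrite t0].
Qed.

Lemma holo_atZ F z (a : C) : holo_at F z -> holo_at (fun w => a * F w) z.
Proof.
move=> [c [dl [c0 d0 F1 F2]]]; exists (cabs a * c), dl; split => //.
- by rewrite mulr_ge0 ?cabs_ge0.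
- by move=> w /F1 h; rewrite -mulrBr cabsM -mulrA ler_wpM2l ?cabs_ge0.
- move=> t /F2 h.
  have -> : four_points (fun w => a * F w) z t = a * four_points F z t.
    by rewrite /four_points; ring.
  by rewrite cabsM -mulrA ler_wpM2l ?cabs_ge0.
Qed.

Lemma holo_at_cst (a : C) z : holo_at (fun=> a) z.
Proof.
exists 0, 1; split => // [w _|t _]; first by rewrite subrr cabs0 mul0r.
rewrite (_ : four_points _ _ _ = 0) ?cabs0 ?mul0r //.
by rewrite /four_points; ring.
Qed.

Lemma holo_at_sum (I : Type) (s : seq I) (P : pred I) (F : I -> T -> C) z :
  (forall i, holo_at (F i) z) -> holo_at (fun w => \sum_(i <- s | P i) F i w) z.
Proof.
move=> h; elim: s => [|i s IH].
  rewrite (_ : (fun w => _) = fun=> 0); first exact: holo_at_cst.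
  by apply/funext => w; rewrite big_nil.
case: (boolP (P i)) => Pi; last first.
  by rewrite (_ : (fun w => _) = fun w => \sum_(j <- s | P j) F j w) //;
    apply/funext => w; rewrite big_cons (negbTE Pi).
rewrite (_ : (fun w => _) = fun w => F i w + \sum_(j <- s | P j) F j w).
  exact: holo_atD.
by apply/funext => w; rewrite big_cons Pi.
Qed.

Lemma kernel_neq0 (dl s : R) (z w : C) : dl <= cabs (z - s%:C) -> cabs (w - z) < dl -> w - s%:C != 0.
Proof.
move=> hz h; rewrite -cabs_gt0.
have -> : w - s%:C = (z - s%:C) - (z - w) by rewrite opprB addrCA addrAC subrr add0r.
by apply: lt_le_trans (ler_cabsB _ _); rewrite subr_gt0 cabsB (lt_le_trans h).
Qed.

Lemma kernel_lipschitz (dl s : R) (z w : C) : 0 < dl -> dl <= cabs (z - s%:C) ->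
  cabs (w - z) <= dl / 2 ->
  cabs ((w - s%:C)^-1 - (z - s%:C)^-1) <= 2 / dl ^+ 2 * cabs (w - z).
Proof.
move=> d0 hz h; have hw : dl / 2 <= cabs (w - s%:C).
  have -> : w - s%:C = (z - s%:C) - (z - w) by rewrite opprB addrCA addrAC subrr add0r.
  apply: le_trans (ler_cabsB _ _); rewrite [cabs (z - w)]cabsB.
  by lra.
have z0 : z - s%:C != 0 by rewrite -cabs_gt0; lra.
have w0 : w - s%:C != 0 by rewrite -cabs_gt0; lra.
have -> : (w - s%:C)^-1 - (z - s%:C)^-1 = (z - w) / ((w - s%:C) * (z - s%:C)).
  by field; rewrite z0 w0.
rewrite cabsM cabsV cabsM [cabs (z - w)]cabsB mulrC ler_wpM2r ?cabs_ge0 //.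
rewrite -[2 / _]invf_div lef_pV2 ?posrE ?divr_gt0 ?exprn_gt0 ?mulr_gt0 ?cabs_gt0 //.
rewrite expr2 mulrAC; apply: ler_pM => //; lra.
Qed.

(** Summing over the fourth roots of unity cancels the powers of t not divisible by 4; with v = z -
    s the sum is exactly 4 t^4 / (v (v^4 - t^4)). For t < dl / 2 the modulus of v^4 - t^4 is at
    least dl^4 / 2, whence the constant 8. *)
Lemma kernel_four_points (dl s : R) (z : C) (t : R) :
  0 < dl -> dl <= cabs (z - s%:C) -> 0 < t < dl / 2 ->
  cabs (four_points (fun w => (w - s%:C)^-1) z t) <= 8 / dl ^+ 5 * t ^+ 4.
Proof.
move=> d0 hz /andP[t0 t1]; rewrite /four_points; set v := z - s%:C.
have v0 : v != 0 by rewrite -cabs_gt0 /v; lra.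
have nz (a : C) : cabs a = 1 -> v + a * t%:C != 0.
  move=> a1; rewrite /v addrAC; apply: (kernel_neq0 hz).
  by rewrite [z + _]addrC addrK cabsM a1 mul1r cabsR gtr0_norm //; lra.
have i1 : cabs ('i : C) = 1 by rewrite cabsE /= expr0n expr1n add0r sqrtr1.
have n1 := nz 1 (@cabs1 R); have n2 := nz (-1); rewrite cabsN cabs1 in n2.
have n3 := nz 'i i1; have n4 := nz (- 'i); rewrite cabsN i1 in n4.
move: n1 {n2}(n2 erefl) n3 {n4}(n4 erefl) => n1 n2 n3 n4.
rewrite mul1r in n1; rewrite mulN1r in n2; rewrite mulNr in n4.
have -> : z + t%:C - s%:C = v + t%:C by rewrite /v addrAC.
have -> : z - t%:C - s%:C = v - t%:C by rewrite /v addrAC.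
have -> : z + 'i * t%:C - s%:C = v + 'i * t%:C by rewrite /v addrAC.
have -> : z - 'i * t%:C - s%:C = v - 'i * t%:C by rewrite /v addrAC.
have ii : ('i : C) ^+ 2 = -1 by exact: sqr_i.
have e4 : (v + t%:C) * (v - t%:C) * ((v + 'i * t%:C) * (v - 'i * t%:C))
    = v ^+ 4 - t%:C ^+ 4.
  have -> : (v + 'i * t%:C) * (v - 'i * t%:C) = v ^+ 2 - 'i ^+ 2 * t%:C ^+ 2 by ring.
  by rewrite ii; ring.
have n5 : v ^+ 4 - t%:C ^+ 4 != 0 by rewrite -e4 !mulf_neq0.
have -> : (v + t%:C)^-1 + (v - t%:C)^-1 + (v + 'i * t%:C)^-1 + (v - 'i * t%:C)^-1
    - 4 * v^-1 = 4 * t%:C ^+ 4 / (v * (v ^+ 4 - t%:C ^+ 4)).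
  have f1 : v ^+ 2 - t%:C ^+ 2 = (v + t%:C) * (v - t%:C) by ring.
  have f2 : v ^+ 2 + t%:C ^+ 2 = (v + 'i * t%:C) * (v - 'i * t%:C).
    have -> : (v + 'i * t%:C) * (v - 'i * t%:C) = v ^+ 2 - 'i ^+ 2 * t%:C ^+ 2 by ring.
    by rewrite ii; ring.
  have m1 : v ^+ 2 - t%:C ^+ 2 != 0 by rewrite f1 mulf_neq0.
  have m2 : v ^+ 2 + t%:C ^+ 2 != 0 by rewrite f2 mulf_neq0.
  have -> : v ^+ 4 - t%:C ^+ 4 = (v ^+ 2 - t%:C ^+ 2) * (v ^+ 2 + t%:C ^+ 2) by ring.
  have -> : (v + t%:C)^-1 + (v - t%:C)^-1 = 2 * v * (v ^+ 2 - t%:C ^+ 2)^-1.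
    by rewrite f1; field; rewrite n1 n2.
  have e2 : (v + 'i * t%:C)^-1 + (v - 'i * t%:C)^-1 = 2 * v * (v ^+ 2 + t%:C ^+ 2)^-1.
    by rewrite f2; field; rewrite n3 n4.
  rewrite -(addrA (2 * v * _)) e2.
  by field; rewrite m1 m2 v0.
have hv : dl <= cabs v by [].
have hd : dl ^+ 4 / 2 <= cabs (v ^+ 4 - t%:C ^+ 4).
  apply: le_trans (ler_cabsB _ _); rewrite !cabsX cabsR gtr0_norm //.
  have h1 : dl ^+ 4 <= cabs v ^+ 4 by apply: lerXn2r; rewrite ?nnegrE ?cabs_ge0 // ltW.
  have h2 : t ^+ 4 <= (dl / 2) ^+ 4.
    by apply: lerXn2r; rewrite ?nnegrE ?divr_ge0 // ltW.
  have h3 : 0 <= dl ^+ 4 by rewrite exprn_ge0 // ltW.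
  have h4 : (dl / 2) ^+ 4 = dl ^+ 4 / 16 by field.
  lra.
have d4 : 0 < dl ^+ 4 by rewrite exprn_gt0.
rewrite cabsM cabsV (cabsM v) (cabsM 4) cabsX cabsR gtr0_norm //.
have -> : cabs (4 : C) = 4 by rewrite -[4]/(4%:R) -(rmorph_nat (real_complex R)) cabsR normr_nat.
have -> : 8 / dl ^+ 5 * t ^+ 4 = 4 * t ^+ 4 / (dl * (dl ^+ 4 / 2)).
  by field; rewrite gt_eqF.
rewrite ler_wpM2l ?mulr_ge0 ?exprn_ge0 ?(ltW t0) // lef_pV2 ?posrE.
- by apply: ler_pM => //; rewrite ?divr_ge0 // ltW.
- by rewrite mulr_gt0 // (lt_le_trans _ hv, lt_le_trans _ hd) // ?divr_gt0 // (lt_le_trans d0).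
- by rewrite mulr_gt0 // divr_gt0.
Qed.

Lemma holo_at_kernel (dl s : R) z : 0 < dl -> dl <= cabs (z - s%:C) ->
  holo_at (fun w => (w - s%:C)^-1) z.
Proof.
move=> d0 hz; exists (2 / dl ^+ 2 + 8 / dl ^+ 5), (dl / 2); split.
- by rewrite addr_ge0 // divr_ge0 // exprn_ge0 // ltW.
- by rewrite divr_gt0.
- move=> w /ltW h; apply: le_trans (kernel_lipschitz d0 hz h) _.
  by rewrite ler_wpM2r ?cabs_ge0 // lerDl divr_ge0 // exprn_ge0 // ltW.
- move=> t ht; apply: le_trans (kernel_four_points d0 hz ht) _.
  have /andP[t0 _] := ht.
  by rewrite ler_wpM2r ?exprn_ge0 ?ltW // ltrDr divr_gt0 // exprn_gt0.
Qed.

(* At an interior maximum z0 of Re F + eps |.|^2 the sum over z0 + i^k t would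
   exceed four times the maximum by 4 eps t^2 - O(t^4). *)
Lemma maximum_principle (Om : set T) F (e : R) :
  open Om -> compact (closure Om) ->
  (forall z, closure Om z -> holo_at F z) ->
  (forall z, closure Om z -> ~ Om z -> Re (F z) <= e) ->
  forall z, Om z -> Re (F z) <= e.
Proof.
move=> oO cO hF hb z1 Oz1; rewrite leNgt; apply/negP => lt1.
have [B hB] := compact_cabs_le cO.
have B0 : 0 <= B by apply: le_trans (cabs_ge0 z1) (hB _ (subset_closure Oz1)).
(* Small enough that on the closure, where |z| <= B, the added term stays below the excess of Re F
   z1 over e; the maximum of the perturbed function cannot lie outside [Om]. *)
pose eps := (Re (F z1) - e) / (2 * (B ^+ 2 + 1)).
have b1 : 0 < B ^+ 2 + 1 by rewrite ltr_wpDl ?sqr_ge0.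
have eps0 : 0 < eps by rewrite divr_gt0 ?subr_gt0 // mulr_gt0.
pose g (z : T) : R := Re (F z) + eps * cabs z ^+ 2.
have cg : {within closure Om, continuous g}.
  apply: cplx_within_continuous => z cz e' e'0.
  have [c [dl [c0 d0 F1 _]]] := hF z cz.
  have M0 : 0 < c + eps * (2 * B + 1) + 1.
    apply: ltr_wpDl => //; apply: addr_ge0 => //; apply: mulr_ge0; first exact: ltW.
    by apply: addr_ge0 => //; exact: mulr_ge0.
  exists (Num.min dl (Num.min 1 (e' / (c + eps * (2 * B + 1) + 1)))).
    by rewrite !lt_min d0 ltr01 divr_gt0.
  move=> w; rewrite !lt_min => /and3P[/F1 h1 h2 h3].
  rewrite /g opprD addrACA; apply: le_lt_trans (ler_normD _ _) _.
  have h4 : `|Re (F w) - Re (F z)| <= c * cabs (w - z).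
    by rewrite -ReN -ReD; apply: le_trans (normRe_le _) h1.
  have h5 : `|eps * cabs w ^+ 2 - eps * cabs z ^+ 2| <= eps * (2 * B + 1) * cabs (w - z).
    rewrite -mulrBr normrM gtr0_norm // -mulrA ler_pM2l // subr_sqr normrM.
    rewrite mulrC; apply: ler_pM => //.
      rewrite ger0_norm ?addr_ge0 ?cabs_ge0 //.
      have := hB _ cz; have : cabs w <= cabs z + 1.
        by have := ler_cabsB w z; lra.
      lra.
    rewrite ler_norml ler_cabsB andbT lerNl opprB cabsB; exact: ler_cabsB.
  move: h3; rewrite ltr_pdivlMr // => h3; apply: le_lt_trans h3.
  have := cabs_ge0 (w - z); nra.
have [z0 cz0 hmax] := compact_EVT_max (T := T) (f := g) (ex_intro _ z1 (subset_closure Oz1)) cO cg.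
rewrite inE in cz0.
have g1 : g z1 <= g z0 by apply: hmax; rewrite inE; exact: subset_closure.
have epsB : eps * (2 * (B ^+ 2 + 1)) = Re (F z1) - e by rewrite /eps divfK // gt_eqF // mulr_gt0.
have Oz0 : Om z0.
  apply: contrapT => /(hb _ cz0) hz0; move: g1; rewrite /g => g1.
  have h1 : 0 <= eps * cabs z1 ^+ 2 by rewrite mulr_ge0 ?sqr_ge0 ?ltW.
  have h2 : eps * cabs z0 ^+ 2 <= eps * B ^+ 2.
    by rewrite ler_pM2l // lerXn2r ?nnegrE ?cabs_ge0 //; exact: hB.
  have h3 : 0 <= eps * B ^+ 2 by rewrite mulr_ge0 ?sqr_ge0 ?ltW.
  lra.
have [c [dl [c0 d0 _ F2]]] := hF z0 cz0.
have /cplx_nbhsP [r r0 hr] : nbhs z0 Om by exact: open_nbhs_nbhs.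
(* The first two bounds keep the four points inside [Om] and in the range of the estimate at z0; the
   last two give c t^4 <= eps t^2, less than the gain 4 eps t^2. *)
pose t := Num.min (Num.min (dl / 2) (r / 2)) (Num.min 1 (eps / (c + 1))).
have c1 : 0 < c + 1 by exact: ltr_wpDl.
have t0 : 0 < t by rewrite !lt_min ltr01 (divr_gt0 eps0 c1) (divr_gt0 d0) // (divr_gt0 r0).
have tdl : t < dl by apply: (@le_lt_trans _ _ (dl / 2)); [rewrite /t !ge_min lexx|lra].
have tr : t < r by apply: (@le_lt_trans _ _ (r / 2)); [rewrite /t !ge_min lexx orbT|lra].
have t1 : t <= 1 by rewrite /t !ge_min lexx !orbT.
have tc : t * (c + 1) <= eps.
  by rewrite -ler_pdivlMr // /t !ge_min lexx !orbT.
have F4 : cabs (four_points F z0 t) <= c * t ^+ 4 by apply: F2; rewrite t0.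
have ht (a : C) : cabs a = 1 -> g (z0 + a * t%:C) <= g z0.
  move=> a1; apply: hmax; rewrite inE; apply: subset_closure; apply: hr.
  by rewrite [z0 + _]addrC addrK cabsM a1 mul1r cabsR gtr0_norm.
have i1 : cabs ('i : C) = 1 by rewrite cabsE /= expr0n expr1n add0r sqrtr1.
have n1 := ht 1 (@cabs1 R); have n2 := ht (-1); rewrite cabsN cabs1 in n2.
have n3 := ht 'i i1; have n4 := ht (- 'i); rewrite cabsN i1 in n4.
move: n1 {n2}(n2 erefl) n3 {n4}(n4 erefl) => n1 n2 n3 n4.
rewrite mul1r in n1; rewrite mulN1r in n2; rewrite mulNr in n4.
have sq : cabs (z0 + t%:C) ^+ 2 + cabs (z0 - t%:C) ^+ 2 + cabs (z0 + 'i * t%:C) ^+ 2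
   + cabs (z0 - 'i * t%:C) ^+ 2 = 4 * cabs z0 ^+ 2 + 4 * t ^+ 2.
  rewrite !sqr_cabs; case: (z0) => x y /=; ring.
have f4 : - (c * t ^+ 4) <= Re (four_points F z0 t).
  have := le_trans (normRe_le _) F4; rewrite ler_norml => /andP[] //.
move: f4; rewrite /four_points !ReD ReN.
have -> : Re (4 * F z0) = 4 * Re (F z0).
  by rewrite -[4]/(4%:R) -(rmorph_nat (real_complex R)) ReZ.
move: n1 n2 n3 n4; rewrite /g => n1 n2 n3 n4 f4.
have sq' := congr1 (fun x => eps * x) sq; rewrite /= !mulrDr in sq'.
have t2 : 0 < t ^+ 2 by rewrite exprn_gt0.
have t4 : c * t ^+ 4 <= eps * t ^+ 2.
  have -> : c * t ^+ 4 = (c * t) * (t * t ^+ 2) by ring.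
  have h1 : c * t <= eps by move: tc; rewrite mulrDr mulr1 mulrC; lra.
  have h2 : t * t ^+ 2 <= t ^+ 2 by rewrite ler_piMl // ltW.
  by apply: ler_pM => //; rewrite mulr_ge0 // ltW // ?mulr_gt0.
have t5 : 0 < eps * t ^+ 2 by rewrite mulr_gt0.
lra.
Qed.

End MaximumPrinciple.

(** * Stieltjes transforms *)

Section ComplexContinuity.
Context {R : realType}.
Local Notation T := (Cplx R).

Lemma Re_continuous : continuous (@complex.Re R : T -> R).
Proof.
move=> z B /nbhs_ballP [e /= e0 hB]; apply/cplx_nbhsP; exists e => // w hw; apply: hB.
rewrite -ball_normE /= -ReN -ReD; apply: le_lt_trans (normRe_le _) _.
by rewrite cabsB.
Qed.

Lemma Im_continuous : continuous (@complex.Im R : T -> R).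
Proof.
move=> z B /nbhs_ballP [e /= e0 hB]; apply/cplx_nbhsP; exists e => // w hw; apply: hB.
rewrite -ball_normE /= -ImN -ImD; apply: le_lt_trans (normIm_le _) _.
by rewrite cabsB.
Qed.

Lemma real_complex_continuous : continuous (fun x : R => x%:C : T).
Proof.
move=> x B /cplx_nbhsP [e e0 hB]; apply/nbhs_ballP; exists e => // w; rewrite -ball_normE /= => hw.
by apply: hB; rewrite -rmorphB cabsR distrC.
Qed.

Lemma kernel_continuous (z : T) (s : R) : z - s%:C != 0 ->
  continuous_at s ((fun x : R => (z - x%:C)^-1) : R -> T).
Proof.
move=> h; apply: (@cvgV _ _ (nbhs s) _ (fun x : R => (z - x%:C : T)) (z - s%:C : T) h).
apply: (@cvgB _ T _ (nbhs s) _ (cst z) (fun x : R => (x%:C : T))); first exact: cvg_cst.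
exact: real_complex_continuous.
Qed.

End ComplexContinuity.

Section States.
Context {R : realType}.
Local Notation T := (Cplx R).
Local Notation C := R[i].
Implicit Types (b : R) (f g : R -> C).

Definition cont_on b f := forall s, - b <= s <= b -> continuous_at s (f : R -> T).

Lemma cont_on_cst b (a : C) : cont_on b (fun=> a).
Proof. by move=> s _; exact: cvg_cst. Qed.

Lemma cont_onD b f g : cont_on b f -> cont_on b g -> cont_on b (fun s => f s + g s).
Proof. by move=> hf hg s hs; apply: cvgD; [exact: hf|exact: hg]. Qed.

Lemma cont_onM b f g : cont_on b f -> cont_on b g -> cont_on b (fun s => f s * g s).
Proof.
move=> hf hg s hs.
by apply: (@cvgM _ _ (nbhs s) _ (f : R -> T) (g : R -> T)); [exact: hf|exact: hg].
Qed.

Lemma cont_onZ b (a : C) f : cont_on b f -> cont_on b (fun s => a * f s).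
Proof. by move=> cf; exact: (cont_onM (@cont_on_cst b a) cf). Qed.

Lemma cont_on_kernel b (z : C) : (forall s : R, - b <= s <= b -> z - s%:C != 0) ->
  cont_on b (fun s => (z - s%:C)^-1).
Proof. by move=> h s /h; exact: kernel_continuous. Qed.

(* Positive normalised functionals on the continuous functions on [-b, b]: this
   covers both transforms, phi being the Stieltjes transform of the symmetrised
   square-root image of mu, and phit that of its mixture with the mass at 0. *)
Record state b (L : (R -> C) -> C) : Prop := State {
  stateD : forall f g, cont_on b f -> cont_on b g ->
    L (fun s => f s + g s) = L f + L g;
  stateZ : forall (a : C) f, cont_on b f -> L (fun s => a * f s) = a * L f;
  state_Re_ge : forall (m : R) f, cont_on b f ->
    (forall s, - b <= s <= b -> m <= Re (f s)) -> m <= Re (L f) }.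

Section StateTheory.
Context {b : R} {L : (R -> C) -> C} (hL : state b L).

Lemma state_Re_le m f : cont_on b f ->
  (forall s, - b <= s <= b -> Re (f s) <= m) -> Re (L f) <= m.
Proof.
move=> cf h; rewrite -lerN2 -ReN -[- L f]mulN1r -(stateZ hL) //.
apply: (state_Re_ge hL) => [|s hs]; first exact: cont_onZ.
by rewrite mulN1r ReN lerN2 h.
Qed.

Lemma ImE (z : C) : Im z = - Re ('i * z).
Proof. by case: z => x y /=; rewrite mul0r mul1r sub0r opprK. Qed.

Lemma state_Im_le m f : cont_on b f ->
  (forall s, - b <= s <= b -> Im (f s) <= m) -> Im (L f) <= m.
Proof.
move=> cf h; rewrite ImE lerNl -(stateZ hL) //.
apply: (state_Re_ge hL) => [|s hs]; first exact: cont_onZ.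
by rewrite lerNl -ImE h.
Qed.

Lemma state_Im_ge m f : cont_on b f ->
  (forall s, - b <= s <= b -> m <= Im (f s)) -> m <= Im (L f).
Proof.
move=> cf h; rewrite ImE lerNr -(stateZ hL) //.
apply: state_Re_le => [|s hs]; first exact: cont_onZ.
by rewrite lerNr -ImE h.
Qed.

Lemma state_real f : cont_on b f ->
  (forall s, - b <= s <= b -> Im (f s) = 0) -> L f = (Re (L f))%:C.
Proof.
move=> cf h; apply/eqP; rewrite eq_complex /= eqxx andTb eq_le.
by rewrite state_Im_le ?state_Im_ge // => s /h ->.
Qed.

(** The factor 2 comes from treating real and imaginary parts separately. *)
Lemma state_cabs_le m f : cont_on b f ->
  (forall s, - b <= s <= b -> cabs (f s) <= m) -> cabs (L f) <= 2 * m.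
Proof.
move=> cf h; apply: le_trans (cabs_le_ReIm _) _.
have hR : `|Re (L f)| <= m.
  rewrite ler_norml (state_Re_ge hL) ?state_Re_le // => s /h hs.
    by apply: le_trans hs; exact: Re_le.
  by rewrite lerNl (le_trans _ hs) // -ReN -(cabsN (f s)) Re_le.
have hI : `|Im (L f)| <= m.
  rewrite ler_norml state_Im_ge ?state_Im_le // => s /h hs.
    by apply: le_trans hs; apply: le_trans (normIm_le _); exact: ler_norm.
  by rewrite lerNl (le_trans _ hs) // (le_trans _ (normIm_le _)) // -normrN ler_norm.
lra.
Qed.

Lemma stateB f g : cont_on b f -> cont_on b g ->
  L (fun s => f s - g s) = L f - L g.
Proof.
move=> cf cg; have -> : (fun s => f s - g s) = (fun s => f s + -1 * g s).
  by apply/funext => s; rewrite mulN1r.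
by rewrite (stateD hL cf (cont_onZ (a := -1) cg)) (stateZ hL _ cg) mulN1r.
Qed.

Lemma eq_state f g : cont_on b f -> cont_on b g ->
  (forall s, - b <= s <= b -> f s = g s) -> L f = L g.
Proof.
move=> cf cg h; apply/eqP; rewrite -subr_eq0 -cabs_eq0 eq_le cabs_ge0 andbT.
rewrite -stateB //; have -> : (0 : R) = 2 * 0 by rewrite mulr0.
apply: state_cabs_le => [|s /h ->]; last by rewrite subrr cabs0.
have cN : cont_on b (fun s => -1 * g s) by exact: cont_onZ.
have := cont_onD cf cN; congr (cont_on b _).
by apply/funext => s; rewrite mulN1r.
Qed.

End StateTheory.

Lemma state_mixture b L (c : R) : 0 <= c <= 1 -> 0 <= b -> state b L ->
  state b (fun f => c%:C * L f + (1 - c)%:C * f 0).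
Proof.
move=> /andP[c0 c1] b0 hL; split => [f g cf cg|a f cf|m f cf h].
- by rewrite (stateD hL) //; ring.
- by rewrite (stateZ hL) //; ring.
- rewrite ReD !ReZ; have := state_Re_ge hL cf h.
  have : m <= Re (f 0) by apply: h; rewrite oppr_le0 b0.
  nra.
Qed.

End States.

(** * The functional attached to the noise law *)

Section NoiseState.
Context {R : realType} (mu : probability (measurableTypeR R) R).
Local Notation T := (Cplx R).
Local Notation C := R[i].

(** A point outside the support lies in a null open set, hence in a null interval with rational
    endpoints, and there are countably many of these. *)
Lemma msupport_conull : mu.-negligible (~` msupport mu).
Proof.
pose G (pq : rat * rat) : set (measurableTypeR R) :=
  let I := `]ratr pq.1, ratr pq.2[%classic in if `[< mu I = 0%E >] then I else set0.
pose F n := oapp G set0 (unpickle n).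
apply: (@negligibleS _ _ _ mu (\bigcup_n F n)); last first.
  apply: negligible_bigcup => n; rewrite /F.
  case: unpickle => [pq|]; last exact: negligible_set0.
  rewrite /= /G; case: asboolP => h; last exact: negligible_set0.
  by apply/negligibleP; first exact: measurable_itv.
move=> x /existsNP [U /not_implyP [oU /not_implyP [Ux /negP]]].
rewrite -leNgt => U0; have /nbhs_ballP [e /= e0 he] : nbhs x U by exact: open_nbhs_nbhs.
have e0' : (0 : R) < e by [].
have /rat_in_itvoo [p] : (x : R) - e < x by rewrite ltrBlDr ltrDl.
rewrite in_itv /= => /andP[p1 p2].
have /rat_in_itvoo [q] : (x : R) < x + e by rewrite ltrDl.
rewrite in_itv /= => /andP[q1 q2].
have sub : `]ratr p, ratr q[%classic `<=` U.
  move=> y /=; rewrite in_itv /= => /andP[y1 y2]; apply: he.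
  by rewrite -ball_normE /= ltr_norml; apply/andP; split; lra.
have pq0 : mu `]ratr p, ratr q[%classic = 0%E.
  apply/eqP; rewrite -measure_le0; apply: le_trans U0.
  by apply: le_measure => //; rewrite inE; [exact: measurable_itv|exact: measurable_realfun.open_measurable].
have FE : F (pickle (p, q)) = G (p, q) by rewrite /F pickleK.
exists (pickle (p, q)); first exact: I.
by rewrite FE /G asboolT //= in_itv /= p2 q1.
Qed.

Context (mu_neg : mu [set x | x < 0] = 0%E) (mu_cpt : compact (msupport mu)).
Local Notation b := (edge mu).

Lemma msupport_ge0 x : msupport mu x -> 0 <= x.
Proof.
move=> h; rewrite leNgt; apply/negP => x0.
have := h [set y | y < 0] (@open_lt R 0) x0.
by rewrite mu_neg ltxx.
Qed.

Lemma msupport_has_sup : has_sup (msupport mu).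
Proof.
apply: compact_has_sup => //; apply: contrapT => /set0P/negP; rewrite negbK => /eqP h.
have := msupport_conull; rewrite h setC0 => /negligibleP => /(_ measurableT).
move=> e0; have := eq_trans (esym (probability_setT mu)) e0.
by move/eqP; rewrite onee_eq0.
Qed.

Lemma sqr_edge : b ^+ 2 = sup (msupport mu).
Proof.
rewrite sqr_sqrtr //; have [[x hx] hub] := msupport_has_sup.
by apply: le_trans (msupport_ge0 hx) _; exact: ub_le_sup.
Qed.

Lemma edge_ge0 : 0 <= b.
Proof. exact: sqrtr_ge0. Qed.

(** The interval spanned by 0 and the edge, not the support itself: both square roots of its points
    lie in [-b, b], where test functions are continuous. *)
Definition noise_support : set (measurableTypeR R) := `[0, b ^+ 2]%classic.

Lemma measurable_noise_support : measurable noise_support.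
Proof. exact: measurable_itv. Qed.

Lemma noise_support_conull : mu (~` noise_support) = 0%E.
Proof.
apply/negligibleP; first by apply: measurableC; exact: measurable_noise_support.
apply: negligibleS msupport_conull => x hx sx; apply: hx.
rewrite /noise_support /= in_itv /= msupport_ge0 //= sqr_edge.
by apply: ub_le_sup => //; have [] := msupport_has_sup.
Qed.

Lemma noise_support_full : mu noise_support = 1%E.
Proof.
rewrite -(probability_setT mu) -(setvU noise_support) measureU.
- by rewrite [X in (X + _)%E](noise_support_conull) add0e.
- by apply: measurableC; exact: measurable_noise_support.
- exact: measurable_noise_support.
- exact: setICl.
Qed.

Definition noise_state (f : R -> C) : C :=
  let g x := 2^-1 * (f (Num.sqrt x) + f (- Num.sqrt x)) : C in
  (\int[mu]_(x in noise_support) Re (g x)) +i* (\int[mu]_(x in noise_support) Im (g x)).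

Lemma sqrt_noise_support (x : R) : noise_support x ->
  - b <= Num.sqrt x <= b /\ - b <= - Num.sqrt x <= b.
Proof.
rewrite /noise_support /= in_itv /= => /andP[x0 xb].
have h : Num.sqrt x <= b by rewrite -(ger0_norm edge_ge0) -sqrtr_sqr ler_wsqrtr.
by have := sqrtr_ge0 x; have := edge_ge0; split; apply/andP; split; lra.
Qed.

Definition symmetrize (f : R -> C) (x : R) : C :=
  2^-1 * (f (Num.sqrt x) + f (- Num.sqrt x)).

Lemma symmetrize_continuous f (x : R) : cont_on b f -> noise_support x ->
  continuous_at x (symmetrize f : R -> T).
Proof.
move=> cf /sqrt_noise_support [h1 h2].
have s1 : (f \o Num.sqrt : R -> T) y @[y --> x] --> (f (Num.sqrt x) : T).
  by apply: (@continuous_comp R R T Num.sqrt (f : R -> T)); [exact: sqrt_continuous|exact: cf].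
have s2 : (f \o (fun y => - Num.sqrt y) : R -> T) y @[y --> x] --> (f (- Num.sqrt x) : T).
  apply: (@continuous_comp R R T (fun y => - Num.sqrt y) (f : R -> T)); last exact: cf.
  by apply: cvgN; exact: sqrt_continuous.
apply: (@cvgM _ _ (nbhs x) _ (cst (2^-1 : T)) (fun y => f (Num.sqrt y) + f (- Num.sqrt y) : T)).
  exact: cvg_cst.
exact: cvgD s1 s2.
Qed.

Lemma symmetrize_integrable f : cont_on b f ->
  mu.-integrable noise_support (EFin \o (fun x => Re (symmetrize f x))) /\
  mu.-integrable noise_support (EFin \o (fun x => Im (symmetrize f x))).
Proof.
move=> cf.
have int (h : R -> R) : {in noise_support, continuous h} ->
    mu.-integrable noise_support (EFin \o h).
  move=> ch; have wh : {within noise_support, continuous h} by exact: continuous_in_subspaceT.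
  apply: measurable_bounded_integrable.
  - exact: measurable_noise_support.
  - apply: (@le_lt_trans _ _ 1%E); last exact: ltry.
    by rewrite le_eqVlt; apply/orP; left; apply/eqP; exact: noise_support_full.
  - by apply: measurable_realfun.subspace_continuous_measurable_fun => //; exact: measurable_noise_support.
  - have := compact_bounded (continuous_compact wh (@segment_compact R 0 (b ^+ 2))).
    by case=> M [Mr hM]; exists M; split => // x /hM {}hM y hy; apply: hM; exists y.
split; apply: int => x; rewrite inE => /(symmetrize_continuous cf) cx.
  by apply: (@continuous_comp R T R (symmetrize f)) => //; exact: Re_continuous.
by apply: (@continuous_comp R T R (symmetrize f)) => //; exact: Im_continuous.
Qed.

Lemma noise_state_state : state b noise_state.
Proof.
have mD := measurable_noise_support; split => [f g cf cg|a f cf|m f cf h].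
- have [If1 If2] := symmetrize_integrable cf; have [Ig1 Ig2] := symmetrize_integrable cg.
  have e x : 2^-1 * (f (Num.sqrt x) + g (Num.sqrt x) + (f (- Num.sqrt x) + g (- Num.sqrt x)))
      = symmetrize f x + symmetrize g x by rewrite /symmetrize; ring.
  rewrite /noise_state -/(symmetrize f _).
  under eq_Rintegral do rewrite e ReD.
  under [X in _ +i* X = _]eq_Rintegral do rewrite e ImD.
  by rewrite !RintegralD.
- have [If1 If2] := symmetrize_integrable cf.
  have e x : 2^-1 * (a * f (Num.sqrt x) + a * f (- Num.sqrt x)) = a * symmetrize f x.
    by rewrite /symmetrize; ring.
  rewrite /noise_state -/(symmetrize f _).
  have mZ (u : R) h : mu.-integrable noise_support (EFin \o h) ->
      mu.-integrable noise_support (EFin \o (fun x => u * h x)).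
    move=> ih; apply: (eq_integrable mD) (integrableZl mD u ih) => // x _.
  under eq_Rintegral do rewrite e ReM.
  under [X in _ +i* X = _]eq_Rintegral do rewrite e ImM.
  rewrite RintegralB ?RintegralD ?RintegralZl //; try exact: mZ.
  by apply/eqP; rewrite eq_complex ReM ImM /= !eqxx.
- have [If1 _] := symmetrize_integrable cf.
  have -> : m = \int[mu]_(x in noise_support) m.
    rewrite Rintegral_cst //.
    have -> : fine (mu noise_support) = 1 by rewrite [X in fine X]noise_support_full.
    by rewrite mulr1.
  apply: le_Rintegral => //.
    apply: measurable_bounded_integrable => //.
      apply: (@le_lt_trans _ _ 1%E); last exact: ltry.
      by rewrite le_eqVlt; apply/orP; left; apply/eqP; exact: noise_support_full.
    by exists `|m|; split=> // y hy z _ /=; apply: ltW.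
  move=> x /sqrt_noise_support [/h h1 /h h2]; rewrite /symmetrize.
  have -> : (2^-1 : C) = (2^-1 : R)%:C by rewrite fmorphV /= rmorph_nat.
  by rewrite ReZ ReD; lra.
Qed.

Lemma off_cut_kernel_neq0 (z : C) (s : R) : off_cut mu z -> - b <= s <= b ->
  z - s%:C != 0.
Proof.
move=> hz hs; apply/eqP => /eqP; rewrite subr_eq0 => /eqP zs; apply: hz.
by rewrite zs.
Qed.

(* The integrand of phi may be singular at a point outside the support. *)
Lemma phi_integrand_measurable (z : C) (h : C -> R) : continuous (h : T -> R) ->
  measurable_fun setT (fun x : R => h (z / (z ^+ 2 - x%:C))).
Proof.
move=> ch; pose p := Re (z ^+ 2).
rewrite -(setvU [set p]); apply/measurable_funU => //.
  by apply: measurableC; exact: measurable_set1.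
split; last exact: measurable_fun_set1.
apply: measurable_realfun.open_continuous_measurable_fun.
  by rewrite openC; exact: closed_eq.
move=> x; rewrite inE /= => xp.
have nz : z ^+ 2 - x%:C != 0.
  by apply: contra_not_neq xp => /eqP; rewrite subr_eq0 /p => /eqP ->.
apply: (@continuous_comp R T R (fun x : R => z / (z ^+ 2 - x%:C)) h); last exact: ch.
apply: (@cvgM _ _ (nbhs x) _ (cst (z : T)) (fun x : R => (z ^+ 2 - x%:C)^-1 : T)).
  exact: cvg_cst.
exact: kernel_continuous.
Qed.

Lemma Rintegral_noise_support (h g : R -> R) : measurable_fun setT h ->
  mu.-integrable noise_support (EFin \o g) ->
  (forall x, noise_support x -> h x = g x) ->
  \int[mu]_x h x = \int[mu]_(x in noise_support) g x.
Proof.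
move=> mh ig hg; have mD := measurable_noise_support.
have DE : setT `\` (~` noise_support) = noise_support by rewrite setTD setCK.
have ih : mu.-integrable noise_support (EFin \o h).
  by apply: eq_integrable ig => // x; rewrite inE => /hg /= ->.
have mN : measurable (~` noise_support) by exact: measurableC.
rewrite /Rintegral (@negligible_integral _ _ _ mu setT (~` noise_support)) //.
- rewrite DE; congr fine; apply: eq_integral => x; rewrite inE => /hg -> //.
- apply/(@negligible_integrable _ _ _ mu setT (~` noise_support)) => //.
  + exact/measurable_realfun.measurable_EFinP.
  + exact: noise_support_conull.
  + by rewrite DE.
- exact: noise_support_conull.
Qed.

(** Partial fractions: z / (z^2 - x) is the mean of 1 / (z - sqrt x) and 1 / (z + sqrt x). The two
    integrals run over different sets, whose difference is null. *)
Lemma phi_noise_state z : off_cut mu z ->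
  phi mu z = noise_state (fun s => (z - s%:C)^-1).
Proof.
move=> hz; have ck : cont_on b (fun s => (z - s%:C)^-1).
  by apply: cont_on_kernel => s; exact: off_cut_kernel_neq0.
have [I1 I2] := symmetrize_integrable ck.
have e (x : R) : noise_support x ->
    z / (z ^+ 2 - x%:C) = symmetrize (fun s => (z - s%:C)^-1) x.
  move=> Dx; have [h1 h2] := sqrt_noise_support Dx.
  have := off_cut_kernel_neq0 hz h1; have := off_cut_kernel_neq0 hz h2.
  have x0 : 0 <= x by move: Dx; rewrite /noise_support /= in_itv /= => /andP[].
  rewrite /symmetrize rmorphN /= opprK; set s := (Num.sqrt x)%:C => n1 n2.
  have -> : x%:C = s ^+ 2 by rewrite -rmorphXn /= sqr_sqrtr.
  have n3 : z ^+ 2 - s ^+ 2 != 0 by rewrite subr_sqr mulf_neq0.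
  by field; rewrite n1 n2 n3.
rewrite /phi /cintegral /noise_state -/(symmetrize _ _); congr (_ +i* _).
- apply: Rintegral_noise_support => // [|x /e -> //].
  exact: (phi_integrand_measurable z (@Re_continuous R)).
- apply: Rintegral_noise_support => // [|x /e -> //].
  exact: (phi_integrand_measurable z (@Im_continuous R)).
Qed.

Lemma phit_noise_state (c : R) z : off_cut mu z ->
  phit mu c z = c%:C * noise_state (fun s => (z - s%:C)^-1)
                + (1 - c)%:C * (z - 0%:C)^-1.
Proof. by move=> hz; rewrite /phit phi_noise_state // subr0. Qed.

End NoiseState.

Section Stieltjes.
Context {R : realType} {b : R}.
Local Notation T := (Cplx R).
Local Notation C := R[i].
Implicit Types (z w : C) (dl : R).

(** A quantitative [off_cut]: the estimates below are expressed by powers of this distance to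
    [-b, b]. *)
Definition gap dl z := forall s, - b <= s <= b -> dl <= cabs (z - s%:C).

Lemma gap_neq0 dl z s : 0 < dl -> gap dl z -> - b <= s <= b -> z - s%:C != 0.
Proof. by move=> d0 h /h hs; rewrite -cabs_gt0 (lt_le_trans d0). Qed.

Lemma cont_on_gap dl z : 0 < dl -> gap dl z -> cont_on b (fun s => (z - s%:C)^-1).
Proof. by move=> d0 h; apply: cont_on_kernel => s; exact: gap_neq0 d0 h. Qed.

Lemma kernel_le dl z s : 0 < dl -> gap dl z -> - b <= s <= b ->
  cabs (z - s%:C)^-1 <= dl^-1.
Proof.
by move=> d0 h /h hs; rewrite cabsV lef_pV2 // posrE (lt_le_trans d0).
Qed.

Lemma gap_exists z : (Im z = 0 -> b < `|Re z|) -> exists2 dl, 0 < dl & gap dl z.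
Proof.
move=> h; have [z0|z0] := eqVneq (Im z) 0.
  exists (`|Re z| - b); first by rewrite subr_gt0 h.
  move=> s /andP[s1 s2]; apply: le_trans (normRe_le _).
  have : `|Re z| - `|s| <= `|Re (z - s%:C)|.
    by rewrite ReD ReN /=; exact: lerB_dist.
  have : `|s| <= b by rewrite ler_norml s1.
  lra.
exists `|Im z|; first by rewrite normr_gt0.
by move=> s _; apply: le_trans (normIm_le _); rewrite ImD ImN /= subr0.
Qed.

Lemma gap_near dl z w : gap dl z -> cabs (w - z) <= dl / 2 -> gap (dl / 2) w.
Proof.
move=> h hw s /h hs; have -> : w - s%:C = (z - s%:C) - (z - w) by ring.
by apply: le_trans (ler_cabsB _ _); move: hw; rewrite [cabs (z - w)]cabsB; lra.
Qed.

Context {L : (R -> C) -> C} (hL : state b L).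

(** The Stieltjes transform and its divided differences at (z, w) and (z, w, w). Written under the
    functional they make sense at z = w too, where [st1] is the derivative. *)
Definition st z := L (fun s => (z - s%:C)^-1).
Definition st1 z w := - L (fun s => (z - s%:C)^-1 * (w - s%:C)^-1).
Definition st2 z w :=
  L (fun s => (z - s%:C)^-1 * ((w - s%:C)^-1 * (w - s%:C)^-1)).

Section Estimates.
Context {dl : R} (d0 : 0 < dl).

Lemma cabs_st_le z : gap dl z -> cabs (st z) <= 2 / dl.
Proof.
by move=> h; apply: (state_cabs_le hL) => [|s]; [exact: cont_on_gap h|exact: kernel_le].
Qed.

Lemma cabs_st1_le z w : gap dl z -> gap dl w -> cabs (st1 z w) <= 2 / dl ^+ 2.
Proof.
move=> hz hw; have cz := cont_on_gap d0 hz; have cw := cont_on_gap d0 hw.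
rewrite /st1 cabsN; apply: (state_cabs_le hL) => [|s hs]; first exact: cont_onM cz cw.
by rewrite cabsM -exprVn expr2; apply: ler_pM; rewrite ?cabs_ge0 ?kernel_le.
Qed.

Lemma cabs_st2_le z w : gap dl z -> gap dl w -> cabs (st2 z w) <= 2 / dl ^+ 3.
Proof.
move=> hz hw; have cz := cont_on_gap d0 hz; have cw := cont_on_gap d0 hw.
rewrite /st2; apply: (state_cabs_le hL) => [|s hs].
  exact: cont_onM cz (cont_onM cw cw).
rewrite !cabsM -exprVn exprS expr2.
by do 2?[apply: ler_pM]; rewrite ?mulr_ge0 ?cabs_ge0 ?kernel_le.
Qed.

Lemma st_sub z w : gap dl z -> gap dl w -> st z - st w = (z - w) * st1 z w.
Proof.
move=> hz hw; have cz := cont_on_gap d0 hz; have cw := cont_on_gap d0 hw.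
rewrite /st /st1 -(stateB hL cz cw) mulrN -mulNr -(stateZ hL _ (cont_onM cz cw)).
apply: (eq_state hL) => [||s hs].
- have -> : (fun s => (z - s%:C)^-1 - (w - s%:C)^-1) =
     (fun s => (z - s%:C)^-1 + -1 * (w - s%:C)^-1) by apply/funext => s; rewrite mulN1r.
  exact: cont_onD cz (cont_onZ (a := -1) cw).
- exact: cont_onZ (cont_onM cz cw).
- by have := gap_neq0 d0 hz hs; have := gap_neq0 d0 hw hs => n1 n2; field; rewrite n1 n2.
Qed.

Lemma st1_sub z w : gap dl z -> gap dl w -> st1 z w - st1 w w = (z - w) * st2 z w.
Proof.
move=> hz hw; have cz := cont_on_gap d0 hz; have cw := cont_on_gap d0 hw.
rewrite /st1 /st2 opprK addrC -(stateB hL (cont_onM cw cw) (cont_onM cz cw)).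
rewrite -(stateZ hL _ (cont_onM cz (cont_onM cw cw))).
apply: (eq_state hL) => [||s hs].
- have -> : (fun s => (w - s%:C)^-1 * (w - s%:C)^-1 - (z - s%:C)^-1 * (w - s%:C)^-1) =
     (fun s => (w - s%:C)^-1 * (w - s%:C)^-1 + -1 * ((z - s%:C)^-1 * (w - s%:C)^-1)).
    by apply/funext => s; rewrite mulN1r.
  exact: cont_onD (cont_onM cw cw) (cont_onZ (a := -1) (cont_onM cz cw)).
- exact: cont_onZ (cont_onM cz (cont_onM cw cw)).
- by have := gap_neq0 d0 hz hs; have := gap_neq0 d0 hw hs => n1 n2; field; rewrite n1 n2.
Qed.

Lemma kernel_sub z w s : gap dl z -> gap dl w -> - b <= s <= b ->
  cabs ((z - s%:C)^-1 - (w - s%:C)^-1) <= cabs (z - w) / dl ^+ 2.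
Proof.
move=> hz hw hs; have := gap_neq0 d0 hz hs; have := gap_neq0 d0 hw hs => n1 n2.
have -> : (z - s%:C)^-1 - (w - s%:C)^-1 = (w - z) * ((z - s%:C)^-1 * (w - s%:C)^-1).
  by field; rewrite n1 n2.
rewrite !cabsM cabsB ler_wpM2l ?cabs_ge0 // -exprVn expr2.
by apply: ler_pM; rewrite ?cabs_ge0 ?kernel_le.
Qed.

Lemma cabs_st_sub_le z w : gap dl z -> gap dl w ->
  cabs (st z - st w) <= 2 / dl ^+ 2 * cabs (z - w).
Proof.
move=> hz hw; rewrite st_sub // cabsM mulrC ler_wpM2r ?cabs_ge0 //.
exact: cabs_st1_le.
Qed.

Lemma cabs_st1_sub_le z w v : gap dl z -> gap dl w -> gap dl v ->
  cabs (st1 z v - st1 w v) <= 2 / dl ^+ 3 * cabs (z - w).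
Proof.
move=> hz hw hv; have cz := cont_on_gap d0 hz; have cw := cont_on_gap d0 hw.
have cv := cont_on_gap d0 hv.
rewrite /st1 opprK addrC -(stateB hL (cont_onM cw cv) (cont_onM cz cv)).
have -> : (fun s => (w - s%:C)^-1 * (v - s%:C)^-1 - (z - s%:C)^-1 * (v - s%:C)^-1) =
     (fun s => (v - s%:C)^-1 * ((w - s%:C)^-1 + -1 * (z - s%:C)^-1)).
  by apply/funext => s; ring.
rewrite -mulrA; apply: (state_cabs_le hL) => [|s hs].
  exact: cont_onM cv (cont_onD cw (cont_onZ (a := -1) cz)).
rewrite cabsM mulN1r; have := kernel_sub hw hz hs; have := kernel_le d0 hv hs.
rewrite [cabs (w - z)]cabsB => h1 h2.
have -> : (dl ^+ 3)^-1 * cabs (z - w) = dl^-1 * (cabs (z - w) / dl ^+ 2).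
  by field; rewrite gt_eqF.
by apply: ler_pM; rewrite ?cabs_ge0.
Qed.

Lemma cabs_st2_sub_le z w v : gap dl z -> gap dl w -> gap dl v ->
  cabs (st2 z v - st2 w v) <= 2 / dl ^+ 4 * cabs (z - w).
Proof.
move=> hz hw hv; have cz := cont_on_gap d0 hz; have cw := cont_on_gap d0 hw.
have cv := cont_on_gap d0 hv; have cvv := cont_onM cv cv.
rewrite /st2 -(stateB hL (cont_onM cz cvv) (cont_onM cw cvv)).
have -> : (fun s => (z - s%:C)^-1 * ((v - s%:C)^-1 * (v - s%:C)^-1)
       - (w - s%:C)^-1 * ((v - s%:C)^-1 * (v - s%:C)^-1)) =
     (fun s => (v - s%:C)^-1 * (v - s%:C)^-1 * ((z - s%:C)^-1 + -1 * (w - s%:C)^-1)).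
  by apply/funext => s; ring.
rewrite -mulrA; apply: (state_cabs_le hL) => [|s hs].
  exact: cont_onM cvv (cont_onD cz (cont_onZ (a := -1) cw)).
rewrite !cabsM mulN1r; have h2 := kernel_sub hz hw hs; have h1 := kernel_le d0 hv hs.
have -> : (dl ^+ 4)^-1 * cabs (z - w) = dl^-1 * dl^-1 * (cabs (z - w) / dl ^+ 2).
  by field; rewrite gt_eqF.
by do 2?[apply: ler_pM]; rewrite ?mulr_ge0 ?cabs_ge0.
Qed.

End Estimates.

(** By linearity [four_points] passes under the functional, where the estimate for a single kernel
    is uniform in s. *)
Lemma holo_at_st dl z : 0 < dl -> gap dl z -> holo_at st z.
Proof.
move=> d0 hz; have cz := cont_on_gap d0 hz; have d2 : 0 < dl / 2 by rewrite divr_gt0.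
have k1 : 0 <= 2 / (dl / 2) ^+ 2 by rewrite divr_ge0 // exprn_ge0 // ltW.
have k2 : 0 <= 2 * (8 / dl ^+ 5).
  by rewrite mulr_ge0 // divr_ge0 // exprn_ge0 // ltW.
exists (2 / (dl / 2) ^+ 2 + 2 * (8 / dl ^+ 5)), (dl / 2); split => //.
- exact: addr_ge0.
- move=> w /ltW hwz; have hw := gap_near hz hwz.
  have hz2 : gap (dl / 2) z by move=> s /hz hs; apply: le_trans hs; lra.
  apply: le_trans (cabs_st_sub_le d2 hw hz2) _.
  by rewrite ler_wpM2r ?cabs_ge0 // lerDl.
- move=> t ht; have /andP[t0 t1] := ht.
  have i1 : cabs ('i : C) = 1 by rewrite cabsE /= expr0n expr1n add0r sqrtr1.
  have cn (a : C) : cabs a = 1 -> cont_on b (fun s => (z + a * t%:C - s%:C)^-1).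
    move=> a1; apply: (cont_on_gap d2); apply: (gap_near hz).
    by rewrite [z + _]addrC addrK cabsM a1 mul1r cabsR gtr0_norm // ltW.
  have n1 := cn 1 (@cabs1 R); have n2 := cn (-1); rewrite cabsN cabs1 in n2.
  have n3 := cn 'i i1; have n4 := cn (- 'i); rewrite cabsN i1 in n4.
  move: n1 {n2}(n2 erefl) n3 {n4}(n4 erefl) => n1 n2 n3 n4.
  rewrite mul1r in n1; rewrite mulN1r in n2; rewrite mulNr in n4.
  have n5 := cont_onZ (a := -4) cz.
  have -> : four_points st z t = L (fun s => four_points (fun w => (w - s%:C)^-1) z t).
    rewrite /four_points /st -[- (4 * _)]mulNr -(stateZ hL _ cz) -(stateD hL n1 n2).
    rewrite -(stateD hL (cont_onD n1 n2) n3) -(stateD hL (cont_onD (cont_onD n1 n2) n3) n4).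
    rewrite -(stateD hL (cont_onD (cont_onD (cont_onD n1 n2) n3) n4) n5).
    by congr L; apply/funext => s; rewrite [- 4 * _]mulNr.
  apply: (@le_trans _ _ (2 * (8 / dl ^+ 5 * t ^+ 4))); last first.
    by rewrite mulrA ler_wpM2r ?exprn_ge0 ?(ltW t0) // lerDr.
  apply: (state_cabs_le hL) => [|s hs].
    have := cont_onD (cont_onD (cont_onD (cont_onD n1 n2) n3) n4) n5.
    by congr (cont_on b _); apply/funext => s; rewrite /four_points [- 4 * _]mulNr.
  by apply: kernel_four_points => //; exact: hz.
Qed.

Lemma Im_inv z : Im z^-1 = - Im z / cabs z ^+ 2.
Proof. by rewrite sqr_cabs; case: z => x y /=; rewrite mulNr. Qed.

Lemma Re_invR (x : R) : Re (x%:C^-1) = x^-1.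
Proof. by rewrite -fmorphV. Qed.

(** The imaginary part of 1 / (z - s) is - Im z / |z - s|^2, and |z - s| <= |z| + b bounds it away
    from 0 uniformly in s, so the sign survives the functional. *)
Lemma st_Im_sign z : 0 <= b -> Im z != 0 -> Im z * Im (st z) < 0.
Proof.
move=> b0 z0; have zp : 0 < `|Im z| by rewrite normr_gt0.
have [dl d0 hz] : exists2 dl, 0 < dl & gap dl z.
  by apply: gap_exists => h; rewrite h eqxx in z0.
have cz := cont_on_gap d0 hz.
pose m := (cabs z + b) ^+ 2.
have zb : 0 < cabs z + b.
  by rewrite ltr_pwDl // cabs_gt0; apply: contra_neq z0 => ->.
have mp : 0 < m by rewrite exprn_gt0.
have hk s : - b <= s <= b -> m^-1 <= (cabs (z - s%:C) ^+ 2)^-1.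
  move=> hs; rewrite lef_pV2 ?posrE ?exprn_gt0 ?cabs_gt0 //; last first.
    exact: gap_neq0 d0 hz hs.
  rewrite lerXn2r ?nnegrE ?cabs_ge0 ?addr_ge0 ?cabs_ge0 //.
  apply: le_trans (ler_cabsD _ _) _; rewrite cabsN cabsR lerD2l.
  by rewrite ler_norml.
case: (ltrgtP (Im z) 0) z0 => // zs _.
- suff h : - Im z / m <= Im (st z).
    rewrite nmulr_rlt0 //; apply: lt_le_trans h.
    by rewrite divr_gt0 // oppr_gt0.
  apply: (state_Im_ge hL) => // s /hk hs.
  by rewrite Im_inv ImD ImN /= subr0 ler_wpM2l // oppr_ge0 ltW.
- suff h : Im (st z) <= - Im z / m.
    rewrite pmulr_rlt0 //; apply: le_lt_trans h _.
    by rewrite mulNr oppr_lt0 divr_gt0.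
  apply: (state_Im_le hL) => // s /hk hs.
  by rewrite Im_inv ImD ImN /= subr0 !mulNr lerN2 ler_wpM2l // ltW.
Qed.

Section RealPoints.
Hypothesis b0 : 0 <= b.

Lemma gapR (y a : R) : b < a -> a <= y -> gap (a - b) y%:C.
Proof.
move=> ba ay s /andP[s1 s2]; rewrite -rmorphB cabsR.
by rewrite ger0_norm; lra.
Qed.

Lemma st_real (y : R) : b < y -> st y%:C = (Re (st y%:C))%:C.
Proof.
move=> hy; have g := gapR hy (lexx y); have d0 : 0 < y - b by rewrite subr_gt0.
apply: (state_real hL (cont_on_gap d0 g)) => s _.
by rewrite -rmorphB -fmorphV.
Qed.

Lemma st1_real (y x : R) : b < y -> b < x -> st1 y%:C x%:C = (Re (st1 y%:C x%:C))%:C.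
Proof.
move=> hy hx; have d0 : 0 < y - b by rewrite subr_gt0.
have d1 : 0 < x - b by rewrite subr_gt0.
have cc := cont_onM (cont_on_gap d0 (gapR hy (lexx y))) (cont_on_gap d1 (gapR hx (lexx x))).
rewrite /st1 (state_real hL cc) => [|s _]; first by rewrite -rmorphN.
by rewrite -!rmorphB -!fmorphV -rmorphM.
Qed.

Lemma st2_real (y x : R) : b < y -> b < x -> st2 y%:C x%:C = (Re (st2 y%:C x%:C))%:C.
Proof.
move=> hy hx; have d0 : 0 < y - b by rewrite subr_gt0.
have d1 : 0 < x - b by rewrite subr_gt0.
have cx := cont_on_gap d1 (gapR hx (lexx x)).
have cc := cont_onM (cont_on_gap d0 (gapR hy (lexx y))) (cont_onM cx cx).
apply: (state_real hL cc) => s _.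
by rewrite -!rmorphB -!fmorphV -!rmorphM.
Qed.

(** On [-b, b] the kernel 1 / (y - s) is smallest at s = -b. The next lower bounds of [st1] and of d
    all compare with a point mass there. *)
Lemma st_ge (y : R) : b < y -> (y + b)^-1 <= Re (st y%:C).
Proof.
move=> hy; have d0 : 0 < y - b by rewrite subr_gt0.
apply: (state_Re_ge hL (cont_on_gap d0 (gapR hy (lexx y)))) => s /andP[s1 s2].
rewrite -rmorphB Re_invR lef_pV2 ?posrE; lra.
Qed.

Lemma st1_le (y x : R) : b < y -> b < x ->
  Re (st1 y%:C x%:C) <= - ((y + b)^-1 * (x + b)^-1).
Proof.
move=> hy hx; have d0 : 0 < y - b by rewrite subr_gt0.
have d1 : 0 < x - b by rewrite subr_gt0.
have cc := cont_onM (cont_on_gap d0 (gapR hy (lexx y))) (cont_on_gap d1 (gapR hx (lexx x))).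
rewrite /st1 ReN lerN2; apply: (state_Re_ge hL cc) => s /andP[s1 s2].
rewrite -!rmorphB -!fmorphV -rmorphM /=.
have h1 : 0 < y + b by lra.
have h2 : 0 < x + b by lra.
by apply: ler_pM; rewrite ?invr_ge0 ?(ltW h1) ?(ltW h2) // lef_pV2 ?posrE; lra.
Qed.

End RealPoints.

End Stieltjes.

Arguments st {R} L z.
Arguments st1 {R} L z w.
Arguments st2 {R} L z w.
Arguments gap {R} b dl z.

(** * The scalar equation 1 = t d(z) *)

Section NearReal.
Context {R : realType}.
Local Notation C := R[i].

(* a is a value at the height h above the real axis and a0 the corresponding
   real boundary value. *)
Definition near_real (K h : R) (a a0 : C) : Prop :=
  [/\ 0 <= K /\ 0 <= h, cabs a <= K, cabs a0 <= K, Im a0 = 0 & cabs (a - a0) <= K * h].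

Lemma near_real_le K K' h a a0 : K <= K' ->
  near_real K h a a0 -> near_real K' h a a0.
Proof.
move=> KK [[K0 h0] h1 h2 h3 h4]; split => //; try exact: le_trans KK.
  by split => //; exact: le_trans KK.
by apply: le_trans h4 _; rewrite ler_wpM2r.
Qed.

Lemma near_real_cst K h (a : C) : 0 <= h -> Im a = 0 -> cabs a <= K ->
  near_real K h a a.
Proof.
move=> h0 a0 aK; have K0 : 0 <= K by apply: le_trans (cabs_ge0 _) aK.
by split => //; rewrite subrr cabs0 mulr_ge0.
Qed.

Lemma near_realD K K' h a a0 b b0 : near_real K h a a0 -> near_real K' h b b0 ->
  near_real (K + K') h (a + b) (a0 + b0).
Proof.
move=> [[K0 h0] h1 h2 h3 h4] [[K0' _] h1' h2' h3' h4']; split.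
- by split => //; exact: addr_ge0.
- exact: le_trans (ler_cabsD _ _) (lerD h1 h1').
- exact: le_trans (ler_cabsD _ _) (lerD h2 h2').
- by rewrite ImD h3 h3' addr0.
- by rewrite opprD addrACA mulrDl; exact: le_trans (ler_cabsD _ _) (lerD h4 h4').
Qed.

Lemma near_realN K h a a0 : near_real K h a a0 -> near_real K h (- a) (- a0).
Proof.
by move=> [K0 h1 h2 h3 h4]; split; rewrite ?cabsN ?ImN ?h3 ?oppr0 // -opprD cabsN.
Qed.

Lemma near_realM K K' h a a0 b b0 : near_real K h a a0 -> near_real K' h b b0 ->
  near_real (2 * K * K') h (a * b) (a0 * b0).
Proof.
move=> [[K0 h0] h1 h2 h3 h4] [[K0' _] h1' h2' h3' h4'].
have KK : 0 <= K * K' by exact: mulr_ge0.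
have m1 : cabs (a * b) <= K * K' by rewrite cabsM ler_pM ?cabs_ge0.
have m2 : cabs (a0 * b0) <= K * K' by rewrite cabsM ler_pM ?cabs_ge0.
split; [split => //; lra|lra|lra|by rewrite ImM h3 h3' mulr0 mul0r addr0|].
have -> : a * b - a0 * b0 = (a - a0) * b + a0 * (b - b0) by ring.
apply: le_trans (ler_cabsD _ _) _; rewrite !cabsM.
have t1 : cabs (a - a0) * cabs b <= K * h * K' by rewrite ler_pM ?cabs_ge0.
have t2 : cabs a0 * cabs (b - b0) <= K * (K' * h) by rewrite ler_pM ?cabs_ge0.
lra.
Qed.

Lemma near_realV K c h a a0 : 0 < c -> c <= cabs a -> c <= cabs a0 ->
  near_real K h a a0 -> near_real (c^-1 + K / c ^+ 2) h a^-1 a0^-1.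
Proof.
move=> c0 ca ca0 [[K0 h0] h1 h2 h3 h4].
have a_n0 : a != 0 by rewrite -cabs_gt0 (lt_le_trans c0).
have a0_n0 : a0 != 0 by rewrite -cabs_gt0 (lt_le_trans c0).
have c1 : 0 <= c^-1 by rewrite invr_ge0 ltW.
have c2 : 0 <= K / c ^+ 2 by rewrite divr_ge0 // exprn_ge0 // ltW.
have i1 (x : C) : c <= cabs x -> cabs x^-1 <= c^-1.
  by move=> hx; rewrite cabsV lef_pV2 // posrE (lt_le_trans c0).
split.
- by split => //; exact: addr_ge0.
- by apply: le_trans (i1 _ ca) _; rewrite lerDl.
- by apply: le_trans (i1 _ ca0) _; rewrite lerDl.
- by rewrite Im_inv h3 oppr0 mul0r.
- have -> : a^-1 - a0^-1 = (a0 - a) * (a^-1 * a0^-1) by field; rewrite a_n0 a0_n0.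
  have Kh : 0 <= K * h by exact: mulr_ge0.
  have k1 : cabs (a^-1 * a0^-1) <= (c ^+ 2)^-1.
    by rewrite cabsM -exprVn expr2 ler_pM ?cabs_ge0 ?i1.
  rewrite cabsM cabsB; apply: (@le_trans _ _ (K * h * (c ^+ 2)^-1)).
    by rewrite ler_pM ?cabs_ge0.
  by rewrite mulrDl mulrAC lerDr mulr_ge0.
Qed.

End NearReal.

(** * The product d of two Stieltjes transforms, on and off the real axis *)

Section Transforms.
Context {R : realType} {b : R}.
Local Notation C := R[i].
Context {Lp Lq : (R -> C) -> C} (hp : state b Lp) (hq : state b Lq).
Hypothesis b0 : 0 <= b.
Local Notation p := (st Lp).
Local Notation q := (st Lq).
Implicit Types (z w : C) (x y : R).

Definition dd z := p z * q z.
(** Divided differences of the product at (z, w) and (z, w, w), by the Leibniz rule. *)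
Definition dd1 z w := st1 Lp z w * q z + p w * st1 Lq z w.
Definition dd2 z w :=
  st2 Lp z w * q z + st1 Lp w w * st1 Lq z w + p w * st2 Lq z w.

Lemma dd_sub dl z w : 0 < dl -> gap b dl z -> gap b dl w ->
  dd z - dd w = (z - w) * dd1 z w.
Proof.
move=> d0 hz hw; have e1 := st_sub hp d0 hz hw; have e2 := st_sub hq d0 hz hw.
have -> : dd z - dd w = (p z - p w) * q z + p w * (q z - q w) by rewrite /dd; ring.
by rewrite e1 e2 /dd1; ring.
Qed.

Lemma dd1_sub dl z w : 0 < dl -> gap b dl z -> gap b dl w ->
  dd1 z w - dd1 w w = (z - w) * dd2 z w.
Proof.
move=> d0 hz hw; have e1 := st1_sub hp d0 hz hw; have e2 := st1_sub hq d0 hz hw.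
have e3 := st_sub hq d0 hz hw.
have -> : dd1 z w - dd1 w w = (st1 Lp z w - st1 Lp w w) * q z
    + st1 Lp w w * (q z - q w) + p w * (st1 Lq z w - st1 Lq w w) by rewrite /dd1; ring.
by rewrite e1 e2 e3 /dd2; ring.
Qed.

(** The imaginary parts of p and q are nonzero with the same sign, so the product d is never a
    nonnegative real: either d < 0 or Im d is nonzero. In both cases |1 - t d| grows at least
    linearly in t. No separation from the roots is required off the axis. *)
Lemma dd_nonreal_lower z : Im z != 0 ->
  exists2 c : R, 0 < c & forall t : R, 0 <= t -> c * (1 + t) <= cabs (1 - t%:C * dd z).
Proof.
move=> z0; have sp := st_Im_sign hp b0 z0; have sq := st_Im_sign hq b0 z0.
have pq : 0 < Im (p z) * Im (q z).
  have : 0 < (Im z * Im (p z)) * (Im z * Im (q z)) by rewrite nmulr_rgt0.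
  rewrite mulrACA -expr2 pmulr_rgt0 // lt_def sqr_ge0 andbT sqrf_eq0 //.
set D := dd z; have [D0|D0] := eqVneq (Im D) 0.
  have rD : Re D < 0.
    move: D0; rewrite /D /dd ImM ReM.
    move: pq; set p1 := Re (p z); set p2 := Im (p z); set q1 := Re (q z); set q2 := Im (q z).
    move=> pq /eqP; rewrite addr_eq0 => /eqP h.
    have p20 : p2 != 0 by apply: contraTneq pq => ->; rewrite mul0r ltxx.
    have p2p : 0 < p2 ^+ 2 by rewrite lt_def sqr_ge0 andbT sqrf_eq0.
    (* Im d = 0 reads p2 q1 = - p1 q2; substituted in p2^2 Re d it leaves - (p1^2 + p2^2) p2 q2,
       which is negative. *)
    rewrite -(pmulr_rlt0 _ p2p).
    have -> : p2 ^+ 2 * (p1 * q1 - p2 * q2) = p1 * p2 * (p2 * q1) - p2 ^+ 2 * (p2 * q2) by ring.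
    have -> : p2 * q1 = - (p1 * q2) by rewrite h opprK.
    have -> : p1 * p2 * - (p1 * q2) - p2 ^+ 2 * (p2 * q2) =
       - ((p1 ^+ 2 + p2 ^+ 2) * (p2 * q2)) by ring.
    by rewrite oppr_lt0 mulr_gt0 // ltr_wpDl // sqr_ge0.
  exists (Num.min 1 (- Re D)); first by rewrite lt_min ltr01 oppr_gt0.
  move=> t t0; apply: le_trans (Re_le _); rewrite ReD ReN ReZ /=.
  have h1 : Num.min 1 (- Re D) <= 1 by rewrite ge_min lexx.
  have h2 : Num.min 1 (- Re D) * t <= - Re D * t by rewrite ler_wpM2r // ge_min lexx orbT.
  lra.
pose M := cabs D + 1.
have M0 : 1 <= M by rewrite lerDr cabs_ge0.
have I0 : 0 < `|Im D| by rewrite normr_gt0.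
(* For t <= 1 / (2 M) the term t d has modulus at most 1/2, so the left side is at least 1/2 >= (1 +
   t) / 3; for larger t its imaginary part t |Im d| suffices, as 1 <= 2 M t. *)
exists (Num.min (1 / 3) (`|Im D| / (2 * M + 1))).
  by rewrite lt_min divr_gt0 // divr_gt0 //; lra.
move=> t t0; have [tM|tM] := lerP t (1 / (2 * M)).
  apply: (@le_trans _ _ (1 / 3 * (1 + t))); first by rewrite ler_wpM2r ?ge_min ?lexx //; lra.
  have h1 : t * M <= 1 / 2.
    have -> : 1 / 2 = 1 / (2 * M) * M :> R by field; rewrite gt_eqF //; lra.
    by rewrite ler_wpM2r //; lra.
  have h2 : t <= 1 / 2 by apply: le_trans h1; rewrite ler_peMr.
  have h3 : cabs (t%:C * D) <= 1 / 2.
    rewrite cabsM cabsR ger0_norm //; apply: le_trans h1.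
    by rewrite ler_wpM2l // /M lerDl.
  have := ler_cabsB 1 (t%:C * D); rewrite cabs1; lra.
apply: (@le_trans _ _ (`|Im D| / (2 * M + 1) * (1 + t))).
  by rewrite ler_wpM2r ?ge_min ?lexx ?orbT //; lra.
apply: le_trans (normIm_le _); rewrite ImD ImN ImZ /= sub0r normrN normrM ger0_norm //.
rewrite [t * _]mulrC -mulrA ler_wpM2l // mulrC ler_pdivrMr; last by lra.
have : 1 <= t * (2 * M).
  by move/ltW: tM; rewrite ler_pdivrMr //; lra.
lra.
Qed.

Lemma dd_real y : b < y -> dd y%:C = (Re (dd y%:C))%:C.
Proof.
by move=> hy; rewrite /dd (st_real hp hy) (st_real hq hy) -rmorphM.
Qed.

Lemma dd1_real y x : b < y -> b < x -> dd1 y%:C x%:C = (Re (dd1 y%:C x%:C))%:C.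
Proof.
move=> hy hx; rewrite /dd1 (st1_real hp hy hx) (st1_real hq hy hx) (st_real hp hx).
by rewrite (st_real hq hy) -!rmorphM -rmorphD.
Qed.

Lemma dd1_le y x : b < y -> b < x ->
  Re (dd1 y%:C x%:C) <=
  - ((y + b)^-1 * (x + b)^-1 * (y + b)^-1 + (x + b)^-1 * ((y + b)^-1 * (x + b)^-1)).
Proof.
move=> hy hx; have b0' := b0.
have h1 := st1_le hp hy hx; have h2 := st1_le hq hy hx.
have h3 := st_ge hq hy; have h4 := st_ge hp hx.
have y0 : 0 < (y + b)^-1 by rewrite invr_gt0; lra.
have x0 : 0 < (x + b)^-1 by rewrite invr_gt0; lra.
rewrite /dd1 (st1_real hp hy hx) (st1_real hq hy hx) (st_real hp hx) (st_real hq hy).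
rewrite -!rmorphM -rmorphD /= opprD; apply: lerD.
  rewrite -mulNr -lerN2 -!mulNr opprK.
  by apply: ler_pM => //; rewrite ?mulr_ge0 ?(ltW x0) ?(ltW y0) // lerNr.
rewrite -mulrN -lerN2 -!mulrN opprK.
by apply: ler_pM => //; rewrite ?mulr_ge0 ?(ltW x0) ?(ltW y0) // lerNr.
Qed.

(** The bound of [dd1_le] is exactly the divided difference of (x + b)^-2, so d decreases at least
    as fast as this function, its value for point masses at -b. *)
Lemma dd_gap_le y x : b < y -> y < x ->
  (y + b)^-1 ^+ 2 - (x + b)^-1 ^+ 2 <= Re (dd y%:C) - Re (dd x%:C).
Proof.
move=> hy yx; have hx := lt_trans hy yx; have b0' := b0.
have d0 : 0 < y - b by rewrite subr_gt0.
have e := dd_sub d0 (gapR hy (lexx y)) (gapR hy (ltW yx)).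
rewrite -ReN -ReD e -rmorphB ReZ; have h := dd1_le hy hx.
have Y0 : y + b != 0 by rewrite gt_eqF //; lra.
have X0 : x + b != 0 by rewrite gt_eqF //; lra.
have -> : (y + b)^-1 ^+ 2 - (x + b)^-1 ^+ 2 = (y - x) *
  - ((y + b)^-1 * (x + b)^-1 * (y + b)^-1 + (x + b)^-1 * ((y + b)^-1 * (x + b)^-1)).
  by field; rewrite Y0 X0.
by rewrite ler_nM2l // subr_lt0.
Qed.

Lemma dd_decr y x : b < y -> y < x -> Re (dd x%:C) < Re (dd y%:C).
Proof.
move=> hy yx; rewrite -subr_gt0; apply: lt_le_trans (dd_gap_le hy yx).
have b0' := b0; rewrite subr_gt0 ltrXn2r // ?invr_ge0; try lra.
by rewrite ltf_pV2 ?posrE; lra.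
Qed.

Lemma dd_gt0 y : b < y -> 0 < Re (dd y%:C).
Proof.
move=> hy; rewrite /dd (st_real hp hy) (st_real hq hy) -rmorphM /=.
have b0' := b0; have h : 0 < (y + b)^-1 by rewrite invr_gt0; lra.
by rewrite mulr_gt0 // (lt_le_trans h) // st_ge.
Qed.

Lemma dd_le y : b < y -> Re (dd y%:C) <= (2 / (y - b)) ^+ 2.
Proof.
move=> hy; have d0 : 0 < y - b by rewrite subr_gt0.
have g := gapR hy (lexx y).
apply: le_trans (Re_le _) _; rewrite cabsM expr2.
by apply: ler_pM; rewrite ?cabs_ge0 //;
  [exact: (cabs_st_le hp d0 g)|exact: (cabs_st_le hq d0 g)].
Qed.

(** With t = 1 / d(x) the quantity is t |d(x) - d(y)|, and d(x) <= D lets t control a multiple of 1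
    + t. Only y ranges over a compact interval: x is unbounded, as theta is. *)
Lemma dd_root_lower (a1 b1 dl D : R) : b < a1 -> a1 <= b1 -> 0 < dl -> 0 < D ->
  exists2 c : R, 0 < c & forall y x, a1 <= y <= b1 -> b < x -> dl <= `|x - y| ->
    Re (dd x%:C) <= D ->
    c * (1 + (Re (dd x%:C))^-1) <= cabs (1 - (Re (dd x%:C))^-1%:C * dd y%:C).
Proof.
move=> ha hab dl0 D0; have b0' := b0; pose B := b1 + b.
have B0 : 0 < B by rewrite /B; lra.
(* The two terms are the smallest drops of (x + b)^-2 over a step of length at least dl, for x to
   the right and to the left of y respectively. *)
pose m := Num.min (dl ^+ 2 / (B ^+ 2 * (B + dl) ^+ 2)) (dl / B ^+ 3).
have m0 : 0 < m.
  by rewrite lt_min !divr_gt0 // ?mulr_gt0 ?exprn_gt0 // addr_gt0.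
exists (m / (1 + D)); first by rewrite divr_gt0 // addr_gt0.
move=> y x /andP[y1 y2] hx dlx dD; have hy : b < y by lra.
have dx := dd_gt0 hx; set t := (Re (dd x%:C))^-1.
have t0 : 0 < t by rewrite invr_gt0.
have key : m <= `|Re (dd x%:C) - Re (dd y%:C)|.
  set Y := y + b; set X := x + b.
  have Y0 : 0 < Y by rewrite /Y; lra.
  have X0 : 0 < X by rewrite /X; lra.
  have YB : Y <= B by rewrite /Y /B lerD2r.
  have Y0w := ltW Y0; have X0w := ltW X0; have dl0w := ltW dl0; have B0w := ltW B0.
  have Ydl : 0 < Y + dl by exact: addr_gt0.
  have Ydlw := ltW Ydl.
  have [xy|xy|xy] := ltrgtP x y.
  - apply: (@le_trans _ _ (X^-1 ^+ 2 - Y^-1 ^+ 2)); last first.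
      by apply: le_trans (dd_gap_le hx xy) _; exact: ler_norm.
    apply: (@le_trans _ _ (dl / B ^+ 3)); first by rewrite /m ge_min lexx orbT.
    have XY : X < Y by rewrite /X /Y ltrD2r.
    have dXY : dl <= Y - X.
      by move: dlx; rewrite ltr0_norm ?subr_lt0 // /X /Y; lra.
    have -> : X^-1 ^+ 2 - Y^-1 ^+ 2 = (Y - X) * ((X + Y) * X^-1 ^+ 2 * Y^-1 ^+ 2).
      by field; rewrite !gt_eqF.
    apply: ler_pM => //; first by rewrite invr_ge0 exprn_ge0.
    apply: (@le_trans _ _ (Y * Y^-1 ^+ 2 * Y^-1 ^+ 2)).
      have -> : Y * Y^-1 ^+ 2 * Y^-1 ^+ 2 = (Y ^+ 3)^-1 by field; rewrite gt_eqF.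
      by rewrite lef_pV2 ?posrE ?exprn_gt0 // lerXn2r ?nnegrE.
    rewrite ler_wpM2r ?sqr_ge0 //; apply: ler_pM; rewrite ?sqr_ge0 //.
      by rewrite lerDr.
    rewrite lerXn2r ?nnegrE ?invr_ge0 // lef_pV2 ?posrE //; exact: ltW.
  - apply: (@le_trans _ _ (Y^-1 ^+ 2 - X^-1 ^+ 2)); last first.
      by apply: le_trans (dd_gap_le hy xy) _; rewrite distrC ler_norm.
    apply: (@le_trans _ _ (dl ^+ 2 / (B ^+ 2 * (B + dl) ^+ 2))); first by rewrite /m ge_min lexx.
    have dXY : Y + dl <= X.
      by move: dlx; rewrite gtr0_norm ?subr_gt0 // /X /Y; lra.
    apply: (@le_trans _ _ (Y^-1 ^+ 2 - (Y + dl)^-1 ^+ 2)); last first.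
      by rewrite lerD2l lerN2 lerXn2r ?nnegrE ?invr_ge0 // lef_pV2 ?posrE.
    have -> : Y^-1 ^+ 2 - (Y + dl)^-1 ^+ 2 =
        dl * (2 * Y + dl) / (Y ^+ 2 * (Y + dl) ^+ 2).
      by field; rewrite !gt_eqF.
    have hB2 : 0 < B + dl by exact: addr_gt0.
    have hB2w := ltW hB2.
    apply: ler_pM; rewrite ?sqr_ge0 ?invr_ge0 ?mulr_ge0 ?sqr_ge0 //.
      by rewrite expr2 ler_pM2l // lerDr mulr_ge0.
    rewrite lef_pV2 ?posrE ?mulr_gt0 ?exprn_gt0 //.
    by apply: ler_pM; rewrite ?sqr_ge0 // lerXn2r ?nnegrE // lerD2r.
  - by move: dlx; rewrite xy subrr normr0 leNgt dl0.
rewrite (dd_real hy) -rmorphM -(rmorph1 (real_complex R)) -rmorphB cabsR.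
have -> : 1 - t * Re (dd y%:C) = t * (Re (dd x%:C) - Re (dd y%:C)).
  by rewrite mulrBr /t mulVf ?gt_eqF.
rewrite normrM gtr0_norm //.
have -> : m / (1 + D) * (1 + t) = t * (m * ((1 + t^-1) / (1 + D))).
  by field; rewrite !gt_eqF // addr_gt0.
rewrite ler_pM2l //; apply: le_trans key.
rewrite ler_piMr ?(ltW m0) // ler_pdivrMr ?addr_gt0 // mul1r lerD2l.
by rewrite /t invrK.
Qed.

(** Covers the values theta without a root, with D the edge value of d: t d(y) <= d(a1) / D < 1, and
    t <= 1 / D makes 1 + t bounded. *)
Lemma dd_subcritical_lower (a1 D : R) : b < a1 -> Re (dd a1%:C) < D ->
  exists2 c : R, 0 < c & forall y t, a1 <= y -> 0 <= t -> t * D <= 1 ->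
    c * (1 + t) <= cabs (1 - t%:C * dd y%:C).
Proof.
move=> ha hD; have d1 := dd_gt0 ha; have D0 : 0 < D by exact: lt_trans hD.
pose c0 := 1 - Re (dd a1%:C) / D.
have c00 : 0 < c0 by rewrite subr_gt0 ltr_pdivrMr // mul1r.
exists (c0 / (1 + D^-1)); first by rewrite divr_gt0 // addr_gt0 ?invr_gt0.
move=> y t ay t0 tD; have hy : b < y by lra.
have dy : Re (dd y%:C) <= Re (dd a1%:C).
  by move: ay; rewrite le_eqVlt => /predU1P[->//|ay]; apply/ltW/dd_decr.
have tD' : t <= D^-1 by rewrite -[D^-1]mul1r ler_pdivlMr.
apply: le_trans (Re_le _); rewrite ReD ReN ReZ /=.
apply: (@le_trans _ _ c0).
  rewrite -mulrA ler_piMr ?(ltW c00) // mulrC ler_pdivrMr ?addr_gt0 ?invr_gt0 //.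
  by rewrite mul1r lerD2l.
rewrite /c0 lerD2l lerN2 mulrC; apply: ler_pM => //.
  exact/ltW/dd_gt0.
Qed.

Lemma gap_strip (a1 y h : R) : b < a1 -> a1 <= y -> gap b (a1 - b) (y +i* h).
Proof.
move=> ha hy s /andP[s1 s2]; apply: le_trans (Re_le _); rewrite ReD ReN /=; lra.
Qed.

(** The distance to [-b, b] is at least a1 - b on the whole half plane Re z >= a1, so a single
    constant serves for all y, x and h. *)
Lemma strip_near_real (a1 : R) : b < a1 -> exists2 K : R, 0 <= K &
  forall y x h, a1 <= y -> a1 <= x -> 0 <= h ->
  let z := y +i* h in
  [/\ near_real K h (p z) (p y%:C) /\ near_real K h (q z) (q y%:C),
      near_real K h (st1 Lp z x%:C) (st1 Lp y%:C x%:C) /\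
      near_real K h (st1 Lq z x%:C) (st1 Lq y%:C x%:C),
      near_real K h (dd z) (dd y%:C),
      near_real K h (dd1 z x%:C) (dd1 y%:C x%:C) &
      near_real K h (dd2 z x%:C) (dd2 y%:C x%:C)].
Proof.
move=> ha; pose dl := a1 - b; have d0 : 0 < dl by rewrite subr_gt0.
(* [K0] dominates the sizes and Lipschitz constants of [st], [st1] and [st2]; [K] below also
   dominates the sums of products that form [dd], [dd1] and [dd2]. *)
pose K0 := 2 / dl + 2 / dl ^+ 2 + (2 / dl ^+ 3 + 2 / dl ^+ 4).
have k1 : 0 <= 2 / dl by rewrite divr_ge0 // ltW.
have k2 : 0 <= 2 / dl ^+ 2 by rewrite divr_ge0 // exprn_ge0 // ltW.
have k3 : 0 <= 2 / dl ^+ 3 by rewrite divr_ge0 // exprn_ge0 // ltW.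
have k4 : 0 <= 2 / dl ^+ 4 by rewrite divr_ge0 // exprn_ge0 // ltW.
have K00 : 0 <= K0 by rewrite /K0; lra.
pose K := K0 + 2 * K0 * K0 + (2 * K0 * K0 + 2 * K0 * K0) + (2 * K0 * K0).
have KK : 0 <= K0 * K0 by rewrite mulr_ge0.
have K1 : K0 <= K by rewrite /K; lra.
have K2 : 2 * K0 * K0 <= K by rewrite /K; lra.
have K3 : 2 * K0 * K0 + 2 * K0 * K0 <= K by rewrite /K; lra.
have K4 : 2 * K0 * K0 + 2 * K0 * K0 + 2 * K0 * K0 <= K by rewrite /K; lra.
exists K; first by rewrite /K; lra.
move=> y x h hy hx h0 z; have gz : gap b dl z by exact: gap_strip.
have gy : gap b dl y%:C by exact: gapR.
have gx : gap b dl x%:C by exact: gapR.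
have hby : b < y by lra.
have hbx : b < x by lra.
have zy : cabs (z - y%:C) = h.
  have -> : z - y%:C = 'i * h%:C.
    by apply/eqP; rewrite eq_complex /=; apply/andP; split; apply/eqP; ring.
  by rewrite cabsM cabsR ger0_norm // cabsE /= expr0n expr1n add0r sqrtr1 mul1r.
have nrs L (hL : state b L) : near_real K0 h (st L z) (st L y%:C).
  split => //.
  - by apply: le_trans (cabs_st_le hL d0 gz) _; rewrite /K0; lra.
  - by apply: le_trans (cabs_st_le hL d0 gy) _; rewrite /K0; lra.
  - by rewrite (st_real hL hby).
  - apply: le_trans (cabs_st_sub_le hL d0 gz gy) _; rewrite zy ler_wpM2r //.
    by rewrite /K0; lra.
have nrs1 L (hL : state b L) : near_real K0 h (st1 L z x%:C) (st1 L y%:C x%:C).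
  split => //.
  - by apply: le_trans (cabs_st1_le hL d0 gz gx) _; rewrite /K0; lra.
  - by apply: le_trans (cabs_st1_le hL d0 gy gx) _; rewrite /K0; lra.
  - by rewrite (st1_real hL hby hbx).
  - apply: le_trans (cabs_st1_sub_le hL d0 gz gy gx) _; rewrite zy ler_wpM2r //.
    by rewrite /K0; lra.
have nrs2 L (hL : state b L) : near_real K0 h (st2 L z x%:C) (st2 L y%:C x%:C).
  split => //.
  - by apply: le_trans (cabs_st2_le hL d0 gz gx) _; rewrite /K0; lra.
  - by apply: le_trans (cabs_st2_le hL d0 gy gx) _; rewrite /K0; lra.
  - by rewrite (st2_real hL hby hbx).
  - apply: le_trans (cabs_st2_sub_le hL d0 gz gy gx) _; rewrite zy ler_wpM2r //.
    by rewrite /K0; lra.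
have cp : near_real K0 h (p x%:C) (p x%:C).
  apply: near_real_cst => //; first by rewrite (st_real hp hbx).
  by apply: le_trans (cabs_st_le hp d0 gx) _; rewrite /K0; lra.
have cp1 : near_real K0 h (st1 Lp x%:C x%:C) (st1 Lp x%:C x%:C).
  apply: near_real_cst => //; first by rewrite (st1_real hp hbx hbx).
  by apply: le_trans (cabs_st1_le hp d0 gx gx) _; rewrite /K0; lra.
split.
- by split; apply: near_real_le (nrs _ _).
- by split; apply: near_real_le (nrs1 _ _).
- exact: near_real_le K2 (near_realM (nrs _ hp) (nrs _ hq)).
- apply: near_real_le K3 (near_realD (near_realM (nrs1 _ hp) (nrs _ hq)) _).
  exact: near_realM cp (nrs1 _ hq).
- apply: near_real_le K4 (near_realD (near_realD (near_realM (nrs2 _ hp) (nrs _ hq)) _) _).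
    exact: near_realM cp1 (nrs1 _ hq).
  exact: near_realM cp (nrs2 _ hq).
Qed.

Lemma dd1_lower (a1 b1 : R) y x : b < a1 -> a1 <= y <= b1 -> a1 <= x <= b1 ->
  2 / (b1 + b) ^+ 3 <= cabs (dd1 y%:C x%:C).
Proof.
move=> ha /andP[y1 y2] /andP[x1 x2]; have b0' := b0.
have hy : b < y by lra.
have hx : b < x by lra.
apply: le_trans (normRe_le _); rewrite -normrN; apply: le_trans (ler_norm _).
rewrite lerNr; apply: le_trans (dd1_le hy hx) _; rewrite lerN2.
have Bp : 0 < b1 + b by lra.
have Bw : 0 <= (b1 + b)^-1 by rewrite invr_ge0 ltW.
have Yi : (b1 + b)^-1 <= (y + b)^-1 by rewrite lef_pV2 ?posrE; lra.
have Xi : (b1 + b)^-1 <= (x + b)^-1 by rewrite lef_pV2 ?posrE; lra.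
have -> : 2 / (b1 + b) ^+ 3 = (b1 + b)^-1 * (b1 + b)^-1 * (b1 + b)^-1
   + (b1 + b)^-1 * ((b1 + b)^-1 * (b1 + b)^-1) by field; rewrite gt_eqF.
by apply: lerD; do 2?[apply: ler_pM]; rewrite ?mulr_ge0.
Qed.

(* With e the divided difference of d, N / (1 - t d) = kap / (z - x) + g, where
   g = - (N1 e(x) - N(x) e2) / (t e e(x)) is real on the real axis. *)
Lemma near_pole_algebra (K c : R) : 0 < c -> exists K' : R,
  forall (h t : R) (z x Nz Nx N1z N1y ez ey ex e2z e2y dz : C),
  [/\ near_real K h N1z N1y, near_real K h ez ey, near_real K h e2z e2y,
      near_real K h ex ex & near_real K h Nx Nx] ->
  [/\ c <= cabs ez, c <= cabs ey & c <= cabs ex] ->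
  [/\ Nz - Nx = (z - x) * N1z, ez - ex = (z - x) * e2z &
      1 - t%:C * dz = - t%:C * ((z - x) * ez)] ->
  z != x -> 0 < t -> t^-1 <= K ->
  `|Im (Nz / (1 - t%:C * dz)) - - Re Nx / (t * Re ex) * Im (z - x)^-1| <= K' * h.
Proof.
(* The witness is left open and is assembled by the [near_real] rules; it depends on K and c
   only. *)
move=> c0; eexists => h t z x Nz Nx N1z N1y ez ey ex e2z e2y dz.
move=> [n1 n2 n3 n4 n5] [c1 c2 c3] [i1 i2 i3] zx t0 tK.
have h0 : 0 <= h by case: n1 => -[].
have nt : near_real K h (t^-1)%:C (t^-1)%:C.
  by apply: near_real_cst => //; rewrite cabsR gtr0_norm ?invr_gt0.
have nd := near_realM (near_realV c0 c1 c2 n2) (near_realV c0 c3 c3 n4).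
have nn := near_realD (near_realM n1 n4) (near_realN (near_realM n5 n3)).
have [_ _ _ g1 g2] := near_realN (near_realM nt (near_realM nn nd)).
have ez0 : ez != 0 by rewrite -cabs_gt0 (lt_le_trans c0).
have ex0 : ex != 0 by rewrite -cabs_gt0 (lt_le_trans c0).
have tC0 : t%:C != 0 :> C by rewrite (inj_eq (@complexI R)) gt_eqF.
have zx0 : z - x != 0 by rewrite subr_eq0.
have exr : ex = (Re ex)%:C by case: n4 => _ _ _; case: (ex) => u v /= ->.
have nxr : Nx = (Re Nx)%:C by case: n5 => _ _ _; case: (Nx) => u v /= ->.
set g := - (_ * _) in g2; set g0 := - (_ * _) in g1 g2.
have -> : Nz / (1 - t%:C * dz) = (- Re Nx / (t * Re ex))%:C * (z - x)^-1 + g.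
  rewrite i3 !rmorphM rmorphN fmorphV rmorphM /= -exr -nxr /g fmorphV /=.
  have -> : N1z = (Nz - Nx) / (z - x) by rewrite i1 mulrAC mulfV ?mul1r.
  have -> : e2z = (ez - ex) / (z - x) by rewrite i2 mulrAC mulfV ?mul1r.
  by field; rewrite ez0 ex0 tC0 zx0.
rewrite ImD ImZ addrAC subrr add0r.
have -> : Im g = Im (g - g0) by rewrite ImD [Im (- g0)]ImN g1 subr0.
exact: le_trans (normIm_le _) g2.
Qed.

(** For t = 1 / d(x) the denominator factors as - t (z - x) [dd1] z x. Each entry is thus a pole at
    x plus a remainder with real boundary values, whose imaginary part is O(h). The numerators p and
    q give the diagonal entries, and 1 the off-diagonal ones. *)
Lemma near_pole (a1 b1 : R) : b < a1 -> a1 <= b1 ->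
  exists K h1 : R, [/\ 0 <= K, 0 < h1 & forall y x h,
  a1 <= y <= b1 -> a1 <= x <= b1 -> 0 < h <= h1 ->
  let z := y +i* h in let t := (Re (dd x%:C))^-1 in
  let kap (n : R) := - n / (t * Re (dd1 x%:C x%:C)) in
  let u := (1 - t%:C * dd z)^-1 in
  [/\ `|Im (p z * u) - kap (Re (p x%:C)) * Im (z - x%:C)^-1| <= K * h,
      `|Im (q z * u) - kap (Re (q x%:C)) * Im (z - x%:C)^-1| <= K * h &
      `|Im u - kap 1 * Im (z - x%:C)^-1| <= K * h]].
Proof.
move=> ha hab; have b0' := b0; have [K K0 hK] := strip_near_real ha.
pose c0 := 2 / (b1 + b) ^+ 3.
have B0 : 0 < b1 + b by lra.
have c00 : 0 < c0 by rewrite divr_gt0 // exprn_gt0.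
pose K2 := Num.max K (Num.max 1 (2 / (a1 - b)) ^+ 2).
have KK2 : K <= K2 by rewrite le_max lexx.
have m1 : 1 <= Num.max 1 (2 / (a1 - b)) by rewrite le_max lexx.
have K21 : 1 <= K2.
  by rewrite le_max; apply/orP; right; rewrite expr2 -[leLHS]mulr1 ler_pM.
have c02 : 0 < c0 / 2 by rewrite divr_gt0.
have [K' hK'] := near_pole_algebra K2 c02.
(* The bound on h keeps [dd1] z x at least c0 / 2, half of its lower bound on the axis. *)
exists (Num.max K' 0), (c0 / 2 / (K + 1)); split.
- by rewrite le_max lexx orbT.
- by apply: divr_gt0 => //; exact: ltr_wpDl.
move=> y x h hy hx /andP[h0 hh] z t kap u.
have [/andP[y1 y2] /andP[x1 x2]] := conj hy hx.
have bx : b < x by lra.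
have byy : b < y by lra.
have dx := dd_gt0 bx.
have t0 : 0 < t by rewrite invr_gt0.
have tK : t^-1 <= K2.
  rewrite /t invrK; apply: le_trans (dd_le bx) _; rewrite le_max; apply/orP; right.
  have h1 : 2 / (x - b) <= Num.max 1 (2 / (a1 - b)).
    rewrite le_max; apply/orP; right; rewrite ler_wpM2l // lef_pV2 ?posrE; lra.
  rewrite !expr2; apply: ler_pM => //; apply: divr_ge0 => //; lra.
have d0 : 0 < a1 - b by rewrite subr_gt0.
have gz : gap b (a1 - b) z by exact: gap_strip.
have gx : gap b (a1 - b) x%:C by exact: gapR.
have [[np nq] [np1 nq1] nd n1 n2] := hK y x h y1 x1 (ltW h0).
have [[npx nqx] _ _ nx1 _] := hK x x 0 x1 x1 (lexx 0).
have zx : z != x%:C.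
  by apply/eqP => /(congr1 (@complex.Im R)) /= h00; move: h0; rewrite h00 ltxx.
have cst (a a' : C) : near_real K 0 a a' -> near_real K2 h a' a'.
  by case=> _ _ ka ra _; apply: near_real_cst; rewrite ?(ltW h0) // (le_trans ka).
have up (a a' : C) : near_real K h a a' -> near_real K2 h a a' by exact: near_real_le.
have e1 : c0 <= cabs (dd1 y%:C x%:C) by exact: (dd1_lower ha hy hx).
have e2 : c0 <= cabs (dd1 x%:C x%:C) by exact: (dd1_lower ha hx hx).
have e3 : c0 / 2 <= cabs (dd1 z x%:C).
  have [_ _ _ _] := n1; have := ler_cabsB (dd1 y%:C x%:C) (dd1 y%:C x%:C - dd1 z x%:C).
  rewrite opprB addrCA subrr addr0 [cabs (_ - dd1 z _)]cabsB => h1 h2.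
  have h3 : K * h <= c0 / 2.
    move: hh; rewrite ler_pdivlMr ?ltr_wpDl // => hh.
    have : h * K <= h * (K + 1) by rewrite ler_wpM2l ?(ltW h0) // lerDl.
    lra.
  lra.
have cc : [/\ c0 / 2 <= cabs (dd1 z x%:C), c0 / 2 <= cabs (dd1 y%:C x%:C) &
    c0 / 2 <= cabs (dd1 x%:C x%:C)] by split => //; lra.
have iu : 1 - t%:C * dd z = - t%:C * ((z - x%:C) * dd1 z x%:C).
  rewrite -(dd_sub d0 gz gx) mulNr mulrBr opprB; congr (_ - _).
  by rewrite (dd_real bx) -rmorphM /t mulVf ?gt_eqF.
have ie := dd1_sub d0 gz gx.
have fin (Nz Nx N1z N1y : C) : near_real K2 h N1z N1y -> near_real K2 h Nx Nx ->
    Nz - Nx = (z - x%:C) * N1z ->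
    `|Im (Nz * u) - kap (Re Nx) * Im (z - x%:C)^-1| <= Num.max K' 0 * h.
  move=> a1' a2' a3'.
  have nn := And5 a1' (up _ _ n1) (up _ _ n2) (cst _ _ nx1) a2'.
  apply: le_trans (hK' h t z _ Nz Nx _ _ _ _ _ _ _ (dd z) nn cc (And3 a3' ie iu) zx t0 tK) _.
  by rewrite ler_wpM2r ?(ltW h0) // le_max lexx.
split.
- exact: fin (up _ _ np1) (cst _ _ npx) (st_sub hp d0 gz gx).
- exact: fin (up _ _ nq1) (cst _ _ nqx) (st_sub hq d0 gz gx).
- rewrite -[u]mul1r; apply: (fin 1 1 0 0).
  + by apply: near_real_cst; rewrite ?(ltW h0) ?cabs0 // (le_trans ler01).
  + by apply: near_real_cst; rewrite ?(ltW h0) ?cabs1.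
  + by rewrite subrr mulr0.
Qed.


(** Away from the roots the boundary values are real, so imaginary parts are O(h), uniformly in th.
    The third entry carries th^-1, unbounded for small th; it is absorbed because u is within a
    multiple of t h / (1 + t)^2 of its real boundary value, with t = th^2. *)
Lemma off_pole (a1 c : R) : b < a1 -> 0 < c -> exists K h1 : R,
  [/\ 0 <= K, 0 < h1 & forall y th h, a1 <= y -> 0 < th -> 0 < h <= h1 ->
  c * (1 + th ^+ 2) <= cabs (1 - (th ^+ 2)%:C * dd y%:C) ->
  let z := y +i* h in
  let u := (1 - (th ^+ 2)%:C * dd z)^-1 in
  [/\ `|Im (p z * u)| <= K * h, `|Im (q z * u)| <= K * h &
      `|Im (th^-1%:C * u)| <= K * h]].
Proof.
move=> ha c0; have b0' := b0; have [K K0 hK] := strip_near_real ha.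
exists (K * (2 / c) + K * (K * (2 / c ^+ 2)) + K * (2 / c ^+ 2)), (c / 2 / (K + 1)).
have c2 : 0 <= 2 / c by rewrite divr_ge0 // ltW.
have c3 : 0 <= 2 / c ^+ 2 by rewrite divr_ge0 // exprn_ge0 // ltW.
have k1 : 0 <= K * (2 / c) by rewrite mulr_ge0.
have k2 : 0 <= K * (2 / c ^+ 2) by rewrite mulr_ge0.
have k3 : 0 <= K * (K * (2 / c ^+ 2)) by rewrite mulr_ge0.
split; [lra|by rewrite !divr_gt0 // ltr_wpDl|].
move=> y th h hy th0 /andP[h0 hh] hc z u.
have hby : b < y by lra.
have [[np nq] _ nd _ _] := hK y y h hy hy (ltW h0).
have KH : K * h <= c / 2.
  move: hh; rewrite ler_pdivlMr ?ltr_wpDl // => hh.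
  have : h * K <= h * (K + 1) by rewrite ler_wpM2l ?(ltW h0) // lerDl.
  lra.
have t0 : 0 < th ^+ 2 by rewrite exprn_gt0.
set t := th ^+ 2 in hc u t0 *.
have t1 : 0 < 1 + t by rewrite addr_gt0.
pose v := 1 - t%:C * dd z; pose v0 := 1 - t%:C * dd y%:C.
have vv : v0 - v = t%:C * (dd z - dd y%:C) by rewrite /v /v0; ring.
have dvv : cabs (v0 - v) <= t * (K * h).
  have [_ _ _ _ hd] := nd.
  by rewrite vv cabsM cabsR gtr0_norm // ler_wpM2l // ltW.
have vlow : c / 2 * (1 + t) <= cabs v.
  have -> : v = v0 - (v0 - v) by rewrite opprB addrCA subrr addr0.
  apply: le_trans (ler_cabsB _ _).
  have : t * (K * h) <= t * (c / 2) by rewrite ler_wpM2l // ltW.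
  move: hc; rewrite -/v0; lra.
have cpos : 0 < c * (1 + t) by rewrite mulr_gt0.
have cpos2 : 0 < c / 2 * (1 + t) by rewrite mulr_gt0 // divr_gt0.
have v0n : v0 != 0 by rewrite -cabs_gt0 (lt_le_trans cpos).
have vn : v != 0 by rewrite -cabs_gt0 (lt_le_trans cpos2).
have ub : cabs u <= 2 / c / (1 + t).
  have -> : 2 / c / (1 + t) = (c / 2 * (1 + t))^-1 by field; rewrite !gt_eqF.
  by rewrite cabsV lef_pV2 ?posrE // (lt_le_trans cpos2).
have ub1 : cabs u <= 2 / c.
  by apply: le_trans ub _; rewrite ler_piMr // invf_le1 // lerDl ltW.
pose u0 := v0^-1.
have du : cabs (u - u0) <= t / (1 + t) ^+ 2 * (K * h * (2 / c ^+ 2)).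
  have -> : u - u0 = (v0 - v) * (u * u0) by rewrite /u -/v /u0; field; rewrite vn v0n.
  have u0b : cabs u0 <= (c * (1 + t))^-1 by rewrite cabsV lef_pV2 ?posrE // (lt_le_trans cpos).
  rewrite !cabsM.
  have -> : t / (1 + t) ^+ 2 * (K * h * (2 / c ^+ 2)) =
      t * (K * h) * (2 / c / (1 + t) * (c * (1 + t))^-1) by field; rewrite !gt_eqF.
  by apply: ler_pM; rewrite ?mulr_ge0 ?cabs_ge0 // ler_pM ?cabs_ge0.
have Kh : 0 <= K * h * (2 / c ^+ 2) by exact: mulr_ge0 (mulr_ge0 K0 (ltW h0)) c3.
have du1 : cabs (u - u0) <= K * h * (2 / c ^+ 2).
  apply: le_trans du _; rewrite ler_piMl // ler_pdivrMr ?exprn_gt0 // mul1r.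
  have := sqr_ge0 t; rewrite sqrrD; lra.
have ru0 : Im u0 = 0.
  by rewrite /u0 /v0 (dd_real hby) -rmorphM -(rmorph1 (real_complex R)) -rmorphB -fmorphV.
have fin (a a0 : C) : near_real K h a a0 ->
    `|Im (a * u)| <= (K * (2 / c) + K * (K * (2 / c ^+ 2)) + K * (2 / c ^+ 2)) * h.
  move=> [_ ka ka0 ra0 da].
  have -> : Im (a * u) = Im ((a - a0) * u + a0 * (u - u0)).
    have -> : (a - a0) * u + a0 * (u - u0) = a * u - a0 * u0 by ring.
    by rewrite ImD ImN [Im (a0 * _)]ImM ra0 ru0 mulr0 mul0r addr0 subr0.
  apply: le_trans (normIm_le _) _; apply: le_trans (ler_cabsD _ _) _; rewrite !cabsM.
  have s1 : cabs (a - a0) * cabs u <= K * h * (2 / c) by rewrite ler_pM ?cabs_ge0.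
  have s2 : cabs a0 * cabs (u - u0) <= K * (K * h * (2 / c ^+ 2)) by rewrite ler_pM ?cabs_ge0.
  have s3 : 0 <= K * (2 / c ^+ 2) * h by rewrite mulr_ge0 // ltW.
  lra.
split; [exact: fin np|exact: fin nq|].
have -> : Im (th^-1%:C * u) = Im (th^-1%:C * (u - u0)).
  by rewrite !ImZ ImD ImN ru0 subr0.
apply: le_trans (normIm_le _) _; rewrite cabsM cabsR gtr0_norm ?invr_gt0 //.
apply: (@le_trans _ _ (th^-1 * (t / (1 + t) ^+ 2 * (K * h * (2 / c ^+ 2))))).
  by rewrite ler_wpM2l // invr_ge0 ltW.
apply: (@le_trans _ _ (K * h * (2 / c ^+ 2))).
  rewrite mulrA ler_piMl //.
  have -> : th^-1 * (t / (1 + t) ^+ 2) = th / (1 + t) ^+ 2.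
    by rewrite /t; field; rewrite !gt_eqF.
  rewrite ler_pdivrMr ?exprn_gt0 // mul1r.
  have := sqr_ge0 (th - 1); have := sqr_ge0 t; rewrite sqrrB sqrrD -/t !mulr1; lra.
have := mulr_ge0 k1 (ltW h0); have := mulr_ge0 k3 (ltW h0); lra.
Qed.

End Transforms.

Arguments dd {R} Lp Lq z.
Arguments dd1 {R} Lp Lq z w.
Arguments dd2 {R} Lp Lq z w.

(** * Locations and weights *)

Section Locations.
Context {R : realType} (mu : probability (measurableTypeR R) R) (c : R).
Local Notation T := (Cplx R).
Local Notation C := R[i].
Context (mu_neg : mu [set x | x < 0] = 0%E) (mu_cpt : compact (msupport mu))
  (c01 : 0 < c <= 1).
Local Notation b := (edge mu).

Definition phi_state := noise_state mu.
Definition phit_state (f : R -> C) : C :=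
  c%:C * noise_state mu f + (1 - c)%:C * f 0.

Lemma phi_stateP : state b phi_state.
Proof. exact: noise_state_state. Qed.

Lemma phit_stateP : state b phit_state.
Proof.
apply: state_mixture; [|exact: edge_ge0|exact: noise_state_state].
by have /andP[c0 ->] := c01; rewrite ltW.
Qed.

Local Notation b0 := (edge_ge0 mu).
Local Notation p := (st phi_state).
Local Notation q := (st phit_state).
Local Notation d := (dd phi_state phit_state).
Local Notation d1 := (dd1 phi_state phit_state).

Lemma phiE z : off_cut mu z -> phi mu z = p z.
Proof. exact: phi_noise_state. Qed.

Lemma phitE z : off_cut mu z -> phit mu c z = q z.
Proof. exact: phit_noise_state. Qed.

Lemma dtrE z : off_cut mu z -> dtr mu c z = d z.
Proof. by move=> hz; rewrite /dtr phiE ?phitE. Qed.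

Lemma off_cutP (z : C) : off_cut mu z <-> (Im z = 0 -> b < `|Re z|).
Proof.
split=> [h z0|h [z0 hz]].
  rewrite ltNge; apply/negP => hb; apply: h; split => //.
  by rewrite -ler_norml.
by have := h z0; rewrite ltNge ler_norml hz.
Qed.

Lemma off_cutR (y : R) : b < y -> off_cut mu y%:C.
Proof. by move=> hy; apply/off_cutP => _ /=; apply: lt_le_trans hy (ler_norm _). Qed.

Lemma off_cut_nonreal (z : C) : Im z != 0 -> off_cut mu z.
Proof. by move=> h; apply/off_cutP => z0; rewrite z0 eqxx in h. Qed.

Lemma off_cut_gap z : off_cut mu z -> exists2 dl, 0 < dl & gap b dl z.
Proof. by move=> /off_cutP; exact: gap_exists. Qed.

Lemma gap_off_cut dl z : 0 < dl -> gap b dl z -> off_cut mu z.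
Proof.
move=> d0 h [z0 hz]; have := h (Re z) hz.
have -> : z - (Re z)%:C = 0 by rewrite {1}[z]complexE z0 mulr0 addr0 subrr.
by rewrite cabs0 leNgt d0.
Qed.

Lemma holo_at_eq (F G : T -> C) z : off_cut mu z ->
  (forall w, off_cut mu w -> F w = G w) -> holo_at G z -> holo_at F z.
Proof.
move=> hz e [k [r [k0 r0 G1 G2]]]; have [dl d0 g] := off_cut_gap hz.
have near w : cabs (w - z) < Num.min r (dl / 2) -> off_cut mu w /\ cabs (w - z) < r.
  rewrite lt_min => /andP[h1 /ltW h2]; split => //.
  by apply: (@gap_off_cut (dl / 2)); [rewrite divr_gt0|exact: gap_near h2].
exists k, (Num.min r (dl / 2)); split => //; first by rewrite lt_min r0 divr_gt0.
  by move=> w /near [hw rw]; rewrite !e //; exact: G1.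
move=> t /andP[t0 t1].
have i1 : cabs ('i : C) = 1 by rewrite cabsE /= expr0n expr1n add0r sqrtr1.
have pt (a : C) : cabs a = 1 -> F (z + a * t%:C) = G (z + a * t%:C).
  move=> a1; apply: e; apply: (near _ _).1.
  by rewrite [z + _]addrC addrK cabsM a1 mul1r cabsR gtr0_norm.
have n1 := pt 1 (@cabs1 R); have n2 := pt (-1); rewrite cabsN cabs1 in n2.
have n3 := pt 'i i1; have n4 := pt (- 'i); rewrite cabsN i1 in n4.
move: n1 {n2}(n2 erefl) n3 {n4}(n4 erefl) => n1 n2 n3 n4.
rewrite mul1r in n1; rewrite mulN1r in n2; rewrite mulNr in n4.
have -> : four_points F z t = four_points G z t.
  by rewrite /four_points n1 n2 n3 n4 (e _ hz).
by apply: G2; rewrite t0 /=; move: t1; rewrite lt_min => /andP[].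
Qed.

Lemma holo_at_phi z : off_cut mu z -> holo_at (phi mu) z.
Proof.
move=> hz; have [dl d0 g] := off_cut_gap hz.
exact: holo_at_eq hz phiE (holo_at_st phi_stateP d0 g).
Qed.

Lemma holo_at_phit z : off_cut mu z -> holo_at (phit mu c) z.
Proof.
move=> hz; have [dl d0 g] := off_cut_gap hz.
exact: holo_at_eq hz phitE (holo_at_st phit_stateP d0 g).
Qed.

Lemma phi_reE y : b < y -> phi_re mu y = Re (p y%:C).
Proof. by move=> hy; rewrite /phi_re phiE //; exact: off_cutR. Qed.

Lemma phit_reE y : b < y -> phit_re mu c y = Re (q y%:C).
Proof. by move=> hy; rewrite /phit_re phitE //; exact: off_cutR. Qed.

Lemma d_reE y : b < y -> d_re mu c y = Re (d y%:C).
Proof. by move=> hy; rewrite /d_re dtrE //; exact: off_cutR. Qed.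

(** Both the derivative and the continuity of d on (b, +oo) follow from this Lipschitz control of
    its difference quotient. *)
Lemma d_re_quotient x : b < x -> exists K r : R, [/\ 0 <= K, 0 < r & forall y,
  `|y - x| < r -> b < y /\
  exists2 k : R, d_re mu c y - d_re mu c x = (y - x) * k &
    `|k - Re (d1 x%:C x%:C)| <= K * `|y - x|].
Proof.
move=> hx; pose a1 := (b + x) / 2.
have ha : b < a1 by rewrite /a1; lra.
have ax : a1 <= x by rewrite /a1; lra.
have [K K0 hK] := strip_near_real phi_stateP phit_stateP ha.
exists K, (x - a1); split => //; first by rewrite /a1; lra.
move=> y; rewrite ltr_norml => /andP[y1 y2].
have ay : a1 <= y by lra.
have hy : b < y by lra.
have d0 : 0 < a1 - b by rewrite subr_gt0.
have gy : gap b (a1 - b) y%:C by exact: gapR.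
have gx : gap b (a1 - b) x%:C by exact: gapR.
split => //; exists (Re (d1 y%:C x%:C)).
  by rewrite !d_reE // -ReN -ReD (dd_sub phi_stateP phit_stateP d0 gy gx) -rmorphB ReZ.
rewrite -ReN -ReD (dd1_sub phi_stateP phit_stateP d0 gy gx).
apply: le_trans (normRe_le _) _; rewrite cabsM -rmorphB cabsR mulrC.
rewrite ler_wpM2r //; have [_ _ _ _ [_ h1 _ _ _]] := hK y x 0 ay ax (lexx 0).
exact: h1.
Qed.

Lemma derive1_d_re x : b < x -> derive1 (d_re mu c) x = Re (d1 x%:C x%:C).
Proof.
move=> hx; have [K [r [K0 r0 h]]] := d_re_quotient hx.
apply/cvg_lim => //; apply/cvgrPdist_le => e e0; near=> s.
have s0 : s != 0 by near: s; exact: nbhs_dnbhs_neq.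
have sr : `|s + x - x| < r.
  rewrite addrK; near: s; apply: nbhs_dnbhs.
  by apply/nbhs_ballP; exists r => //= s; rewrite /ball /= sub0r normrN.
have se : (K + 1) * `|s| <= e.
  rewrite mulrC -ler_pdivlMr ?ltr_wpDl //; near: s; apply: nbhs_dnbhs.
  apply/nbhs_ballP; exists (e / (K + 1)); first by rewrite /= divr_gt0 ?ltr_wpDl.
  by move=> s; rewrite /ball /= sub0r normrN => /ltW.
have [_ [k -> hk]] := h _ sr; rewrite addrK in hk *.
rewrite [_ *: _]mulKf // distrC; apply: le_trans hk (le_trans _ se).
by rewrite mulrDl mul1r lerDl.
Unshelve. all: by end_near.
Qed.

Lemma continuous_d_re x : b < x -> continuous_at x (d_re mu c).
Proof.
move=> hx; have [K [r [K0 r0 h]]] := d_re_quotient hx.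
pose M := K * r + `|Re (d1 x%:C x%:C)| + 1.
have M0 : 0 < M by rewrite ltr_wpDl ?addr_ge0 ?mulr_ge0 // ltW.
apply/cvgrPdist_le => e e0; near=> y.
have yr : `|y - x| < r.
  by near: y; apply/nbhs_ballP; exists r => //= y; rewrite /ball /= distrC.
have ye : M * `|y - x| <= e.
  rewrite mulrC -ler_pdivlMr //; near: y.
  have eM : 0 < e / M by rewrite divr_gt0.
  by apply/nbhs_ballP; exists (e / M) => // y; rewrite /ball /= distrC => /ltW.
have [_ [k hd hk]] := h _ yr.
rewrite distrC hd normrM mulrC; apply: le_trans ye; apply: ler_wpM2r => //.
have : K * `|y - x| <= K * r by rewrite ler_wpM2l // ltW.
have := ler_normD (k - Re (d1 x%:C x%:C)) (Re (d1 x%:C x%:C)); rewrite subrK /M; lra.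
Unshelve. all: by end_near.
Qed.

Context (hedge : edge_condition mu c).

Lemma d_edge_gt y : b < y -> d_re mu c y < d_edge mu c.
Proof.
(* An intermediate point keeps the inequality strict in the limit. *)
move=> hy; have [hcv _] := hedge; pose x := (b + y) / 2.
have bx : b < x by rewrite /x; lra.
apply: (@lt_le_trans _ _ (d_re mu c x)).
  rewrite !d_reE //; apply: (dd_decr phi_stateP phit_stateP b0) => //.
  by rewrite /x; lra.
apply: limr_ge => //; near=> w.
have bw : b < w by near: w; exact: nbhs_right_gt.
have wx : w < x by near: w; exact: nbhs_right_lt.
rewrite !d_reE //; apply: ltW.
exact: (dd_decr phi_stateP phit_stateP b0).
Unshelve. all: by end_near.
Qed.

Lemma theta_star_ltP t : 0 < t -> (theta_star mu c < t) = ((t ^+ 2)^-1 < d_edge mu c).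
Proof.
move=> t0; have [_ e0] := hedge; have s0 : 0 < Num.sqrt (d_edge mu c) by rewrite sqrtr_gt0.
rewrite -[X in _ = (_ < X)](sqr_sqrtr (ltW e0)) -exprVn.
by rewrite ltr_sqr ?nnegrE ?invr_ge0 ?(ltW s0) ?(ltW t0) // /theta_star invf_plt ?posrE.
Qed.

Lemma rhoP t : 0 < t -> theta_star mu c < t ->
  b < rho mu c t /\ d_re mu c (rho mu c t) = (t ^+ 2)^-1.
Proof.
move=> t0 ht; have := ht; rewrite theta_star_ltP // => td.
rewrite /rho ht; suff [y hy] : exists y, b < y /\ d_re mu c y = (t ^+ 2)^-1.
  by apply: (@xgetPex _ b [set z | b < z /\ d_re mu c z = (t ^+ 2)^-1]); exists y.
(* At b + 3 t the a priori bound (2 / (y - b))^2 of d is 4 / (9 t^2), below the target 1 / t^2; near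
   the edge d exceeds the target, and the intermediate value theorem applies. *)
have [hcv _] := hedge; pose x1 := b + 3 * t.
have bx1 : b < x1 by rewrite /x1 ltrDl mulr_gt0.
have [x0 [bx0 x01 dx0]] : exists x0, [/\ b < x0, x0 < x1 & (t ^+ 2)^-1 < d_re mu c x0].
  apply: (@filter_ex _ (b^'+)); near=> x0; split.
  - by near: x0; exact: nbhs_right_gt.
  - by near: x0; exact: nbhs_right_lt.
  - by near: x0; exact: (cvgr_gt _ hcv).
have dx1 : d_re mu c x1 < (t ^+ 2)^-1.
  rewrite (d_reE bx1); apply: le_lt_trans (dd_le phi_stateP phit_stateP bx1) _.
  rewrite /x1 [b + _]addrC addrK -exprVn ltr_sqr ?nnegrE ?divr_ge0 ?invr_ge0 //; last 2 first.
  - by rewrite mulr_ge0 // ltW.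
  - exact: ltW.
  by rewrite ltr_pdivrMr ?mulr_gt0 // mulrCA mulVf ?gt_eqF // mulr1 ltr_nat.
have [||y] := @IVT _ (d_re mu c) x0 x1 (t ^+ 2)^-1 (ltW x01).
- apply: continuous_in_subspaceT => y; rewrite inE /= in_itv /= => /andP[hy _].
  exact/continuous_d_re/(lt_le_trans bx0).
- by rewrite ge_min le_max (ltW dx0) (ltW dx1) orbT.
rewrite in_itv /= => /andP[hy _] dy; exists y; split => //.
exact: lt_le_trans hy.
Unshelve. all: by end_near.
Qed.

Lemma rho_sub t : ~ (theta_star mu c < t) -> rho mu c t = b.
Proof. by move=> /negP/negbTE h; rewrite /rho h. Qed.

Lemma rho_gt_theta t : b < rho mu c t -> theta_star mu c < t.
Proof. by apply: contraTT => /negP/rho_sub ->; rewrite ltxx. Qed.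

(** Joins the two regimes: above the threshold t^2 is the inverse of d at the root, below it t^2
    times the edge value of d is at most 1. *)
Lemma location_lower (a1 b1 dl : R) : b < a1 -> a1 <= b1 -> 0 < dl ->
  exists2 e : R, 0 < e & forall y t, a1 <= y <= b1 -> 0 < t -> dl <= `|rho mu c t - y| ->
    e * (1 + t ^+ 2) <= cabs (1 - (t ^+ 2)%:C * d y%:C).
Proof.
move=> ha hab dl0; have [_ D0] := hedge.
have [e1 e10 h1] := dd_root_lower phi_stateP phit_stateP b0 ha hab dl0 D0.
have dD : Re (d a1%:C) < d_edge mu c by rewrite -d_reE //; exact: d_edge_gt.
have [e2 e20 h2] := dd_subcritical_lower phi_stateP phit_stateP b0 ha dD.
exists (Num.min e1 e2); first by rewrite lt_min e10.
move=> y t hy t0 hr; have t2 : 0 < 1 + t ^+ 2 by rewrite addr_gt0 ?exprn_gt0.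
have [ht|/negP ht] := boolP (theta_star mu c < t).
  have [bx dx] := rhoP t0 ht.
  have dx' : Re (d (rho mu c t)%:C) = (t ^+ 2)^-1 by rewrite -d_reE.
  apply: le_trans (_ : e1 * (1 + t ^+ 2) <= _).
    by rewrite ler_wpM2r ?(ltW t2) // ge_min lexx.
  have := h1 y _ hy bx hr; rewrite dx' invrK; apply.
  by move: ht; rewrite theta_star_ltP // => /ltW.
apply: le_trans (_ : e2 * (1 + t ^+ 2) <= _).
  by rewrite ler_wpM2r ?(ltW t2) // ge_min lexx orbT.
apply: h2; [by case/andP: hy|by rewrite sqr_ge0|].
move/negP: ht; rewrite theta_star_ltP // -leNgt => ht.
by rewrite -ler_pdivlMl ?exprn_gt0 // mulr1.
Qed.

Section Weights.
Context (t : R) (t0 : 0 < t) (ht : theta_star mu c < t).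
Local Notation x := (rho mu c t).

(** Turns half of an overlap weight into the residue met in [near_pole], using t^-2 = d(rho). *)
Lemma kappaE (n : R) :
  - (2 * n) / (t ^+ 2 * derive1 (d_re mu c) x) / 2 =
  - n / ((Re (d x%:C))^-1 * Re (d1 x%:C x%:C)).
Proof.
have [bx dx] := rhoP t0 ht.
rewrite derive1_d_re // -d_reE // dx invrK mulrAC; congr (_ / _).
by rewrite -mulrN mulrAC mulfV ?mul1r // pnatr_eq0.
Qed.

Lemma kappaLE :
  kappaL mu c t / 2 = - Re (p x%:C) / ((Re (d x%:C))^-1 * Re (d1 x%:C x%:C)).
Proof. by have [bx dx] := rhoP t0 ht; rewrite /kappaL ht phi_reE // kappaE. Qed.

Lemma kappaRE :
  kappaR mu c t / 2 = - Re (q x%:C) / ((Re (d x%:C))^-1 * Re (d1 x%:C x%:C)).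
Proof. by have [bx dx] := rhoP t0 ht; rewrite /kappaR ht phit_reE // kappaE. Qed.

Lemma kappaLRE :
  kappaLR mu c t / 2 = t^-1 * (- 1 / ((Re (d x%:C))^-1 * Re (d1 x%:C x%:C))).
Proof.
have [bx dx] := rhoP t0 ht.
rewrite /kappaLR ht -kappaE mulr1 exprS -[t * _ * _]mulrA invfM.
by rewrite [- 2 * (_ / _)]mulrCA -!mulrA.
Qed.

End Weights.

(** The lower bound concerns the trace of the limiting 2 x 2 block; as the block has rank one, this
    is its nonzero eigenvalue. For [kappaLR] the factor t^-1 is at most 1 + t^-2 = 1 + d(rho). *)
Lemma kappa_bounds (a1 b1 : R) : b < a1 -> a1 <= b1 -> exists K e : R, [/\ 0 <= K, 0 < e &
  forall t, 0 < t -> a1 <= rho mu c t <= b1 ->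
  [/\ `|kappaL mu c t / 2| <= K, `|kappaR mu c t / 2| <= K,
      `|kappaLR mu c t / 2| <= K &
      e <= kappaL mu c t / 2 + kappaR mu c t / 2]].
Proof.
move=> ha hab; have [K K0 hK] := strip_near_real phi_stateP phit_stateP ha.
have b0' : 0 <= b := b0.
have bb : 0 < b1 + b by lra.
pose D := 2 / (b1 + b) ^+ 3; pose s := (b1 + b)^-1.
have s0 : 0 < s by rewrite invr_gt0.
have D0 : 0 < D by rewrite divr_gt0 ?exprn_gt0.
have K1 : 0 < K + 1 by rewrite ltr_wpDl.
have M0 : 0 <= K * (K / D) by rewrite mulr_ge0 // divr_ge0 // ltW.
have N0 : 0 <= (1 + K) * (K / D) by rewrite mulr_ge0 ?addr_ge0 // divr_ge0 // ltW.
exists (K * (K / D) + (1 + K) * (K / D)), (s * (s * s / (K + 1))).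
split; [exact: addr_ge0|by rewrite !mulr_gt0 ?invr_gt0|].
move=> t t0 /andP[hx1 hx2]; have bx := lt_le_trans ha hx1.
have ht := rho_gt_theta bx; have [_ dx] := rhoP t0 ht.
rewrite kappaLE // kappaRE // kappaLRE //; rewrite d_reE // in dx.
have [[hp hq] _ hd hd1 _] := hK _ _ 0 hx1 hx1 (lexx 0).
have W0 : D <= - Re (d1 (rho mu c t)%:C (rho mu c t)%:C).
  have := dd1_lower phi_stateP phit_stateP b0 ha (introT andP (conj hx1 hx2))
    (introT andP (conj hx1 hx2)).
  rewrite (dd1_real phi_stateP phit_stateP bx bx) cabsR ltr0_norm //.
  apply: le_lt_trans (dd1_le phi_stateP phit_stateP b0 bx bx) _.
  have x0 : 0 < (rho mu c t + b)^-1 by rewrite invr_gt0; lra.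
  by rewrite oppr_lt0 addr_gt0 // !mulr_gt0.
have WK : - Re (d1 (rho mu c t)%:C (rho mu c t)%:C) <= K.
  have [_ _ h _ _] := hd1; apply: le_trans h.
  by apply: le_trans (normRe_le _); rewrite -normrN ler_norm.
have [P1 PK] : s <= Re (p (rho mu c t)%:C) /\ Re (p (rho mu c t)%:C) <= K.
  split; last by have [_ _ h _ _] := hp; apply: le_trans (Re_le _) h.
  apply: le_trans (st_ge phi_stateP bx).
  by rewrite lef_pV2 ?posrE ?lerD2r //; lra.
have [Q1 QK] : s <= Re (q (rho mu c t)%:C) /\ Re (q (rho mu c t)%:C) <= K.
  split; last by have [_ _ h _ _] := hq; apply: le_trans (Re_le _) h.
  apply: le_trans (st_ge phit_stateP bx).
  by rewrite lef_pV2 ?posrE ?lerD2r //; lra.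
have DPQ : Re (d (rho mu c t)%:C) = Re (p (rho mu c t)%:C) * Re (q (rho mu c t)%:C).
  by rewrite /dd (st_real phi_stateP bx) (st_real phit_stateP bx) -rmorphM.
have DK : Re (d (rho mu c t)%:C) <= K.
  by have [_ _ h _ _] := hd; apply: le_trans (Re_le _) h.
move: dx P1 PK Q1 QK DPQ DK W0 WK.
set P := Re (p _); set Q := Re (q _); set E := Re (d _); set W := Re (d1 _ _).
move=> dx P1 PK Q1 QK DPQ DK W0 WK.
have alg n : - n / (E^-1 * W) = n * (E / - W).
  by rewrite invfM invrK invrN mulNr !mulrN.
rewrite !alg.
have Ds : s * s <= E by rewrite DPQ ler_pM // ltW.
have E0 : 0 < E by apply: lt_le_trans Ds; rewrite mulr_gt0.
have Wp : 0 < - W by exact: lt_le_trans W0.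
have EW0 : 0 <= E / - W by rewrite divr_ge0 // ltW.
have EW : E / - W <= K / D by rewrite ler_pM ?(ltW E0) ?invr_ge0 ?(ltW Wp) // lef_pV2 ?posrE.
have P0 : 0 <= P by apply: le_trans P1; rewrite ltW.
have Q0 : 0 <= Q by apply: le_trans Q1; rewrite ltW.
have GL : s * s / (K + 1) <= E / - W.
  apply: ler_pM => //; first by rewrite mulr_ge0 // ltW.
    by rewrite invr_ge0 ltW.
  by rewrite lef_pV2 ?posrE //; lra.
move: EW0 EW GL; move: (E / - W) => G G0 GK GL.
have ti : 0 <= t^-1 by rewrite invr_ge0 ltW.
rewrite !ger0_norm ?mulr_ge0 //; split.
- by apply: le_trans (_ : K * (K / D) <= _); [exact: ler_pM|rewrite lerDl].
- by apply: le_trans (_ : K * (K / D) <= _); [exact: ler_pM|rewrite lerDl].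
- rewrite mul1r; apply: le_trans (_ : (1 + K) * (K / D) <= _); last by rewrite lerDr.
  apply: ler_pM => //.
  by have := sqr_ge0 (t^-1 - 1); rewrite sqrrB mulr1 expr1n exprVn -dx; lra.
- apply: le_trans (_ : P * G <= _); last by rewrite lerDl mulr_ge0.
  apply: ler_pM => //; first exact: ltW.
  by rewrite divr_ge0 ?mulr_ge0 // ltW.
Qed.

(** The boolean [w] selects the regime: if the location lies in [a1, b1] its pole is subtracted,
    however close y may be; otherwise it is far from y and there is nothing to subtract. *)
Lemma entries_near (a1 b1 dl : R) : b < a1 -> a1 <= b1 -> 0 < dl ->
  exists K h1 : R, [/\ 0 <= K, 0 < h1 & forall y t h (w : bool),
  a1 <= y <= b1 -> 0 < t -> 0 < h <= h1 ->
  (if w then a1 <= rho mu c t <= b1 else dl <= `|rho mu c t - y|) ->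
  let z := y +i* h in let u := (1 - (t ^+ 2)%:C * d z)^-1 in
  let pole := Im (z - (rho mu c t)%:C)^-1 in
  [/\ `|Im (p z * u) - kappaL mu c t / 2 * w%:R * pole| <= K * h,
      `|Im (q z * u) - kappaR mu c t / 2 * w%:R * pole| <= K * h &
      `|Im (t^-1%:C * u) - kappaLR mu c t / 2 * w%:R * pole| <= K * h]].
Proof.
move=> ha hab dl0; have b0' : 0 <= b := b0.
have [e e0 he] := location_lower ha hab dl0.
have [K1 [h1 [k1 h10 np]]] := near_pole phi_stateP phit_stateP b0 ha hab.
have [K2 [h2 [k2 h20 op]]] := off_pole phi_stateP phit_stateP b0 ha e0.
pose s := 2 / (a1 - b); have s0 : 0 < s by rewrite /s divr_gt0 // subr_gt0.
exists (K1 + s * K1 + K2), (Num.min h1 h2); split.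
- by rewrite !addr_ge0 // mulr_ge0 // ltW.
- by rewrite lt_min h10.
move=> y t h w hy t0; rewrite le_min => /and3P[h0 hh1 hh2] hw z u pole.
have sK : 0 <= s * K1 by rewrite mulr_ge0 // ltW.
have leK1 : K1 * h <= (K1 + s * K1 + K2) * h.
  by rewrite ler_wpM2r ?(ltW h0) // -addrA lerDl addr_ge0.
have leK2 : K2 * h <= (K1 + s * K1 + K2) * h.
  by rewrite ler_wpM2r ?(ltW h0) // lerDr addr_ge0.
have lesK : s * K1 * h <= (K1 + s * K1 + K2) * h.
  by rewrite ler_wpM2r ?(ltW h0) // addrAC lerDr addr_ge0.
case: w hw => hw.
  have bx : b < rho mu c t by case/andP: hw => /(lt_le_trans ha).
  have ht := rho_gt_theta bx; have [_ dx] := rhoP t0 ht.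
  have dx' : (Re (d (rho mu c t)%:C))^-1 = t ^+ 2 by rewrite -d_reE // dx invrK.
  have hh : 0 < h <= h1 by rewrite h0.
  have [] := np y _ h hy hw hh; rewrite dx' -/z -/u -/pole => n1 n2 n3.
  rewrite !mulr1 kappaLE // kappaRE // kappaLRE // dx'.
  split; [exact: le_trans n1 leK1|exact: le_trans n2 leK1|].
  rewrite ImZ -mulrA -mulrBr normrM gtr0_norm ?invr_gt0 //.
  apply: le_trans lesK; rewrite -mulrA; apply: ler_pM => //.
    by rewrite invr_ge0 ltW.
  rewrite -ler_sqr ?nnegrE ?invr_ge0 ?(ltW s0) ?(ltW t0) // exprVn -dx d_reE //.
  apply: le_trans (dd_le phi_stateP phit_stateP bx) _.
  rewrite ler_sqr ?nnegrE ?divr_ge0 ?subr_ge0 ?(ltW bx) ?(ltW ha) //.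
  rewrite /s ler_pM2l // lef_pV2 ?posrE ?subr_gt0 //.
  by rewrite lerD2r; case/andP: hw.
rewrite !mulr0 !mul0r !subr0.
have hh : 0 < h <= h2 by rewrite h0.
have ay : a1 <= y by case/andP: hy.
have [n1 n2 n3] := op y t h ay t0 hh (he _ _ hy t0 hw).
by split; apply: le_trans leK2.
Qed.

End Locations.

(** * The Poisson filter *)

Section PoissonFilter.
Context {R : realType}.
Implicit Types (x y : R).

(** The derivative of 1 / (1 + x^2) is bounded by 1 in absolute value, so the rectangle error is at
    most the squared step. *)
Lemma atan_step (u v : R) : u <= v ->
  `|(v - u) / (1 + u ^+ 2) - (atan v - atan u)| <= (v - u) ^+ 2.
Proof.
move=> uv; have [|x] := @MVT_segment R (@atan R) (fun x => (1 + x ^+ 2)^-1) u v uv.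
  exact/continuous_subspaceT/continuous_atan.
rewrite in_itv /= => /andP[ux xv] ->.
have p (y : R) : 0 < 1 + y ^+ 2 by rewrite ltr_wpDr ?sqr_ge0.
rewrite [_^-1 * _]mulrC -mulrBr normrM ger0_norm ?subr_ge0 // expr2.
rewrite ler_wpM2l ?subr_ge0 //.
have -> : (1 + u ^+ 2)^-1 - (1 + x ^+ 2)^-1 =
    (x - u) * ((x + u) / ((1 + u ^+ 2) * (1 + x ^+ 2))).
  by field; rewrite !gt_eqF.
rewrite normrM ger0_norm ?subr_ge0 // -[leRHS]mulr1 ler_pM ?subr_ge0 ?lerD2r //.
rewrite normrM normfV [`|_ * (_ + _)|]gtr0_norm ?mulr_gt0 // ler_pdivrMr ?mulr_gt0 // mul1r.
apply: le_trans (ler_normD _ _) _.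
have := sqr_ge0 (`|x| - 1); have := sqr_ge0 (`|u| - 1).
rewrite !sqrrB !real_normK ?num_real // => h1 h2.
have := sqr_ge0 u; have := sqr_ge0 x.
have := mulr_ge0 (sqr_ge0 u) (sqr_ge0 x); lra.
Qed.

Lemma atan_riemann_sum (s u : R) N : 0 <= s ->
  `|\sum_(k < N) s / (1 + (u + k%:R * s) ^+ 2) - (atan (u + N%:R * s) - atan u)|
  <= N%:R * s ^+ 2.
Proof.
move=> s0; elim: N => [|N IH].
  by rewrite big_ord0 !mul0r addr0 !subrr normr0.
rewrite big_ord_recr /=.
have st : u + N%:R * s <= u + N.+1%:R * s by rewrite lerD2l ler_wpM2r // ler_nat.
have := atan_step st.
have -> : u + N.+1%:R * s - (u + N%:R * s) = s by rewrite -natr1; ring.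
move=> h; have -> : N.+1%:R * s ^+ 2 = N%:R * s ^+ 2 + s ^+ 2 by rewrite -natr1; ring.
apply: le_trans (lerD IH h); apply: le_trans (ler_normD _ _); rewrite le_eqVlt.
apply/orP; left; apply/eqP; congr (`|_|); ring.
Qed.

Lemma atan_large (e : R) : 0 < e -> exists2 M : R, 0 < M &
  forall t, M <= t -> pi / 2 - e <= atan t.
Proof.
move=> e0; have := @cvgy_atan R => /cvgrPdist_le /(_ _ e0) [M [_ hM]].
exists (`|M| + 1); first by rewrite ltr_wpDl.
move=> t ht; have /hM : M < t.
  by apply: lt_le_trans ht; rewrite (le_lt_trans (ler_norm M)) // ltrDl.
by rewrite ler_norml => /andP[_]; lra.
Qed.

Definition poisson (x y eta : R) : R := eta / ((x - y) ^+ 2 + eta ^+ 2).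

(** After rescaling by eta this is a Riemann sum for the derivative of atan. The error 3 e is one e
    for discretization and one for each tail; the margin 1 inside [A, B] makes both rescaled
    endpoints at least 1 / eta in size. *)
Lemma poisson_sum (A B x eta e : R) N :
  (0 < N)%N -> A < B -> 0 < eta -> 0 < e ->
  (forall t, eta^-1 <= t -> pi / 2 - e <= atan t) ->
  (B - A) ^+ 2 <= e * eta ^+ 2 * N%:R ->
  A + 1 <= x <= B - 1 ->
  `|\sum_(k < N) (B - A) / N%:R * poisson x (A + k%:R * ((B - A) / N%:R)) eta - pi| <= 3 * e.
Proof.
move=> N0 AB eta0 e0 hat hN /andP[x1 x2].
have n0 : 0 < N%:R :> R by rewrite ltr0n.
pose s := (B - A) / N%:R / eta; pose u := (A - x) / eta.
have s0 : 0 <= s by rewrite !divr_ge0 ?subr_ge0 // ltW.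
have := atan_riemann_sum u N s0.
have -> : u + N%:R * s = (B - x) / eta by rewrite /u /s; field; rewrite !gt_eqF.
have -> : N%:R * s ^+ 2 = (B - A) ^+ 2 / (eta ^+ 2 * N%:R).
  by rewrite /s; field; rewrite !gt_eqF.
rewrite (eq_bigr (fun k : 'I_N =>
    (B - A) / N%:R * poisson x (A + k%:R * ((B - A) / N%:R)) eta)); last first.
  move=> k _; rewrite /poisson.
  have -> : u + k%:R * s = (A + k%:R * ((B - A) / N%:R) - x) / eta.
    by rewrite /u /s; field; rewrite !gt_eqF.
  move: (A + _) => y; rewrite /s -[(x - y) ^+ 2]sqrrN opprB.
  have p1 : 0 < (y - x) ^+ 2 + eta ^+ 2 by rewrite ltr_wpDl ?sqr_ge0 ?exprn_gt0.
  have p2 : 1 + ((y - x) / eta) ^+ 2 = ((y - x) ^+ 2 + eta ^+ 2) / eta ^+ 2.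
    by field; rewrite gt_eqF.
  by rewrite p2; field; rewrite !gt_eqF.
have : (B - A) ^+ 2 / (eta ^+ 2 * N%:R) <= e.
  by rewrite ler_pdivrMr ?mulr_gt0 ?exprn_gt0 // mulrA.
have ei : 0 < eta^-1 by rewrite invr_gt0.
have h1 := hat ((B - x) / eta); have h2 := hat (- u).
have {}h1 : pi / 2 - e <= atan ((B - x) / eta).
  by apply: h1; rewrite -[leLHS]mul1r ler_pM2r //; lra.
have {}h2 : atan u <= - (pi / 2 - e).
  rewrite lerNr -atanN; apply: h2; rewrite /u -mulNr -[leLHS]mul1r ler_pM2r //; lra.
have := atan_ltpi2 ((B - x) / eta); have := atan_gtNpi2 u.
rewrite !ler_norml; lra.
Qed.

Lemma poisson_far (x y eta dl : R) : 0 < eta -> 0 < dl -> dl <= `|x - y| ->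
  0 <= poisson x y eta <= eta / dl ^+ 2.
Proof.
move=> eta0 d0 hd.
have h : dl ^+ 2 <= (x - y) ^+ 2.
  by rewrite -[(x - y) ^+ 2]real_normK ?num_real // ler_sqr ?nnegrE // ltW.
rewrite /poisson divr_ge0 ?(ltW eta0) ?addr_ge0 ?sqr_ge0 //=.
rewrite ler_pM2l // lef_pV2 ?posrE ?exprn_gt0 ?ltr_wpDl ?sqr_ge0 ?exprn_gt0 //.
by apply: le_trans h _; rewrite lerDl sqr_ge0.
Qed.

(* As x -> Im (z - x)^-1, the sum is a finite combination of resolvents at
   nonreal points; this replaces the contour integral. *)
Lemma poisson_filter (A B dl e eta1 : R) :
  A < B -> 0 < dl -> 0 < e -> 0 < eta1 ->
  exists (eta : R) (N : nat), [/\ 0 < eta <= eta1, (0 < N)%N &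
  forall (J : set R) x,
  (forall y, `|x - y| < dl -> (y \in J) = (x \in J)) ->
  (x \in J -> A + 1 <= x <= B - 1) ->
  `|\sum_(k < N) (A + k%:R * ((B - A) / N%:R) \in J)%:R *
      ((B - A) / N%:R / pi * poisson x (A + k%:R * ((B - A) / N%:R)) eta)
    - (x \in J)%:R| <= e].
Proof.
move=> AB d0 e0 eta10; have BA : 0 < B - A by rewrite subr_gt0.
have p0 := @pi_gt0 R; have p2 := @pi_ge2 R.
pose e1 := e / 3; have e10 : 0 < e1 by rewrite divr_gt0.
have [M M0 hM] := atan_large e10.
(* The bound by M^-1 makes the atan tails at most e1; the last one makes the total weight of the
   nodes farther than dl from x at most e1. The number N of nodes then makes the discretization
   error at most e1. *)
pose eta := Num.min eta1 (Num.min M^-1 (e1 * dl ^+ 2 / (B - A))).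
have eta0 : 0 < eta.
  by rewrite !lt_min eta10 invr_gt0 M0 divr_gt0 ?mulr_gt0 ?exprn_gt0.
have etaM : M <= eta^-1.
  by rewrite -[M]invrK lef_pV2 ?posrE ?invr_gt0 // ge_min ge_min lexx orbT.
have etad : (B - A) * (eta / dl ^+ 2) <= e1.
  rewrite mulrA ler_pdivrMr ?exprn_gt0 // -ler_pdivlMl //.
  by rewrite [_^-1 * _]mulrC !ge_min lexx !orbT.
pose N := (Num.truncn ((B - A) ^+ 2 / (e1 * eta ^+ 2))).+1.
have N0 : 0 < N%:R :> R by rewrite ltr0n.
exists eta, N; split => //.
  by rewrite eta0 /= ge_min lexx.
move=> J x hx hxJ.
pose y (k : 'I_N) := A + k%:R * ((B - A) / N%:R).
pose W (k : 'I_N) := (B - A) / N%:R / pi * poisson x (y k) eta.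
have -> : \sum_(k < N) (A + k%:R * ((B - A) / N%:R) \in J)%:R *
      ((B - A) / N%:R / pi * poisson x (A + k%:R * ((B - A) / N%:R)) eta)
   = \sum_k (y k \in J)%:R * W k by [].
have W0 k : 0 <= W k.
  rewrite /W mulr_ge0 ?divr_ge0 ?(ltW BA) ?(ltW p0) ?(ltW N0) //.
  by rewrite ltW.
  by rewrite addr_ge0 ?sqr_ge0.
have far : \sum_k ((y k \in J) != (x \in J))%:R * W k <= e1.
  apply: le_trans etad.
  have -> : (B - A) * (eta / dl ^+ 2) = \sum_(k < N) ((B - A) / N%:R * (eta / dl ^+ 2)).
    rewrite sumr_const card_ord -mulr_natr; field; rewrite gt_eqF //=.
    by rewrite gt_eqF.
  apply: ler_sum => k _; case: eqP => [_|/eqP hk]; rewrite ?mul0r ?mul1r.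
    by rewrite mulr_ge0 ?divr_ge0 ?(ltW BA) ?(ltW N0) ?(ltW eta0) // sqr_ge0.
  have dk : dl <= `|x - y k|.
    by rewrite leNgt; apply: contra hk => /hx ->.
  have /andP[P0 P1] := poisson_far eta0 d0 dk.
  have BN0 : 0 <= (B - A) / N%:R by rewrite divr_ge0 ?(ltW BA) ?(ltW N0).
  apply: ler_pM => //; first by rewrite divr_ge0 ?(ltW p0).
  rewrite ler_pdivrMr // ler_peMr //; lra.
have [xJ|xJ] := boolP (x \in J); last first.
  rewrite subr0 ger0_norm; last by apply: sumr_ge0 => k _; rewrite mulr_ge0.
  apply: le_trans (_ : e1 <= _); last by rewrite /e1; lra.
  by move: far; rewrite (negbTE xJ); under eq_bigr do rewrite eqbF_neg negbK.
have tot : `|\sum_k W k - 1| <= e1 * 3 / pi.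
  have -> : \sum_k W k - 1 =
      (\sum_(k < N) (B - A) / N%:R * poisson x (A + k%:R * ((B - A) / N%:R)) eta - pi) / pi.
    rewrite mulrBl mulfV ?gt_eqF // mulr_suml; congr (_ - _); apply: eq_bigr => k _.
    by rewrite /W [RHS]mulrAC.
  rewrite normrM normfV (gtr0_norm p0) ler_pM2r ?invr_gt0 // [e1 * 3]mulrC.
  apply: poisson_sum => //; last exact: hxJ.
    by move=> t ht; apply: hM; exact: le_trans ht.
  rewrite -ler_pdivrMl ?mulr_gt0 ?exprn_gt0 // mulrC; apply: ltW.
  by rewrite /N; apply: truncnS_gt.
have -> : \sum_k (y k \in J)%:R * W k - 1 =
    (\sum_k W k - 1) - \sum_k ((y k \in J) != true)%:R * W k.
  rewrite addrAC -sumrB; congr (_ - _); apply: eq_bigr => k _.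
  by rewrite eqb_id; case: (y k \in J); rewrite /= ?mul1r ?mul0r ?subr0 ?subrr.
apply: le_trans (ler_normB _ _) _.
move: far; rewrite xJ => far; rewrite [X in _ + X]ger0_norm; last first.
  by apply: sumr_ge0 => k _; rewrite mulr_ge0.
have : e1 * 3 / pi <= e1 * 3 / 2 by rewrite ler_pM2l ?mulr_gt0 // lef_pV2 ?posrE.
move: far tot; rewrite /e1; lra.
Qed.

Lemma poissonE (x y eta : R) : poisson x y eta = - Im ((y +i* eta) - x%:C)^-1.
Proof.
rewrite Im_inv mulNr opprK sqr_cabs /= subr0 /poisson.
by rewrite -[(x - y) ^+ 2]sqrrN opprB.
Qed.

End PoissonFilter.

(** * Unions of intervals *)

Section IntervalUnions.
Context {R : realType} (J : set R) (hJ : compact_union_of_intervals J).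
Local Notation C := R[i].
Local Notation T := (Cplx R).
Implicit Types (x y : R).

Lemma union_closed : closed J.
Proof. by apply: compact_closed; [exact: Rhausdorff|case: hJ]. Qed.

Lemma boundary_sub : boundary J `<=` J.
Proof. by move=> x []; rewrite -(closure_id J).1 //; exact: union_closed. Qed.

(** The intervals have positive length, so J has no isolated points. *)
Lemma boundary_closure_interior : boundary J `<=` closure (interior J).
Proof.
move=> x /boundary_sub; have [_ [s [hs hJs]]] := hJ; rewrite {1}hJs => -[I Is Ix].
have [u [v [uv Iu Iv]]] := hs _ Is.
have IJ : [set` I] `<=` J by move=> y Iy; rewrite hJs; exists I.
have convI := @interval_is_interval R I.
have inner y z w : y \in I -> z \in I -> y < w < z -> interior J w.
  move=> Iy Iz /andP[yw wz]; apply/nbhs_ballP; exists (Num.min (w - y) (z - w)).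
    by rewrite /= lt_min !subr_gt0 yw.
  move=> w'; rewrite /ball /= lt_min !ltr_norml => /andP[/andP[h1 h2] /andP[h3 h4]].
  by apply/IJ/(convI y z) => //; apply/andP; split; lra.
move=> B /nbhs_ballP[e /= e0 he]; have [xv|vx] := ltP x v.
  pose t := Num.min e (v - x); have t0 : 0 < t by rewrite lt_min e0 subr_gt0.
  have [te tv] : t <= e /\ t <= v - x by rewrite /t !ge_min !lexx orbT.
  exists (x + t / 2); split; first by apply: (inner x v) => //; apply/andP; split; lra.
  by apply: he; rewrite /ball /= ltr_norml; apply/andP; split; lra.
pose t := Num.min e (x - u); have t0 : 0 < t by rewrite lt_min e0 subr_gt0 (lt_le_trans uv).
have [te tv] : t <= e /\ t <= x - u by rewrite /t !ge_min !lexx orbT.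
exists (x - t / 2); split; first by apply: (inner u x) => //; apply/andP; split; lra.
by apply: he; rewrite /ball /= ltr_norml; apply/andP; split; lra.
Qed.

(** Without boundary points in S, the trace of J on S is both open and closed in S. *)
Lemma connected_sub (S : set R) x : connected S -> S x -> J x ->
  (forall y, S y -> ~ boundary J y) -> S `<=` J.
Proof.
move=> cS Sx Jx hS y Sy; have e : S `&` J = S `&` interior J.
  apply/seteqP; split=> z [Sz Jz]; split => //; last exact: interior_subset.
  apply: contrapT => nz; apply: (hS _ Sz); split => //; exact: subset_closure.
suff SJ : S `&` J = S by move: Sy; rewrite -SJ => -[].
apply: cS; first by exists x.
  by exists (interior J) => //; exact: open_interior.
by exists J => //; exact: union_closed.
Qed.

Lemma far_from_boundary x (dl : R) : (forall y, boundary J y -> dl <= `|x - y|) ->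
  forall y, `|x - y| < dl -> (y \in J) = (x \in J).
Proof.
move=> hx y hy; pose S : set R := `]x - dl, x + dl[%classic.
have Sb z : S z -> ~ boundary J z.
  rewrite /S /= in_itv /= => /andP[z1 z2] /hx; apply/negP; rewrite -ltNge ltr_norml; lra.
have cS : connected S by apply/connected_intervalP/interval_is_interval.
have Sx : S x.
  by rewrite /S /= in_itv /=; have := normr_ge0 (x - y); lra.
have Sy : S y.
  by rewrite /S /= in_itv /=; move: hy; rewrite ltr_norml; lra.
by apply/idP/idP; rewrite !inE => h; [exact: (connected_sub cS Sy)|exact: (connected_sub cS Sx)].
Qed.

Lemma union_bounds (b : R) : (forall x, J x -> b < x) ->
  exists a1 b1 : R, [/\ b < a1, a1 <= b1 & forall x, J x -> a1 <= x <= b1].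
Proof.
move=> hb; have [B [_ hB]] := compact_bounded hJ.1.
have nJ : (~` J) b by move=> /hb; rewrite ltxx.
have /nbhs_ballP[e /= e0 he] : nbhs b (~` J).
  exact: (open_nbhs_nbhs (conj (closed_openC union_closed) nJ)).
(* J is closed and misses b, hence a whole neighbourhood of b. The maximum gives a1 <= b1 even when
   J is empty. *)
exists (b + e), (Num.max (b + e) (`|B| + 1)); split.
- by rewrite ltrDl.
- by rewrite le_max lexx.
move=> x Jx; apply/andP; split.
  rewrite leNgt; apply/negP => xe; apply: (he x) => //.
  rewrite /ball /= distrC ger0_norm ?subr_ge0 ?(ltW (hb _ Jx)) //; lra.
rewrite le_max; apply/orP; right; apply: le_trans (ler_norm _) _.
by apply: hB => //; rewrite (le_lt_trans (ler_norm B)) // ltrDl.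
Qed.

Lemma lebesgue_number (W : set T) : open W -> (forall y, J y -> W y%:C) ->
  exists2 e : R, 0 < e & forall y z, J y -> cabs (z - y%:C) <= e -> W z.
Proof.
(* Compactness in near-covering form, against the filter of radii tending to 0 from the right. *)
move=> oW JW; have := (compact_near_coveringP J).1 hJ.1.
move=> /(_ R (0 : R)^'+ (fun e y => forall z, cabs (z - y%:C) <= e -> W z) _) [].
  move=> y Jy; have /cplx_nbhsP[e e0 he] := open_nbhs_nbhs (conj oW (JW y Jy)).
  pose A : set R := [set y' | `|y' - y| < e / 2]; pose B : set R := [set t | t < e / 2].
  exists (A, B).
    split; first by apply/nbhs_ballP; exists (e / 2); [rewrite /= divr_gt0|move=> y'; rewrite /ball /= /A /= distrC].
    by apply: nbhs_right_lt; rewrite divr_gt0.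
  move=> [y' t] [/= Ay Bt] z hz; apply: he.
  have -> : z - y%:C = (z - y'%:C) + (y' - y)%:C by rewrite rmorphB; ring.
  apply: le_lt_trans (ler_cabsD _ _) _; rewrite cabsR.
  by move: Ay Bt; rewrite /A /B /=; lra.
move=> e /= e0 he; exists (e / 2); first by rewrite divr_gt0.
move=> y z Jy; apply: he => //=; rewrite ?divr_gt0 //.
by rewrite sub0r normrN gtr0_norm ?divr_gt0 // ltr_pdivrMr //; lra.
Qed.

End IntervalUnions.

Section Region.
Context {R : realType} (J : set R) k (gam : 'I_k -> R -> Cplx R) (K : set (Cplx R)).
Context (hJ : compact_union_of_intervals J) (hgam : contour gam)
  (hOm : [set x : R | Omega_set gam x%:C] = interior J)
  (hK : Gamma_set gam `<=` interior K).

(** A boundary point of J is a limit of interior points, which lie in Omega, without lying in Omega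
    itself. *)
Lemma boundary_Gamma x : boundary J x -> Gamma_set gam x%:C.
Proof.
move=> hx; have : closure (Omega_set gam) x%:C.
  move=> B /cplx_nbhsP[e e0 he].
  have [y [Iy hy]] := boundary_closure_interior hJ hx (nbhsx_ballx x e e0).
  exists y%:C; split; first by move: Iy; rewrite -hOm.
  by apply: he; rewrite -rmorphB cabsR distrC.
case/(closure_Omega_sub hgam) => // hx'; case: hx => _ [].
by rewrite -hOm.
Qed.

(** The interior of J lies in Omega and its boundary in Gamma, hence in the interior of K: J is a
    compact subset of an open set, and a uniform margin exists. *)
Lemma region_margin : exists2 e : R, 0 < e & forall y (z : Cplx R),
  J y -> cabs (z - y%:C) <= e -> closure (Omega_set gam) z \/ K z.
Proof.
pose W := Omega_set gam `|` interior K.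
have oW : open W.
  by apply: openU; [exact: (Omega_open hgam)|exact: open_interior].
have [|e e0 he] := lebesgue_number hJ oW.
  move=> y Jy; have [Iy|nIy] := pselect (interior J y).
    by left; move: Iy; rewrite -hOm.
  by right; apply/hK/boundary_Gamma; split => //; exact: subset_closure.
exists e => // y z Jy /(he _ _ Jy) [h|h]; [left; exact: subset_closure|right].
exact: interior_subset.
Qed.

End Region.

(** * Deterministic estimates *)

Section InnerProductBounds.
Context {R : realType}.
Local Notation C := R[i].

(** Reduces an operator norm to scalar functions, to which the maximum principle applies. *)
Lemma opnorm_le_inner p q (A : 'M[C]_(p, q)) (s : R) : 0 <= s ->
  (forall x y, Re (inner x (A *m y)) <= s * (l2norm x * l2norm y)) -> opnorm A <= s.
Proof.
move=> s0 h; apply: opnorm_le => // x; have := h (A *m x) x.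
rewrite -sqr_l2norm /= expr2 mulrCA.
have [->|x0] := eqVneq (l2norm (A *m x)) 0; first by rewrite mulr_ge0 ?l2norm_ge0.
by rewrite ler_pM2l // lt_neqAle eq_sym x0 l2norm_ge0.
Qed.

Lemma inner_fcalc n (A : 'M[C]_n) f (v w : 'cV[C]_n) :
  inner v (fcalc A f *m w) =
  \sum_i ((spectralmx A *m v) i 0)^*%R * (spectralmx A *m w) i 0 * f (spec A i).
Proof.
have uS : spectralmx A \is unitarymx by exact: spectral_unitarymx.
rewrite /fcalc /diag_conj -!mulmxA inner_mulmx invmx_unitary // trmxCK innerE.
apply: eq_bigr => i _; rewrite mul_diag_mx !mxE -!mulrA; congr (_ * _).
by rewrite mulrC.
Qed.

End InnerProductBounds.

Section Realization.
Context {R : realType} (mu : probability (measurableTypeR R) R) (c : R).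
Local Notation T := (Cplx R).
Local Notation C := R[i].
Context (mu_neg : mu [set x | x < 0] = 0%E) (mu_cpt : compact (msupport mu))
  (c01 : 0 < c <= 1).
Local Notation b := (edge mu).
Local Notation p := (st (phi_state mu)).
Local Notation q := (st (phit_state mu c)).
Local Notation d := (dd (phi_state mu) (phit_state mu c)).

(** Every entry is at most (1 + Q)(1 + theta^2) times the inverse determinant, whence bounds
    independent of r and of the values theta. *)
Lemma Linv_bounds (z w : C) (e Q : R) r (th : 'rV[R]_r) : 0 < e -> 0 <= Q ->
  cabs z <= Q -> cabs w <= Q -> (forall i, 0 < th 0 i) ->
  (forall i, e * (1 + th 0 i ^+ 2) <= cabs (1 - (th 0 i ^+ 2)%:C * (z * w))) ->
  [/\ forall i, 1 - (th 0 i ^+ 2)%:C * (z * w) != 0,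
      opnorm (Linv z w th) <= 4 * ((1 + Q) / e) &
      opnorm (Kmx th *m Linv z w th) <= 4 * ((1 + Q) / e)].
Proof.
move=> e0 Q0 zQ wQ th0 he.
have t1 i : 0 < 1 + th 0 i ^+ 2 by rewrite ltr_pwDl ?sqr_ge0.
have h0 i : 0 < cabs (1 - (th 0 i ^+ 2)%:C * (z * w)).
  by apply: lt_le_trans (he i); rewrite mulr_gt0.
have u0 i : cabs (1 - (th 0 i ^+ 2)%:C * (z * w))^-1 <= (e * (1 + th 0 i ^+ 2))^-1.
  by rewrite cabsV lef_pV2 ?posrE ?mulr_gt0.
have hu i (x : R) : 0 <= x -> x <= (1 + Q) * (1 + th 0 i ^+ 2) ->
    x * cabs (1 - (th 0 i ^+ 2)%:C * (z * w))^-1 <= (1 + Q) / e.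
  move=> x0 hx; apply: le_trans (ler_pM x0 (cabs_ge0 _) hx (u0 i)) _.
  by rewrite invfM mulrACA mulfV ?mulr1 // gt_eqF.
have thle i : th 0 i <= 1 + th 0 i ^+ 2.
  have := sqr_ge0 (th 0 i - 1); have := ltW (th0 i); rewrite sqrrB mulr1 expr1n; lra.
have Q1 : 0 <= (1 + Q) / e by rewrite divr_ge0 ?addr_ge0 // ltW.
have x1 i : 1 <= (1 + Q) * (1 + th 0 i ^+ 2).
  by rewrite -[leLHS]mulr1 ler_pM // ?lerDl // sqr_ge0.
have x2 i : th 0 i <= (1 + Q) * (1 + th 0 i ^+ 2).
  by rewrite -[leLHS]mul1r ler_pM ?(ltW (th0 i)) // lerDl.
have x3 i y : cabs y <= Q -> cabs y * th 0 i <= (1 + Q) * (1 + th 0 i ^+ 2).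
  move=> yQ; rewrite ler_pM ?cabs_ge0 ?(ltW (th0 i)) //; lra.
have x4 i y : cabs y <= Q -> th 0 i ^+ 2 * cabs y <= (1 + Q) * (1 + th 0 i ^+ 2).
  move=> yQ; rewrite mulrC ler_pM ?cabs_ge0 ?sqr_ge0 // ?lerDr //; lra.
split; first by move=> i; rewrite -cabs_gt0.
- apply: opnorm_dblock_le => // i; split; rewrite ?cabsM ?[cabs (th 0 i)%:C]cabsR ?[`|th 0 i|]gtr0_norm //.
  + by rewrite -[leLHS]mul1r; exact: hu.
  + by apply: hu; [rewrite mulr_ge0 ?cabs_ge0 ?(ltW (th0 i))|exact: x3].
  + by apply: hu; [rewrite mulr_ge0 ?cabs_ge0 ?(ltW (th0 i))|exact: x3].
  + by rewrite -[leLHS]mul1r; exact: hu.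
- rewrite KmxLinv; apply: opnorm_dblock_le => // i.
  split; rewrite !cabsM cabsR.
  + rewrite ger0_norm ?sqr_ge0 //.
    by apply: hu; [rewrite mulr_ge0 ?cabs_ge0 ?sqr_ge0|exact: x4].
  + by rewrite gtr0_norm //; apply: hu; rewrite ?(ltW (th0 i)).
  + by rewrite gtr0_norm //; apply: hu; rewrite ?(ltW (th0 i)).
  + rewrite ger0_norm ?sqr_ge0 //.
    by apply: hu; [rewrite mulr_ge0 ?cabs_ge0 ?sqr_ge0|exact: x4].
Qed.

Lemma Mmx_st r z : off_cut mu z ->
  Mmx mu c r z = dblock (fun=> p z) (fun=> 0) (fun=> 0) (fun=> q z).
Proof. by move=> hz; rewrite Mmx_dblock phiE // phitE. Qed.

(** For fixed vectors the sesquilinear form of (G - M) K is a finite combination of kernels 1 / (z -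
    lambda), lambda an eigenvalue of the noise linearization, and of the two transforms, so it is
    holomorphic at every point of the closure. *)
Lemma compatibility_extension (Om : set T) n m r (X : 'M[C]_(n, m)) (U : 'M[C]_(n, r))
    (V : 'M[C]_(m, r)) (K : 'M[C]_(r + r)) (s : R) :
  open Om -> compact (closure Om) -> closure Om `<=` off_cut mu ->
  (forall z, closure Om z -> resolvent_defined X z) ->
  0 <= s ->
  (forall z, closure Om z -> ~ Om z -> opnorm ((Gmx X U V z - Mmx mu c r z) *m K) <= s) ->
  forall z, closure Om z -> opnorm ((Gmx X U V z - Mmx mu c r z) *m K) <= s.
Proof.
move=> oOm cOm hcut hres s0 hbd z hz; have [Oz|] := pselect (Om z); last exact: hbd.
apply: opnorm_le_inner => // x y; pose y' := K *m y.
pose A := lin X; have hA : A^t* = A by exact: lin_adj.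
pose a i := ((spectralmx A *m (Emx U V *m x)) i 0)^*%R * (spectralmx A *m (Emx U V *m y')) i 0.
pose a1 := inner x (block_mx 1%:M 0 0 0 *m y').
pose a2 := inner x (block_mx 0 0 0 1%:M *m y').
pose f (z : T) : C := \sum_i a i * (z - (spec A i)%:C)^-1 + ((- a1) * phi mu z + (- a2) * phit mu c z).
have fE w : closure Om w -> inner x (((Gmx X U V w - Mmx mu c r w) *m K) *m y) = f w.
  move=> hw; have hs := unit_spec hA (hres w hw).
  rewrite -mulmxA -/y' mulmxBl innerDr.
  rewrite /Gmx resolventE // -(mulmxA _ _ y') -(mulmxA _ (fcalc _ _)) inner_mulmx trmxCK.
  rewrite inner_fcalc /f; congr (_ + _).
  have -> : Mmx mu c r w *m y' = phi mu w *: (block_mx 1%:M 0 0 0 *m y')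
      + phit mu c w *: (block_mx 0 0 0 1%:M *m y').
    rewrite !scalemxAl -mulmxDl; congr (_ *m _).
    by rewrite /Mmx !scale_block_mx add_block_mx !scaler0 !addr0 !add0r !scalemx1.
  by rewrite -scaleN1r innerZr innerDr !innerZr -/a1 -/a2; ring.
rewrite fE //; apply: (maximum_principle oOm cOm) => // w hw; last first.
  move=> nw; rewrite -fE //; apply: le_trans (Re_le _) _.
  apply: le_trans (CauchySchwarz_inner _ _) _; rewrite mulrCA.
  apply: ler_wpM2l; first exact: l2norm_ge0.
  apply: le_trans (opnormP _ _) _; apply: ler_wpM2r; first exact: l2norm_ge0.
  exact: hbd.
apply: holo_atD; last by apply: holo_atD; apply: holo_atZ; [apply: holo_at_phi|apply: holo_at_phit]; auto.
apply: holo_at_sum => i; apply: holo_atZ.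
by apply: holo_at_kernel (lexx _); rewrite cabs_gt0 subr_eq0 (unit_spec hA (hres w hw)).
Qed.

End Realization.

(** * Imaginary parts of matrices and the filtered limit entries *)

Section SkewPart.
Context {R : realType}.
Local Notation C := R[i].

(** Minus the imaginary part of a matrix. On a compressed resolvent at y + i eta it gives the
    compressed Poisson kernel, which is positive. *)
Definition skew p (D : 'M[C]_p) : 'M[C]_p := (2 * 'i)^-1 *: (D^t* - D).

Lemma skewE (w : C) : (2 * 'i)^-1 * ((w^*)%R - w) = (- Im w)%:C.
Proof.
have i0 : (2 * 'i : C) != 0 by rewrite mulf_neq0 ?pnatr_eq0 // neq0Ci.
apply: (mulfI i0); rewrite mulVKf //; case: w => x y.
by apply/eqP; rewrite eq_complex /=; apply/andP; split; apply/eqP; ring.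
Qed.

Lemma opnorm_skew_le p (D : 'M[C]_p) : opnorm (skew D) <= opnorm D.
Proof.
have c2 : cabs (2 * 'i : C)^-1 = 2^-1.
  rewrite cabsV cabsM; have -> : cabs ('i : C) = 1.
    by rewrite cabsE /= expr0n expr1n add0r sqrtr1.
  have -> : (2 : C) = (2 : R)%:C by rewrite rmorph_nat.
  by rewrite cabsR mulr1 ger0_norm.
apply: le_trans (opnormZ_le _ _) _; rewrite c2 ler_pdivrMl //.
apply: le_trans (ler_opnormD _ _) _; rewrite opnormN mulr_natl mulr2n lerD2r.
exact: opnorm_adj.
Qed.

Lemma skewB p (D D' : 'M[C]_p) : skew D - skew D' = skew (D - D').
Proof.
rewrite /skew -scalerBr; congr (_ *: _).
have -> : (D - D')^t* = D^t* - D'^t* by apply/matrixP => i j; rewrite !mxE raddfB.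
by rewrite !opprD !opprK addrACA.
Qed.

Lemma skew_fcalc N k (A : 'M[C]_N) (E : 'M[C]_(N, k)) f :
  skew (E^t* *m fcalc A f *m E) = E^t* *m fcalc A (fun x => (- Im (f x))%:C) *m E.
Proof.
rewrite /skew adjmx_mul adjmx_mul trmxCK fcalc_adj mulmxA -mulmxBl -mulmxBr fcalcB.
have -> : fcalc A (fun x => (- Im (f x))%:C) = (2 * 'i)^-1 *: fcalc A (fun x => (f x)^*%R - f x).
  by rewrite fcalcZ; apply: eq_fcalc => i; rewrite skewE.
by rewrite -scalemxAr -scalemxAl.
Qed.

Lemma skew_dblock r (a b d : 'I_r -> C) :
  skew (dblock a b b d) =
  dblock (fun i => (- Im (a i))%:C) (fun i => (- Im (b i))%:C) (fun i => (- Im (b i))%:C)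
    (fun i => (- Im (d i))%:C).
Proof.
have adj : (dblock a b b d)^t* = dblock (fun i => (a i)^*)%R (fun i => (b i)^*)%R
    (fun i => (b i)^*)%R (fun i => (d i)^*)%R.
  rewrite /dblock tr_block_mx map_block_mx !tr_diag_mx !map_diag_mx.
  by congr block_mx; apply: (congr1 (@diag_mx _ _)); apply/rowP => i; rewrite !mxE.
by rewrite /skew adj dblockB dblockZ; apply: eq_dblock => i; rewrite skewE.
Qed.

Lemma subr_telescope (W : zmodType) (x y y' z t w : W) : y = y' -> w = y' - z ->
  x - t = (x - y) + (w + (z - t)).
Proof. by move=> <- ->; rewrite [y - z + _]addrA subrK addrA subrK. Qed.

Lemma compressB N k (E : 'M[C]_(N, k)) (A B : 'M[C]_N) :
  E^t* *m (A - B) *m E = E^t* *m A *m E - E^t* *m B *m E.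
Proof. by rewrite mulmxBr mulmxBl. Qed.

Lemma error_budget (x k l e1 e2 e : R) : (1 + 4 * k) * e1 = e / 3 ->
  12 * (x + 1) * e2 = e -> l <= x * e2 -> 0 <= e2 -> e1 + (e / 3 + 4 * (l + k * e1)) <= e.
Proof. lra. Qed.

(** For real t the off-diagonal entry t D u and t^-1 u have the same imaginary part; the second form
    is the one estimated near and off the poles. *)
Lemma shift_inverse (t D : C) : t != 0 -> 1 - t ^+ 2 * D != 0 ->
  t * D * (1 - t ^+ 2 * D)^-1 = t^-1 * (1 - t ^+ 2 * D)^-1 - t^-1.
Proof.
move=> t0 D0; apply: (mulIf D0); rewrite mulrBl !mulfVK //.
by rewrite mulrBr mulr1 opprB addrC subrK expr2 -[t * t * D]mulrA mulKf.
Qed.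

(* a is an entry of the limit, with residue kap * ind at its real pole. *)
Lemma filtered_pole (N : nat) (g : 'I_N -> bool) (w kap KE KK e : R) (ind : bool)
    (a pole : 'I_N -> R) :
  0 <= w -> 0 <= KE -> `|kap * ind%:R| <= KK ->
  (forall k, g k -> `|a k - kap * ind%:R * - pole k| <= KE) ->
  `|\sum_k (g k)%:R * (w * pole k) - ind%:R| <= e ->
  `|\sum_k (g k)%:R * w * - a k - kap * ind%:R| <= N%:R * w * KE + KK * e.
Proof.
move=> w0 KE0 hk ha hF.
have -> : \sum_k (g k)%:R * w * - a k - kap * ind%:R =
  \sum_k (g k)%:R * w * - (a k - kap * ind%:R * - pole k) +
  kap * ind%:R * (\sum_k (g k)%:R * (w * pole k) - ind%:R).
  rewrite mulrBr mulr_sumr addrA -big_split /=; congr (_ - _).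
    by apply: eq_bigr => k _; ring.
  by case: (ind); rewrite ?mulr1 ?mulr0.
apply: le_trans (ler_normD _ _) (lerD _ _); last by rewrite normrM ler_pM.
apply: le_trans (ler_norm_sum _ _ _) _.
have -> : N%:R * w * KE = \sum_(k < N) w * KE by rewrite sumr_const card_ord -[RHS]mulr_natl mulrA.
apply: ler_sum => k _; rewrite !normrM normrN (ger0_norm w0).
case gk : (g k); last by rewrite normr0 !mul0r mulr_ge0.
by rewrite normr1 mul1r ler_wpM2l // ha.
Qed.

End SkewPart.

(** * Uniform consequences of the local laws for one realization *)

Section RegularRealizations.
Context {R : realType} (mu : probability (measurableTypeR R) R) (c : R).
Local Notation T := (Cplx R).
Local Notation C := R[i].
Context (mu_neg : mu [set x | x < 0] = 0%E) (mu_cpt : compact (msupport mu))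
  (c01 : 0 < c <= 1) (hedge : edge_condition mu c).
Local Notation b := (edge mu).
Local Notation p := (st (phi_state mu)).
Local Notation q := (st (phit_state mu c)).
Local Notation d := (dd (phi_state mu) (phit_state mu c)).
Context (J : set R) (Rg : set T) (a1 b1 eta0 dl : R).
Context (hJ : compact_union_of_intervals J) (hab : forall x, J x -> a1 <= x <= b1)
  (ha : b < a1) (hab1 : a1 <= b1) (eta00 : 0 < eta0) (dl0 : 0 < dl)
  (hRg : Rg `<=` off_cut mu)
  (hmargin : forall y z, J y -> cabs (z - y%:C) <= eta0 -> Rg z).

(** What remains of a realization once randomness is removed. The single tolerance s bounds the
    excess of the noise norm and both errors on the region [Rg]; dl is the separation of the
    locations from the boundary of J. *)
Record regular (s : R) n m r (X P : 'M[C]_(n, m)) (U : 'M[C]_(n, r)) (V : 'M[C]_(m, r))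
    (th : 'rV[R]_r) : Prop := Regular {
  reg_U : stiefel U;
  reg_V : stiefel V;
  reg_th : forall i, 0 < th 0 i;
  reg_P : P = U *m re_mx (diag_mx th) *m V^t*;
  reg_tol : 0 <= s;
  reg_norm : opnorm X <= b + s;
  reg_local : forall z, Rg z ->
    [/\ resolvent_defined X z, opnorm (Gmx X U V z - Mmx mu c r z) <= s &
        opnorm ((Gmx X U V z - Mmx mu c r z) *m Kmx th) <= s];
  reg_sep : forall i y, boundary J y -> dl <= `|rho mu c (th 0 i) - y|
}.

Let b0 := edge_ge0 mu.
Let hp := phi_stateP mu_neg mu_cpt.
Let hq := phit_stateP mu_neg mu_cpt c01.

Lemma regular_Linv (z : C) (e Q : R) r (th : 'rV[R]_r) : off_cut mu z -> 0 < e -> 0 <= Q ->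
  cabs (p z) <= Q -> cabs (q z) <= Q -> (forall i, 0 < th 0 i) ->
  (forall i, e * (1 + th 0 i ^+ 2) <= cabs (1 - (th 0 i ^+ 2)%:C * d z)) ->
  [/\ Linv (p z) (q z) th *m (1%:M - Mmx mu c r z *m Kmx th) = 1%:M,
      opnorm (Linv (p z) (q z) th) <= 4 * ((1 + Q) / e) &
      opnorm (Kmx th *m Linv (p z) (q z) th) <= 4 * ((1 + Q) / e)].
Proof.
move=> hz e0 Q0 pQ qQ th0 he; have [h1 h2 h3] := Linv_bounds e0 Q0 pQ qQ th0 he.
by split => //; rewrite Mmx_st // LinvK.
Qed.

(** An eigenvalue close to the boundary of J would lie in [Rg] and stay dl / 2 away from all
    locations; there 1 - M K has a bounded inverse, and [no_eigenvector] excludes it. *)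
Lemma spectrum_far : exists s1 d1 : R, [/\ 0 < s1, 0 < d1 &
  forall s n m r X P U V th, s <= s1 -> @regular s n m r X P U V th ->
  forall i y, boundary J y -> d1 <= `|spec (lin (X + P)) i - y|].
Proof.
have ha' := ha; have hab1' := hab1.
pose a2 := (a1 + b) / 2; have ha2 : b < a2 by rewrite /a2; lra.
have hab2 : a2 <= b1 + 1 by rewrite /a2; lra.
have dl2 : 0 < dl / 2 by rewrite divr_gt0.
have [e e0 he] := location_lower mu_neg mu_cpt c01 hedge ha2 hab2 dl2.
have [Q Q0 hQ] := strip_near_real hp hq ha2.
pose Lb := 4 * ((1 + Q) / e).
have Lb0 : 0 <= Lb by rewrite mulr_ge0 // divr_ge0 ?addr_ge0 // ltW.
have Lb1 : 0 < Lb + 1 by rewrite ltr_wpDl.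
(* In order: separation from the locations, membership in [Rg], and the bounds a2 <= x <= b1 + 1.
   The tolerance (Lb + 1)^-1 makes Lb s < 1. *)
pose d1 := Num.min (dl / 2) (Num.min eta0 (Num.min ((a1 - b) / 2) 1)).
exists (Lb + 1)^-1, d1; split.
- by rewrite invr_gt0.
- by rewrite !lt_min dl2 eta00 ltr01 divr_gt0 // subr_gt0.
move=> s n m r X P U V th hs reg i y hy; rewrite leNgt; apply/negP => hi.
set x := spec _ i in hi.
move: hi; rewrite !lt_min => /and4P[x1 x2 x3 x4].
have [y1 y2] : a1 <= y /\ y <= b1.
  by have /andP := hab (boundary_sub hJ hy).
have hx : a2 <= x <= b1 + 1.
  by move: x3 x4; rewrite !ltr_norml /a2; lra.
have hax : a2 <= x by case/andP: hx.
have Rx : Rg x%:C.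
  by apply: (hmargin (boundary_sub hJ hy)); rewrite -rmorphB cabsR ltW.
have [rX _ GK] := reg_local reg Rx.
have [[hp1 hq1] _ _ _ _] := hQ x x 0 hax hax (lexx 0).
have [pQ qQ] : cabs (p x%:C) <= Q /\ cabs (q x%:C) <= Q.
  by have [_ _ h1 _ _] := hp1; have [_ _ h2 _ _] := hq1.
have sep j : dl / 2 <= `|rho mu c (th 0 j) - x|.
  have := reg_sep reg j hy; have := ler_distD x (rho mu c (th 0 j)) y.
  by move: x1; lra.
have [L1 L2 L3] := regular_Linv (hRg Rx) e0 Q0 pQ qQ (reg_th reg)
  (fun j => he _ _ hx (reg_th reg j) (sep j)).
have [v v0 hv] := spec_eigenvector (lin_adj (X + P)) i.
have hA : lin (X + P) = lin X + Emx U V *m Kmx th *m (Emx U V)^t*.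
  by rewrite (reg_P reg) lin_perturb.
move/eqP: v0; apply; apply: (no_eigenvector hA rX L1 L2 GK _ hv).
apply: le_lt_trans (_ : Lb * (Lb + 1)^-1 < 1); first by rewrite ler_wpM2l.
by rewrite ltr_pdivrMr // mul1r ltrDl.
Qed.

Definition compressed n m r (X P : 'M[C]_(n, m)) (U : 'M[C]_(n, r)) (V : 'M[C]_(m, r)) z :=
  (Emx U V)^t* *m invmx (z%:M - lin (X + P)) *m Emx U V.

Definition limit_compressed r (th : 'rV[R]_r) z : 'M[C]_(r + r) :=
  let u i := (1 - (th 0 i ^+ 2)%:C * d z)^-1 in
  dblock (fun i => p z * u i) (fun i => (th 0 i)%:C * d z * u i)
    (fun i => (th 0 i)%:C * d z * u i) (fun i => q z * u i).

Lemma node_constants (z : C) : Im z != 0 -> exists2 L : R, 0 <= L &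
  forall s n m r X P U V th, @regular s n m r X P U V th ->
  [/\ Linv (p z) (q z) th *m (1%:M - Mmx mu c r z *m Kmx th) = 1%:M,
      opnorm (Linv (p z) (q z) th) <= L &
      opnorm (Kmx th *m Linv (p z) (q z) th) <= L].
Proof.
move=> z0; have [e e0 he] := dd_nonreal_lower hp hq b0 z0.
pose Q := cabs (p z) + cabs (q z).
have Q0 : 0 <= Q by rewrite addr_ge0 ?cabs_ge0.
have Q1 : 0 <= 1 + Q by rewrite addr_ge0.
exists (4 * ((1 + Q) / e)); first by rewrite mulr_ge0 // divr_ge0 // ltW.
move=> s n m r X P U V th reg; apply: regular_Linv => //.
- exact: off_cut_nonreal.
- by rewrite lerDl cabs_ge0.
- by rewrite lerDr cabs_ge0.
- exact: reg_th reg.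
- by move=> i; apply: he; rewrite sqr_ge0.
Qed.

Lemma compressed_close (z : C) : Im z != 0 -> Rg z -> exists2 L : R, 0 <= L &
  forall s n m r X P U V th, @regular s n m r X P U V th ->
  opnorm (compressed X P U V z - limit_compressed th z) <= L * s.
Proof.
move=> z0 Rz; have [L L0 hL] := node_constants z0.
exists (L * (1 + `|Im z|^-1)); first by rewrite mulr_ge0 // addr_ge0 // invr_ge0.
move=> s n m r X P U V th reg; have [L1 L2 L3] := hL _ _ _ _ _ _ _ _ _ reg.
have [rX G1 G2] := reg_local reg Rz.
have hA : lin (X + P) = lin X + Emx U V *m Kmx th *m (Emx U V)^t*.
  by rewrite (reg_P reg) lin_perturb.
have uA : z%:M - lin (X + P) \in unitmx.
  by apply: resolvent_unit (lin_adj _) _ _; exact: nonreal_spec.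
have hE := stiefel_Emx (reg_U reg) (reg_V reg).
have -> : limit_compressed th z = Linv (p z) (q z) th *m Mmx mu c r z.
  by rewrite Mmx_st ?LinvM //; exact: hRg.
rewrite -mulrA mulrDl mul1r [_^-1 * s]mulrC.
apply: (opnorm_compress_resolvent_sub hA uA rX L1 L2 G1 G2).
apply: le_trans (opnorm_submx_le _ hE hE) _.
exact: (opnorm_resolvent_le (lin_adj _) z0).
Qed.

(** Combines a bound on K E^* Q, obtained from one resolvent at height eta0 above a point of J, with
    the gap between J and the noise spectrum. *)
Lemma compressed_lower : exists s1 c0 : R, [/\ 0 < s1, 0 < c0 &
  forall s n m r X P U V th, s <= s1 -> @regular s n m r X P U V th ->
  forall v : 'cV[C]_(n + m), spectral_proj (lin (X + P)) J *m v = v ->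
  c0 * l2norm v <= l2norm ((Emx U V)^t* *m v)].
Proof.
have ha' := ha; have hab1' := hab1; have eta' := eta00.
(* For empty J the projector vanishes and so does v. *)
have [[y0 Jy0]|nJ] := pselect (exists y, J y); last first.
  exists 1, 1; split => // s n m r X P U V th hs reg v.
  rewrite spectral_proj_fcalc (eq_fcalc (g := fun=> 0)).
    rewrite fcalc_cst -scalemx1 scale0r mul0mx => <-.
    by rewrite mulmx0 !l2norm0 mulr0.
  by move=> i; rewrite memNset // => Ji; apply: nJ; exists (spec (lin (X + P)) i).
pose z : C := y0 +i* eta0.
have z0 : Im z != 0 by rewrite /= gt_eqF.
have Rz : Rg z.
  apply: (hmargin Jy0); rewrite cabsE /= subrr expr0n add0r subr0 sqrtr_sqr.
  by rewrite gtr0_norm.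
have [L L0 hL] := node_constants z0.
pose D := (b1 - a1) + eta0.
have D0 : 0 <= D by rewrite /D; lra.
pose ck := L * (eta0^-1 + eta0^-1) * D.
have ck0 : 0 <= ck.
  by rewrite mulr_ge0 // mulr_ge0 // addr_ge0 // invr_ge0 ltW.
have ck1 : 0 < ck + 1 by rewrite ltr_wpDl.
(* Half of the gap is left to the tolerance s on the noise norm, half to the lower bound. *)
pose g := (a1 - b) / 2; have g0 : 0 < g by rewrite divr_gt0 // subr_gt0.
exists (Num.min 1 g), (g / (ck + 1)); split.
- by rewrite lt_min ltr01.
- by rewrite divr_gt0.
move=> s n m r X P U V th; rewrite le_min => /andP[s1 sg] reg v Qv.
have [L1 L2 L3] := hL _ _ _ _ _ _ _ _ _ reg.
have [rX G1 G2] := reg_local reg Rz.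
have hA : lin (X + P) = lin X + Emx U V *m Kmx th *m (Emx U V)^t*.
  by rewrite (reg_P reg) lin_perturb.
have uA : z%:M - lin (X + P) \in unitmx.
  by apply: resolvent_unit (lin_adj _) _ _; exact: nonreal_spec.
have hE := stiefel_Emx (reg_U reg) (reg_V reg).
have KR : opnorm (Kmx th *m ((Emx U V)^t* *m invmx (z%:M - lin (X + P)))) <=
    L * (eta0^-1 + s * eta0^-1).
  have ie : eta0^-1 = `|Im z|^-1 by rewrite /= gtr0_norm.
  rewrite ie; apply: (opnorm_K_adj_resolvent hA uA rX L1 hE L3 G2).
    exact: (opnorm_resolvent_le (lin_adj _) z0).
  exact: (opnorm_resolvent_le (lin_adj _) z0).
have KQ : opnorm (Kmx th *m ((Emx U V)^t* *m spectral_proj (lin (X + P)) J)) <= ck.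
  apply: (opnorm_K_adj_proj (lin_adj _) (nonreal_spec _ z0) D0).
    apply: le_trans KR _; apply: ler_wpM2l => //; rewrite lerD2l ler_piMl //.
    by rewrite invr_ge0 ltW.
  move=> x Jx; apply: le_trans (cabs_le_ReIm _) _.
  rewrite /= subr0 (gtr0_norm eta') /D lerD2r ler_norml.
  have /andP[x1 x2] := hab Jx; have /andP[y1 y2] := hab Jy0.
  by apply/andP; split; [rewrite lerNl opprB; exact: lerB|exact: lerB].
have nX : opnorm (lin X) <= b + g.
  by apply: le_trans (opnorm_lin_le _) _; apply: le_trans (reg_norm reg) _; rewrite lerD2l.
have Ja x : J x -> a1 <= x by move=> /hab /andP[].
have := compress_lower_bound (lin_adj _) hA Ja nX KQ Qv.
have -> : a1 - (b + g) = g by rewrite /g; field.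
move=> h; rewrite mulrAC ler_pdivrMr // mulrC mulrC; apply: le_trans h _.
by rewrite mulrC ler_wpM2l ?l2norm_ge0 // lerDl.
Qed.

Definition limit_proj r (th : 'rV[R]_r) : 'M[C]_(r + r) :=
  let w f i := (f (th 0 i) / 2 * (rho mu c (th 0 i) \in J)%:R)%:C in
  dblock (w (kappaL mu c)) (w (kappaLR mu c)) (w (kappaLR mu c)) (w (kappaR mu c)).

(** Three errors: the filter against the indicator of J on the spectrum of A ([S1]), H against H0 at
    the nodes ([S3]), and the filter against the indicator on the poles of H0 ([S4]). *)
Lemma proj_close e : 0 < e -> exists2 s1 : R, 0 < s1 &
  forall s n m r X P U V th, s <= s1 -> @regular s n m r X P U V th ->
  opnorm ((Emx U V)^t* *m spectral_proj (lin (X + P)) J *m Emx U V - limit_proj th) <= e.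
Proof.
move=> e0; have ha' := ha; have hab1' := hab1.
have [s0 [d1 [s00 d10 hspec]]] := spectrum_far.
have [KK [kmin [KK0 _ hKK]]] := kappa_bounds mu_neg mu_cpt c01 hedge ha hab1.
have [KE [h1 [KE0 h10 hKE]]] := entries_near mu_neg mu_cpt c01 hedge ha hab1 dl0.
pose A0 := a1 - 1; pose B0 := b1 + 1; pose BA := B0 - A0.
have AB0 : A0 < B0 by rewrite /A0 /B0; lra.
have BA0 : 0 < BA by rewrite subr_gt0.
(* [e1] is the precision of the filter, used once on the spectrum and, with weight 4 KK, on the
   poles; [e2] caps eta, so that the O(eta) remainders of the four blocks sum to at most e / 3. *)
pose e1 := e / (3 * (1 + 4 * KK)); pose e2 := e / (12 * (BA * KE + 1)).
have k1 : 0 < 1 + 4 * KK by rewrite ltr_pwDl // mulr_ge0.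
have k2 : 0 < BA * KE + 1 by rewrite ltr_wpDl // mulr_ge0 // ltW.
have e10 : 0 < e1 by rewrite divr_gt0 // mulr_gt0.
have e20 : 0 < e2 by rewrite divr_gt0 // mulr_gt0.
pose eta1 := Num.min eta0 (Num.min h1 e2).
have eta10 : 0 < eta1 by rewrite !lt_min eta00 h10.
have dl10 : 0 < Num.min dl d1 by rewrite lt_min dl0.
have [eta [N [/andP[etap etal] N0 hF]]] := poisson_filter AB0 dl10 e10 eta10.
move: etal; rewrite !le_min => /and3P[eta_0 eta_h eta_2].
pose y (k : 'I_N) : R := A0 + k%:R * ((B0 - A0) / N%:R).
pose z (k : 'I_N) : C := y k +i* eta.
have z0 k : Im (z k) != 0 by rewrite /= gt_eqF.
have Rz k : y k \in J -> Rg (z k).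
  rewrite inE => Jy; apply: (hmargin Jy).
  by rewrite cabsE /= subrr expr0n add0r subr0 sqrtr_sqr gtr0_norm.
(* Only nodes in J carry a nonzero coefficient, and only these are known to lie in [Rg]; the others
   get the constant 0. *)
have hl k : exists l, 0 <= l /\ (y k \in J ->
    forall s n m r X P U V th, @regular s n m r X P U V th ->
    opnorm (compressed X P U V (z k) - limit_compressed th (z k)) <= l * s).
  have [/Rz Rzk|] := boolP (y k \in J); last by exists 0.
  by have [l l0 hl] := compressed_close (z0 k) Rzk; exists l.
have [L hL] := boolp.choice hl.
pose LS := \sum_k L k.
have LS0 : 0 <= LS by apply: sumr_ge0 => k _; have [] := hL k.
have k3 : 0 < BA * LS + 1 by rewrite ltr_wpDl // mulr_ge0 // ltW.
(* The nodes are fixed by now, so the sum [LS] of their constants is a number and the local law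
   error is at most e / 3. *)
exists (Num.min s0 (e / (3 * (BA * LS + 1)))).
  by rewrite lt_min s00 divr_gt0 // mulr_gt0.
move=> s n m r X P U V th; rewrite le_min => /andP[ss0 ss1] reg.
have hE := stiefel_Emx (reg_U reg) (reg_V reg).
have p0 := @pi_gt0 R; have p2 := @pi_ge2 R.
pose w := (B0 - A0) / N%:R / pi.
have N0' : 0 < N%:R :> R by rewrite ltr0n.
have w0 : 0 <= w by rewrite !divr_ge0 // ltW.
have wBA : N%:R * w <= BA.
  rewrite /w -/BA mulrA mulrCA mulfV ?gt_eqF // mulr1 ler_pdivrMr // ler_peMr ?(ltW BA0) //; lra.
have w_BA : w <= BA by apply: le_trans wBA; rewrite ler_peMl // ler1n.
pose A := lin (X + P); pose g k := y k \in J.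
pose Fr x := \sum_k (g k)%:R * (w * poisson x (y k) eta).
have hFr x : (forall t, boundary J t -> Num.min dl d1 <= `|x - t|) ->
    `|Fr x - (x \in J)%:R| <= e1.
  move=> hx; apply: hF; first exact: (far_from_boundary hJ hx).
  by rewrite inE /A0 /B0 => /hab; rewrite subrK addrK.
pose c_ k : C := ((g k)%:R * w)%:C.
have S1 : opnorm ((Emx U V)^t* *m (spectral_proj A J - fcalc A (fun x => (Fr x)%:C)) *m Emx U V) <= e1.
  apply: le_trans (opnorm_submx_le _ hE hE) _; rewrite spectral_proj_fcalc fcalcB.
  apply: opnorm_fcalc_le => [|i]; first exact: ltW.
  rewrite -(rmorph_nat (real_complex R)) -rmorphB cabsR distrC; apply: hFr => t ht.
  by rewrite ge_min (hspec _ _ _ _ _ _ _ _ _ ss0 reg i t ht) orbT.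
have S2 : (Emx U V)^t* *m fcalc A (fun x => (Fr x)%:C) *m Emx U V =
    \sum_k c_ k *: skew (compressed X P U V (z k)).
  have -> : fcalc A (fun x => (Fr x)%:C) =
      \sum_k c_ k *: fcalc A (fun x => (- Im ((z k - x%:C)^-1))%:C).
    under [RHS]eq_bigr do rewrite fcalcZ.
    rewrite fcalc_sum; apply: eq_fcalc => i; rewrite rmorph_sum.
    by apply: eq_bigr => k _; rewrite /c_ -rmorphM -poissonE mulrA.
  rewrite mulmx_sumr mulmx_suml; apply: eq_bigr => k _.
  rewrite -scalemxAr -scalemxAl; congr (_ *: _).
  rewrite /compressed (resolventE (lin_adj _) (nonreal_spec _ (z0 k))).
  by rewrite skew_fcalc.
have S3 : opnorm (\sum_k c_ k *: (skew (compressed X P U V (z k)) - skew (limit_compressed th (z k))))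
    <= e / 3.
  apply: le_trans (ler_opnorm_sum _ _ _) _.
  apply: le_trans (_ : \sum_k BA * (L k * s) <= _).
    apply: ler_sum => k _; apply: le_trans (opnormZ_le _ _) _.
    have [Lk hk] := hL k; rewrite /c_ cabsR /g.
    have Ls0 : 0 <= L k * s by rewrite mulr_ge0 // (reg_tol reg).
    have [yJ|yJ] := boolP (y k \in J); last by rewrite mul0r normr0 mul0r mulr_ge0 // ltW.
    rewrite mul1r ger0_norm // skewB; apply: ler_pM => //; first exact: opnorm_ge0.
    by apply: le_trans (opnorm_skew_le _) _; exact: hk.
  rewrite -mulr_sumr -mulr_suml -/LS mulrA.
  apply: le_trans (_ : (BA * LS + 1) * (e / (3 * (BA * LS + 1))) <= _).
    apply: ler_pM => //; [by rewrite mulr_ge0 // ltW|exact: reg_tol reg|by rewrite lerDl].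
  by rewrite le_eqVlt; apply/orP; left; apply/eqP; field; rewrite gt_eqF.
pose ind i := rho mu c (th 0 i) \in J.
have entry (kap : R) (a : 'I_N -> C) i : `|kap * (ind i)%:R| <= KK ->
    (forall k, g k ->
      `|Im (a k) - kap * (ind i)%:R * Im (z k - (rho mu c (th 0 i))%:C)^-1| <= KE * eta) ->
    cabs (\sum_k c_ k * (- Im (a k))%:C - (kap * (ind i)%:R)%:C) <= BA * (KE * eta) + KK * e1.
  move=> hkap ha_.
  have -> : \sum_k c_ k * (- Im (a k))%:C - (kap * (ind i)%:R)%:C =
      (\sum_k (g k)%:R * w * - Im (a k) - kap * (ind i)%:R)%:C.
    by rewrite rmorphB rmorph_sum; congr (_ - _); apply: eq_bigr => k _; rewrite rmorphM.
  rewrite cabsR.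
  have KEe : 0 <= KE * eta by rewrite mulr_ge0 // ltW.
  apply: le_trans (filtered_pole (pole := fun k => poisson (rho mu c (th 0 i)) (y k) eta)
    w0 KEe hkap _ (hFr _ _)) _.
  - by move=> k gk; rewrite poissonE opprK; exact: ha_.
  - by move=> t ht; rewrite ge_min (reg_sep reg i ht).
  by rewrite lerD2r ler_wpM2r.
have kap_le (f : R -> R) i : (a1 <= rho mu c (th 0 i) <= b1 -> `|f (th 0 i) / 2| <= KK) ->
    `|f (th 0 i) / 2 * (ind i)%:R| <= KK.
  rewrite /ind; have [|_] := boolP (_ \in J); last by rewrite mulr0 normr0.
  by rewrite inE mulr1 => /hab h; apply.
have S4 : opnorm (\sum_k c_ k *: skew (limit_compressed th (z k)) - limit_proj th)
    <= 4 * (BA * (KE * eta) + KK * e1).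
  pose u k i := (1 - (th 0 i ^+ 2)%:C * d (z k))^-1.
  have -> : \sum_k c_ k *: skew (limit_compressed th (z k)) =
    dblock (fun i => \sum_k c_ k * (- Im (p (z k) * u k i))%:C)
      (fun i => \sum_k c_ k * (- Im ((th 0 i)^-1%:C * u k i))%:C)
      (fun i => \sum_k c_ k * (- Im ((th 0 i)^-1%:C * u k i))%:C)
      (fun i => \sum_k c_ k * (- Im (q (z k) * u k i))%:C).
    rewrite -dblock_sum; apply: eq_bigr => k _; rewrite /limit_compressed skew_dblock dblockZ.
    have off i : Im ((th 0 i)%:C * d (z k) * u k i) = Im ((th 0 i)^-1%:C * u k i).
      have [e3 e30 he3] := dd_nonreal_lower hp hq b0 (z0 k).
      have D0 : 1 - (th 0 i ^+ 2)%:C * d (z k) != 0.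
        rewrite -cabs_gt0; apply: lt_le_trans (he3 _ (sqr_ge0 (th 0 i))).
        by rewrite mulr_gt0 // ltr_pwDl ?sqr_ge0.
      have t0 : (th 0 i)%:C != 0 by rewrite fmorph_eq0 gt_eqF // (reg_th reg).
      have -> : (th 0 i)%:C * d (z k) * u k i = (th 0 i)^-1%:C * u k i - (th 0 i)^-1%:C.
        rewrite /u; move: D0; rewrite rmorphXn /= => D0.
        have -> : (th 0 i)^-1%:C = (th 0 i)%:C^-1 by rewrite fmorphV.
        exact: shift_inverse.
      by rewrite ImD ImN /= subr0.
    by apply: eq_dblock => i //; rewrite off.
  have near k i : g k ->
    [/\ `|Im (p (z k) * u k i) -
          kappaL mu c (th 0 i) / 2 * (ind i)%:R * Im (z k - (rho mu c (th 0 i))%:C)^-1| <= KE * eta,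
        `|Im (q (z k) * u k i) -
          kappaR mu c (th 0 i) / 2 * (ind i)%:R * Im (z k - (rho mu c (th 0 i))%:C)^-1| <= KE * eta &
        `|Im ((th 0 i)^-1%:C * u k i) -
          kappaLR mu c (th 0 i) / 2 * (ind i)%:R * Im (z k - (rho mu c (th 0 i))%:C)^-1| <= KE * eta].
    rewrite /g => gk; apply: hKE; rewrite ?etap //; first exact/hab/set_mem.
      exact: reg_th reg i.
    (* A node in J and a location outside J cannot be within dl, since no boundary point is that
       close to the location. *)
    rewrite /ind; have [|nJ] := boolP (_ \in J); first by rewrite inE => /hab.
    rewrite leNgt; apply/negP => /(far_from_boundary hJ (reg_sep reg i)).
    by rewrite gk (negbTE nJ).
  rewrite /limit_proj dblockB; apply: opnorm_dblock_le => [|i].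
    rewrite addr_ge0 // ?[0 <= BA * _]mulr_ge0 ?(ltW BA0) //; last by rewrite mulr_ge0 // ltW.
    by rewrite mulr_ge0 // ltW.
  have kb h := hKK _ (reg_th reg i) h.
  split; apply: entry => [|k gk].
  - by apply: kap_le => /kb[].
  - by have [] := near k i gk.
  - by apply: kap_le => /kb[].
  - by have [] := near k i gk.
  - by apply: kap_le => /kb[].
  - by have [] := near k i gk.
  - by apply: kap_le => /kb[].
  - by have [] := near k i gk.
have sumB : \sum_k c_ k *: (skew (compressed X P U V (z k)) - skew (limit_compressed th (z k))) =
    \sum_k c_ k *: skew (compressed X P U V (z k)) -
    \sum_k c_ k *: skew (limit_compressed th (z k)).
  by rewrite -sumrB; apply: eq_bigr => k _; exact: scalerBr.
have -> : (Emx U V)^t* *m spectral_proj A J *m Emx U V - limit_proj th =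
    (Emx U V)^t* *m (spectral_proj A J - fcalc A (fun x => (Fr x)%:C)) *m Emx U V +
    (\sum_k c_ k *: (skew (compressed X P U V (z k)) - skew (limit_compressed th (z k))) +
     (\sum_k c_ k *: skew (limit_compressed th (z k)) - limit_proj th)).
  rewrite (compressB _ (spectral_proj A J) (fcalc A _)).
  exact: subr_telescope S2 sumB.
apply: le_trans (ler_opnormD _ _) _; apply: le_trans (lerD S1 (ler_opnormD _ _)) _.
apply: le_trans (lerD (lexx _) (lerD S3 S4)) _.
have s1 : (1 + 4 * KK) * e1 = e / 3 by rewrite /e1; field; rewrite gt_eqF.
have s2 : 12 * (BA * KE + 1) * e2 = e by rewrite /e2; field; rewrite gt_eqF.
have s3 : BA * (KE * eta) <= BA * KE * e2 by rewrite mulrA ler_wpM2l // mulr_ge0 // ltW.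
exact: error_budget s1 s2 s3 (ltW e20).
Qed.

End RegularRealizations.

Lemma inner_lower (R : realType) n (y z : 'cV[R[i]]_n) (c0 : R) :
  (forall a, exists m : R, z a 0 = m%:C * y a 0 /\ (y a 0 = 0 \/ c0 <= m)) ->
  c0 * l2norm y ^+ 2 <= Re (inner y z).
Proof.
move=> h; rewrite sqr_l2normE innerE Re_sum mulr_sumr; apply: ler_sum => a _.
have [m [-> [->|cm]]] := h a; first by rewrite cabs0 expr0n !mulr0.
rewrite [X in Re X]mulrCA ReZ; have -> : Re ((y a 0)^*%R * y a 0) = cabs (y a 0) ^+ 2.
  by rewrite mulrC mulcJ.
by rewrite ler_wpM2r ?sqr_ge0.
Qed.

(** * The limit as a sum of rank one blocks *)

Section RankOneBlocks.
Context {R : realType} {r : nat} (ind : pred 'I_r) (P Q G t : 'I_r -> R).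
Local Notation C := R[i].
Local Notation D := (diag_mx (\row_i ((ind i)%:R : C))).
Local Notation diagR f := (diag_mx (\row_i ((f i)%:C : C))).
Hypotheses (PQ : forall i, ind i -> P i * Q i = t i ^+ 2) (t0 : forall i, t i != 0).

(** As P Q = t^2, each selected block G (P, t; t, Q) has rank one, with eigenvector (P, t), a column
    of [block_range], and eigenvalue (P + Q) G. *)
Definition rank_one_blocks : 'M[C]_(r + r) :=
  dblock (fun i => (P i * G i * (ind i)%:R)%:C) (fun i => (t i * G i * (ind i)%:R)%:C)
    (fun i => (t i * G i * (ind i)%:R)%:C) (fun i => (Q i * G i * (ind i)%:R)%:C).

Definition block_range : 'M[C]_(r + r, r) := col_mx (diagR P) (diagR t).

Lemma rank_one_blocksE : rank_one_blocks =
  block_range *m D *m row_mx (diagR G) (diagR (fun i => Q i * G i / t i)).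
Proof.
rewrite /block_range mul_col_mx !mulmx_diag mul_col_row !mulmx_diag /rank_one_blocks /dblock.
have nat_re (b : bool) : (b%:R : C) = (b%:R : R)%:C by rewrite rmorph_nat.
congr block_mx; apply: (congr1 (@diag_mx _ _)); apply/rowP => i; rewrite !mxE nat_re -!rmorphM;
  congr (_%:C).
- by rewrite mulrAC.
- have [/PQ pq|_] := boolP (ind i); last by rewrite !(mulr0, mul0r).
  by rewrite !mulr1 !mulrA pq; field; exact: t0.
- by rewrite mulrAC.
- by field; exact: t0.
Qed.

Lemma block_range_inj (x : 'cV[C]_r) : block_range *m (D *m x) = 0 -> D *m x = 0.
Proof.
rewrite /block_range mul_col_mx => /(congr1 dsubmx); rewrite col_mxKd linear0.
move: (D *m x) => {}x /colP h; apply/colP => i; have := h i.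
rewrite mul_diag_mx !mxE => /eqP; rewrite mulf_eq0 fmorph_eq0 (negbTE (t0 i)) /=.
by move/eqP.
Qed.

Lemma rank_one_blocks_lower (c0 : R) : (forall i, ind i -> c0 <= (P i + Q i) * G i) ->
  forall x : 'cV[C]_r, let y := block_range *m (D *m x) in
  c0 * l2norm y ^+ 2 <= Re (inner y (rank_one_blocks *m y)).
Proof.
move=> hc x /=; set y := block_range *m _.
pose w i : C := (ind i)%:R * x i 0; pose ev i := (P i + Q i) * G i.
have yE : y = col_mx (\col_i ((P i)%:C * w i)) (\col_i ((t i)%:C * w i)).
  by rewrite /y mul_col_mx; congr col_mx; apply/colP => i; rewrite !mul_diag_mx !mxE.
have indw i : ((ind i)%:R : R)%:C * w i = w i.
  by rewrite /w; case: (ind i); rewrite ?mul1r ?mul0r ?mulr0.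
have TyE : rank_one_blocks *m y = col_mx (\col_i ((ev i)%:C * ((P i)%:C * w i)))
    (\col_i ((ev i)%:C * ((t i)%:C * w i))).
  rewrite yE /rank_one_blocks /dblock mul_block_col.
  congr col_mx; apply/colP => i; rewrite mxE !mul_diag_mx !mxE /ev !rmorphM rmorphD /=;
    rewrite -[w i in RHS]indw; last by ring.
  have [/PQ pq|_] := boolP (ind i); last by rewrite !(mulr0, mul0r) addr0.
  have t2 : (t i)%:C * (t i)%:C = (P i)%:C * (Q i)%:C :> C by rewrite -!rmorphM pq.
  move: ((true%:R)%:C) => v.
  transitivity (((P i)%:C * (P i)%:C + (t i)%:C * (t i)%:C) * (G i)%:C * v * w i); first by ring.
  by rewrite t2; ring.
apply: inner_lower => a; rewrite TyE yE.
have wc i : ind i \/ w i = 0.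
  by rewrite /w; case: (ind i); [left|right; rewrite mul0r].
rewrite !mxE; case: (fintype.split a) => i; rewrite !mxE; exists (ev i); split => //.
  by have [/hc|->] := wc i; [right|left; rewrite mulr0].
by have [/hc|->] := wc i; [right|left; rewrite mulr0].
Qed.

End RankOneBlocks.

Lemma opnorm_half (R : realType) p q (M : 'M[R[i]]_(p, q)) (e : R) :
  opnorm (2^-1 *: M) <= e -> opnorm M <= 2 * e.
Proof.
move=> h; have {1}-> : M = 2 *: (2^-1 *: M) by rewrite scalerA mulfV ?scale1r // pnatr_eq0.
apply: le_trans (opnormZ_le _ _) _.
have -> : cabs (2 : R[i]) = 2 by rewrite -(rmorph_nat (real_complex R)) cabsR ger0_norm.
by rewrite ler_pM2l.
Qed.

Lemma block_factor (R : realType) n m k (u : 'M[R[i]]_(n, k)) (v : 'M[R[i]]_(m, k))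
    (D : 'M[R[i]]_k) : D^t* = D ->
  block_mx (u *m D *m u^t*) (u *m D *m v^t*) ((u *m D *m v^t*)^t*) (v *m D *m v^t*) =
  col_mx u v *m D *m row_mx (u^t*) (v^t*).
Proof.
move=> hD; rewrite mul_col_mx mul_col_row; congr block_mx.
by rewrite adjmx_mul adjmx_mul trmxCK hD mulmxA.
Qed.

Section CompressedBlocks.
Context {R : realType} {n m r : nat} (F : base_field) (W : 'M[R[i]]_(n, m)) (u : 'M[R[i]]_n)
  (s : 'rV[R]_n) (v : 'M[R[i]]_(m, n)) (J : set R) (U : 'M[R[i]]_(n, r)) (V : 'M[R[i]]_(m, r)).
Hypotheses (hW : is_svd F W u s v) (hs : forall j, 0 <= s 0 j) (hJ : forall x, J x -> 0 < x).
Local Notation C := R[i].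

Lemma compressed_proj_blocks :
  (Emx U V)^t* *m spectral_proj (lin W) J *m Emx U V =
  2^-1 *: block_mx (U^t* *m PiL J s u *m U) (U^t* *m Chat J s u v *m V)
    (V^t* *m (Chat J s u v)^t* *m U) (V^t* *m PiL J s v *m V).
Proof.
rewrite (spectral_proj_lin hW hs hJ) -scalemxAr -scalemxAl; congr (_ *: _).
rewrite /Emx tr_block_mx map_block_mx !trmx0 !map_mx0 !mulmx_block.
by rewrite !mul0mx !mulmx0 !addr0 !add0r.
Qed.

Lemma compressed_blocks_le (A B D : 'M[C]_r) (e : R) :
  opnorm ((Emx U V)^t* *m spectral_proj (lin W) J *m Emx U V - 2^-1 *: block_mx A B B D) <= e ->
  [/\ opnorm (U^t* *m PiL J s u *m U - A) <= 2 * e,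
      opnorm (V^t* *m PiL J s v *m V - D) <= 2 * e &
      opnorm (U^t* *m Chat J s u v *m V - B) <= 2 * e].
Proof.
rewrite compressed_proj_blocks -scalerBr opp_block_mx add_block_mx; set M := block_mx _ _ _ _.
move=> /opnorm_half hM.
have [h1 h2 h3] := opnorm_ulsub (U^t* *m PiL J s u *m U - A) (U^t* *m Chat J s u v *m V - B)
  (V^t* *m (Chat J s u v)^t* *m U - B) (V^t* *m PiL J s v *m V - D).
by split; [exact: le_trans h1 hM|exact: le_trans h3 hM|exact: le_trans h2 hM].
Qed.

(** Otherwise the indicator of [s 0 j] would vanish on the spectrum of the linearization, although
    it fixes the eigenvector (u_j, v_j). *)
Lemma singular_value_spec j : exists i, spec (lin W) i = s 0 j.
Proof.
apply: contrapT => nex; have [_ su _ _ _] := hW.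
have := fcalc_eigen (lin_adj W) (fun x => (x == s 0 j)%:R) (lin_eigen_pos hW).
rewrite (eq_fcalc (g := fun=> 0)) => [|i]; last first.
  by case: eqP => // e; case: nex; exists i.
rewrite fcalc_cst -scalemx1 scale0r mul0mx mul_col_mx => /esym/(congr1 usubmx).
rewrite col_mxKu linear0 => /(congr1 (mulmx (u^t*))); rewrite mulmxA su mul1mx mulmx0.
by move=> /matrixP/(_ j j); rewrite !mxE !eqxx => /eqP; rewrite oner_eq0.
Qed.

End CompressedBlocks.

(** * The number of singular values in J *)

Section Counting.
Context {R : realType} (mu : probability (measurableTypeR R) R) (c : R).
Local Notation T := (Cplx R).
Local Notation C := R[i].
Context (mu_neg : mu [set x | x < 0] = 0%E) (mu_cpt : compact (msupport mu))
  (c01 : 0 < c <= 1) (hedge : edge_condition mu c).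
Local Notation b := (edge mu).
Context (J : set R) (Rg : set T) (a1 b1 eta0 dl : R).
Context (hJ : compact_union_of_intervals J) (hab : forall x, J x -> a1 <= x <= b1)
  (ha : b < a1) (hab1 : a1 <= b1) (eta00 : 0 < eta0) (dl0 : 0 < dl)
  (hRg : Rg `<=` off_cut mu)
  (hmargin : forall y z, J y -> cabs (z - y%:C) <= eta0 -> Rg z).
Local Notation p := (st (phi_state mu)).
Local Notation q := (st (phit_state mu c)).
Local Notation d := (dd (phi_state mu) (phit_state mu c)).
Local Notation d1 := (dd1 (phi_state mu) (phit_state mu c)).

(** Here t is theta^-1, so the relation P Q = t^2 is the equation d(rho) = theta^-2 of the
    location. *)
Lemma limit_proj_rank_one : exists2 e : R, 0 < e &
  forall r (th : 'rV[R]_r), (forall i, 0 < th 0 i) -> exists P Q G t : 'I_r -> R,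
  let ind := [pred i | rho mu c (th 0 i) \in J] in
  [/\ limit_proj mu c J th = rank_one_blocks ind P Q G t,
      forall i, ind i -> P i * Q i = t i ^+ 2, forall i, t i != 0 &
      forall i, ind i -> e <= (P i + Q i) * G i].
Proof.
have [K [e [_ e0 hK]]] := kappa_bounds mu_neg mu_cpt c01 hedge ha hab1.
exists e => // r th th0; pose x i := rho mu c (th 0 i).
pose P i := Re (p (x i)%:C); pose Q i := Re (q (x i)%:C).
pose G i := - 1 / ((Re (d (x i)%:C))^-1 * Re (d1 (x i)%:C (x i)%:C)).
exists P, Q, G, (fun i => (th 0 i)^-1) => ind.
have hind i : ind i -> [/\ theta_star mu c < th 0 i, a1 <= x i <= b1 & b < x i].
  rewrite /ind /= inE => /hab /[dup] /andP[h1 _] h; split => //; last exact: lt_le_trans h1.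
  exact/rho_gt_theta/(lt_le_trans ha).
have kE i : ind i -> [/\ kappaL mu c (th 0 i) / 2 = P i * G i,
    kappaR mu c (th 0 i) / 2 = Q i * G i & kappaLR mu c (th 0 i) / 2 = (th 0 i)^-1 * G i].
  move=> /hind[ht _ _].
  rewrite (kappaLE mu_neg mu_cpt c01 hedge (th0 i) ht).
  rewrite (kappaRE mu_neg mu_cpt c01 hedge (th0 i) ht).
  rewrite (kappaLRE mu_neg mu_cpt c01 hedge (th0 i) ht).
  by rewrite /P /Q /G !mulNr !mulrN !mul1r.
split=> [|i hi|i|i hi].
- apply: eq_dblock => i; congr (_%:C); rewrite /ind /=;
    (have [hi|_] := boolP (_ \in J); last by rewrite !mulr0);
    by have [k1 k2 k3] := kE i hi; rewrite ?k1 ?k2 ?k3.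
- have [ht hx bx] := hind i hi; have [_ dx] := rhoP mu_neg mu_cpt c01 hedge (th0 i) ht.
  rewrite exprVn -dx (d_reE c mu_neg mu_cpt bx) // /dd.
  rewrite (st_real (phi_stateP mu_neg mu_cpt) bx).
  by rewrite (st_real (phit_stateP mu_neg mu_cpt c01) bx) -rmorphM.
- by rewrite invr_eq0 gt_eqF.
- have [ht hx bx] := hind i hi; have [_ _ _] := hK _ (th0 i) hx.
  by have [-> -> _] := kE i hi; rewrite -mulrDl.
Qed.

Lemma singular_value_count : exists2 s1 : R, 0 < s1 &
  forall s n m r (X P : 'M[C]_(n, m)) (U : 'M[C]_(n, r)) (V : 'M[C]_(m, r)) (th : 'rV[R]_r)
    (F : base_field) (u : 'M[C]_n) (sg : 'rV[R]_n) (v : 'M[C]_(m, n)),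
  s <= s1 -> regular mu c J Rg dl s X P U V th ->
  is_svd F (X + P) u sg v -> (forall j, 0 <= sg 0 j) ->
  (forall j, ~ boundary J (sg 0 j)) /\
  #|[pred j | sg 0 j \in J]| = #|[pred i | rho mu c (th 0 i) \in J]|.
Proof.
have [s0 [d2 [s00 d20 far]]] :=
  spectrum_far mu_neg mu_cpt c01 hedge hJ hab ha hab1 eta00 dl0 hRg hmargin.
have [sl [c0 [sl0 c00 lower]]] :=
  compressed_lower mu_neg mu_cpt c01 dl hab ha hab1 eta00 hmargin.
have [e e0 rank1] := limit_proj_rank_one.
(* Strictly below both thresholds of the rank comparison: c0^2 for the upper bound of the count, e
   for the lower one. *)
pose e2 := Num.min (c0 ^+ 2) e / 2.
have e20 : 0 < e2 by rewrite divr_gt0 // lt_min exprn_gt0.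
have [sp sp0 close] :=
  proj_close mu_neg mu_cpt c01 hedge hJ hab ha hab1 eta00 dl0 hRg hmargin e20.
exists (Num.min s0 (Num.min sl sp)); first by rewrite !lt_min s00 sl0.
move=> s n m r X P U V th F u sg v; rewrite !le_min => /and3P[ss0 ssl ssp] reg hW hsg.
have hJ0 x : J x -> 0 < x.
  move=> /hab/andP[h _]; apply: le_lt_trans (edge_ge0 mu) (lt_le_trans ha h).
split=> [j hj|].
  have [i hi] := singular_value_spec hW j.
  by have := far _ _ _ _ _ _ _ _ _ ss0 reg i _ hj; rewrite hi subrr normr0 leNgt d20.
have [Pf [Q [G [t [hT PQ t0 hlow]]]]] := rank1 _ _ (reg_th reg).
have e2lt : e2 < Num.min (c0 ^+ 2) e.
  by rewrite ltr_pdivrMr // mulr_natr mulr2n ltrDl lt_min exprn_gt0.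
have := close _ _ _ _ _ _ _ _ _ ssp reg; rewrite hT => cl.
have [_ su sv _ _] := hW.
apply/eqP; rewrite eqn_leq; apply/andP; split.
- have low := lower _ _ _ _ _ _ _ _ _ ssl reg.
  have sp_pos := spectral_proj_pos J hW.
  have rk := rank_one_blocksE G PQ t0.
  refine (card_le_of_proj (sJ := [pred j | sg 0 j \in J])
    (rJ := [pred i | rho mu c (th 0 i) \in J]) c00 sp_pos _ low rk _).
    move=> x; rewrite mul_col_mx => /(congr1 usubmx); rewrite col_mxKu linear0.
    by move=> /(congr1 (mulmx (u^t*))); rewrite mulmxA su mul1mx mulmx0.
  by apply: le_lt_trans cl (lt_le_trans e2lt _); rewrite ge_min lexx.
- apply: (card_ge_of_proj (A := lin (X + P)) (E := Emx U V) (J := J) (sJ := [pred j | sg 0 j \in J])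
    (rJ := [pred i | rho mu c (th 0 i) \in J]) (Z := col_mx u v)
    (Z' := 2^-1 *: row_mx (u^t*) (v^t*)) _ _ (rank_one_blocks_lower PQ hlow)).
  + rewrite (spectral_proj_lin hW hsg hJ0) -scalemxAr !PiLE ChatE.
    apply: (congr1 ( *:%R _)); apply: block_factor.
    rewrite tr_diag_mx map_diag_mx; apply: (congr1 (@diag_mx _ _)); apply/rowP => i.
    by rewrite !mxE rmorph_nat.
  + by move=> x; exact: block_range_inj.
  + by apply: le_lt_trans cl (lt_le_trans e2lt _); rewrite ge_min lexx orbT.
Qed.

End Counting.

(** * Limits in probability *)

Lemma limit_projE (R : realType) (mu : probability (measurableTypeR R) R) (c : R) (J : set R)
    r (th : 'rV[R]_r) :
  limit_proj mu c J th = 2^-1 *: block_mx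
    (Kdiag mu c (kappaL mu c) J th) (Kdiag mu c (kappaLR mu c) J th)
    (Kdiag mu c (kappaLR mu c) J th) (Kdiag mu c (kappaR mu c) J th).
Proof. by rewrite Kdiag_block; apply: eq_dblock => i; rewrite mulrA [2^-1 * _]mulrC. Qed.

Section WithProbabilityToOne.
Context {R : realType} {d : nat -> measure_display}
  {T : forall n, measurableType (d n)} (Pr : forall n, probability (T n) R).
Implicit Types E : forall n, set (T n).

Lemma with_prob_to_one_sub E E' (N : nat) :
  (forall n, (N <= n)%N -> E n `<=` E' n) -> with_prob_to_one Pr E -> with_prob_to_one Pr E'.
Proof.
(* Below N the inclusion is unknown; the empty set is a harmless measurable witness there. *)
move=> hE [A [mA AE cA]]; exists (fun n => if (N <= n)%N then A n else set0); split.
- by move=> n; case: ifP.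
- by move=> n w; case: ifP => [Nn Aw|_ []]; exact/(hE n Nn)/AE.
- apply: cvg_trans cA; apply: near_eq_cvg; near=> n.
  have -> // : (N <= n)%N by near: n; exact: nbhs_infty_ge.
Unshelve. all: by end_near.
Qed.

(** The union bound on complements, applied to the measurable inner sets: their intersection has
    probability at least Pr A + Pr B - 1. *)
Lemma with_prob_to_one_and E E' : with_prob_to_one Pr E -> with_prob_to_one Pr E' ->
  with_prob_to_one Pr (fun n => E n `&` E' n).
Proof.
move=> [A [mA AE cA]] [B [mB BE cB]]; exists (fun n => A n `&` B n); split.
- by move=> n; exact: measurableI.
- by move=> n; exact: setISS.
have fin n (D : set (T n)) : measurable D -> Pr n D \is a fin_num.
  by move=> mD; exact: fin_num_measure.
have mI n : measurable (A n `&` B n) by exact: measurableI.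
apply: cvg_EFin; first by apply: nearW => n; exact: fin.
have fA := fine_cvg cA; have fB := fine_cvg cB.
have lb n : fine (Pr n (A n)) + fine (Pr n (B n)) - 1 <= fine (Pr n (A n `&` B n)).
  have hC D : measurable D -> fine (Pr n (~` D)) = 1 - fine (Pr n D).
    by move=> mD; rewrite probability_setC // fineB ?fin.
  have : fine (Pr n (~` (A n `&` B n))) <= fine (Pr n (~` A n)) + fine (Pr n (~` B n)).
    rewrite -fineD ?fin //; try exact: measurableC.
    apply: fine_le; rewrite ?fin_numD ?fin //; try exact: measurableC.
    by rewrite setCI; apply: measureU2; exact: measurableC.
  by rewrite !hC //; lra.
have ub n : fine (Pr n (A n `&` B n)) <= 1.
  by rewrite -[leRHS]/(fine 1%E) fine_le ?fin // probability_le1.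
have cl : fine (Pr n (A n)) + fine (Pr n (B n)) - 1 @[n --> \oo] --> (1 : R).
  have {2}-> : (1 : R) = 1 + 1 - 1 by rewrite addrK.
  apply: cvgB; last exact: cvg_cst.
  exact: (cvgD (fA eventually_filter) (fB eventually_filter)).
apply: (squeeze_cvgr (h := fun=> 1) _ cl); last exact: cvg_cst.
by apply: nearW => n; apply/andP; split; [exact: lb|exact: ub].
Qed.

Lemma cvg_in_probability0 (Y : forall n, T n -> R) : (forall n w, 0 <= Y n w) ->
  (forall e, 0 < e -> with_prob_to_one Pr (fun n => [set w | Y n w <= e])) ->
  cvg_in_probability Pr Y 0.
Proof.
move=> Y0 h e e0; apply: (with_prob_to_one_sub (N := 0%N)) (h e e0) => n _ w /=.
by rewrite subr0 ger0_norm.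
Qed.

End WithProbabilityToOne.

Theorem theorem3p7 (R : realType) (d : nat -> measure_display)
  (T : forall n, measurableType (d n)) (Pr : forall n, probability (T n) R)
  (F : base_field) (m : nat -> nat) (c : R)
  (mu : probability (measurableTypeR R) R)
  (X P : forall n, T n -> 'M[R[i]]_(n, m n))
  (r : forall n, T n -> nat)
  (U : forall n (w : T n), 'M[R[i]]_(n, r n w))
  (theta : forall n (w : T n), 'rV[R]_(r n w))
  (V : forall n (w : T n), 'M[R[i]]_(m n, r n w))
  (uhat : forall n, T n -> 'M[R[i]]_(n, n))
  (sigma : forall n, T n -> 'rV[R]_n)
  (vhat : forall n, T n -> 'M[R[i]]_(m n, n))
  (J : set R) (k : nat) (gam : 'I_k -> R -> Cplx R) (K : set (Cplx R))
  (hm : forall n, (n <= m n)%N)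
  (hc : 0 < c <= 1)
  (hnm : (n%:R / (m n)%:R : R) @[n --> \oo] --> c)
  (hX : forall n, random_mx (X n))
  (hP : forall n, random_mx (P n))
  (hXF : forall n w, X n w \is a mxOver (scalars F))
  (hPsvd : forall n w, is_svd F (P n w) (U n w) (theta n w) (V n w))
  (htheta : forall n w i, 0 < theta n w 0 i)
  (hWsvd : forall n w,
     is_svd F (X n w + P n w) (uhat n w) (sigma n w) (vhat n w))
  (hsigma : forall n w j, 0 <= sigma n w 0 j)
  (hnoise : global_noise_law Pr mu X)
  (hedge : edge_condition mu c)
  (hlocal : subspace_local_law Pr mu c X U V)
  (hJ : compact_union_of_intervals J)
  (hJb : forall x, J x -> edge mu < x)
  (hstable : stable Pr mu c theta J gam)
  (hK : compact K) (hKcut : K `<=` off_cut mu)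
  (hKnbhd : Gamma_set gam `<=` interior K)
  (hcompat : weighted_compatibility Pr mu c X U V theta K) :
  [/\ with_prob_to_one Pr (fun n => [set w |
        (forall j, ~ boundary J (sigma n w 0 j)) /\
        #|[pred j | sigma n w 0 j \in J]| =
        #|[pred i | rho mu c (theta n w 0 i) \in J]|]),
      [/\ cvg_in_probability Pr (fun n w =>
            opnorm ((U n w)^t* *m PiL J (sigma n w) (uhat n w) *m U n w
                    - Kdiag mu c (kappaL mu c) J (theta n w))) 0,
          cvg_in_probability Pr (fun n w =>
            opnorm ((V n w)^t* *m PiL J (sigma n w) (vhat n w) *m V n w
                    - Kdiag mu c (kappaR mu c) J (theta n w))) 0 &
          cvg_in_probability Pr (fun n w =>
            opnorm ((U n w)^t* *m Chat J (sigma n w) (uhat n w) (vhat n w)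
                      *m V n w
                    - Kdiag mu c (kappaLR mu c) J (theta n w))) 0] &
      cvg_in_probability Pr (fun n w =>
        opnorm ((Emx (U n w) (V n w))^t*
                  *m spectral_proj (lin (X n w + P n w)) J
                  *m Emx (U n w) (V n w)
                - 2^-1 *: block_mx
                    (Kdiag mu c (kappaL mu c) J (theta n w))
                    (Kdiag mu c (kappaLR mu c) J (theta n w))
                    (Kdiag mu c (kappaLR mu c) J (theta n w))
                    (Kdiag mu c (kappaR mu c) J (theta n w)))) 0].
Proof.
have [mu_neg mu_cpt _ hop] := hnoise.
have [hgam [cOm hOmcut] hOm [dl [B [dl0 hst]]]] := hstable.
have [a1 [b1 [ha hab1 hab]]] := union_bounds hJ hJb.
have [eta0 eta00 hmargin] := region_margin hJ hgam hOm hKnbhd.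
(* The local law is applied once, on the closed region enclosed by Gamma together with the
   neighbourhood K. *)
pose Rg : set (Cplx R) := closure (Omega_set gam) `|` K.
have hRg : Rg `<=` off_cut mu by move=> z [/hOmcut|/hKcut].
have cRg : compact Rg by exact: compactU.
have hJ0 x : J x -> 0 < x.
  by move=> /hJb; apply: le_lt_trans; exact: edge_ge0.
have regular_wpto s : 0 < s -> with_prob_to_one Pr (fun n => [set w |
    regular mu c J Rg dl s (X n w) (P n w) (U n w) (V n w) (theta n w)]).
  move=> s0; have [eps [eps0 epscvg hloc]] := hlocal Rg cRg hRg.
  have [N hN] : exists N, forall n, (N <= n)%N -> eps n <= s.
    have /cvgrPdist_le/(_ _ s0)[N _ h] := epscvg; exists N => n Nn.
    by have := h n Nn; rewrite sub0r normrN; apply: le_trans; exact: ler_norm.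
  have := with_prob_to_one_and (with_prob_to_one_and hloc (hcompat _ s0))
    (with_prob_to_one_and hst (hop _ s0)).
  apply: (with_prob_to_one_sub (N := N)) => n Nn w [[/= hG hC] [/= [sep _ _] hXn]].
  have [[_ _] sU sV _ hPn] := hPsvd n w.
  split=> //; [exact: ltW| |].
    by move: hXn; rewrite ler_norml lerBlDl => /andP[].
  move=> z hz; have [rz gz] := hG z hz; split=> //; first exact: le_trans gz (hN n Nn).
  have onK v : K v -> opnorm ((Gmx (X n w) (U n w) (V n w) v - Mmx mu c (r n w) v) *m
      Kmx (theta n w)) <= s.
    move=> /hC[_]; apply: le_trans; rewrite lerDl; exact: opnorm_ge0.
  (* On K the weighted bound is assumed; on the closure of Omega it follows by the maximum
     principle, because the points of the closure outside Omega lie on Gamma, hence in K. *)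
  case: hz => [hz|]; last exact: onK.
  apply: (compatibility_extension mu_neg mu_cpt hc (Omega_open hgam) cOm hOmcut _ (ltW s0) _ hz).
    by move=> v hv; have [] := hG v (or_introl hv).
  move=> v hv nv; apply: onK; apply: interior_subset; apply: hKnbhd.
  by have [] := closure_Omega_sub hgam hv.
have close e : 0 < e -> with_prob_to_one Pr (fun n => [set w |
    opnorm ((Emx (U n w) (V n w))^t* *m spectral_proj (lin (X n w + P n w)) J
      *m Emx (U n w) (V n w) - 2^-1 *: block_mx
        (Kdiag mu c (kappaL mu c) J (theta n w)) (Kdiag mu c (kappaLR mu c) J (theta n w))
        (Kdiag mu c (kappaLR mu c) J (theta n w)) (Kdiag mu c (kappaR mu c) J (theta n w)))
    <= e]).
  move=> e0; have [s1 s10 hs1] :=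
    proj_close mu_neg mu_cpt hc hedge hJ hab ha hab1 eta00 dl0 hRg hmargin e0.
  apply: (with_prob_to_one_sub (N := 0%N)) (regular_wpto _ s10) => n _ w reg.
  have := hs1 _ _ _ _ _ _ _ _ _ (lexx s1) reg.
  by rewrite limit_projE.
have blocks e : 0 < e -> with_prob_to_one Pr (fun n => [set w |
  [/\ opnorm ((U n w)^t* *m PiL J (sigma n w) (uhat n w) *m U n w
        - Kdiag mu c (kappaL mu c) J (theta n w)) <= e,
      opnorm ((V n w)^t* *m PiL J (sigma n w) (vhat n w) *m V n w
        - Kdiag mu c (kappaR mu c) J (theta n w)) <= e &
      opnorm ((U n w)^t* *m Chat J (sigma n w) (uhat n w) (vhat n w) *m V n w
        - Kdiag mu c (kappaLR mu c) J (theta n w)) <= e]]).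
  (* The projector carries a factor 1/2 in front of its blocks. *)
  move=> e0; have e20 : 0 < e / 2 by rewrite divr_gt0.
  apply: (with_prob_to_one_sub (N := 0%N)) (close _ e20) => n _ w h.
  have -> : e = 2 * (e / 2) by rewrite mulrCA mulfV ?mulr1 // pnatr_eq0.
  exact: (compressed_blocks_le (hWsvd n w) (hsigma n w) hJ0 h).
have [s1 s10 hcount] :=
  singular_value_count mu_neg mu_cpt hc hedge hJ hab ha hab1 eta00 dl0 hRg hmargin.
split.
- apply: (with_prob_to_one_sub (N := 0%N)) (regular_wpto _ s10) => n _ w reg.
  exact: (hcount _ _ _ _ _ _ _ _ _ _ _ _ _ (lexx s1) reg (hWsvd n w) (hsigma n w)).
- split; apply: cvg_in_probability0 => [n w|e e0]; try exact: opnorm_ge0.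
  + by apply: (with_prob_to_one_sub (N := 0%N)) (blocks e e0) => n _ w [h _ _]; exact: h.
  + by apply: (with_prob_to_one_sub (N := 0%N)) (blocks e e0) => n _ w [_ h _]; exact: h.
  + by apply: (with_prob_to_one_sub (N := 0%N)) (blocks e e0) => n _ w [_ _ h]; exact: h.
- apply: cvg_in_probability0 => [n w|]; [exact: opnorm_ge0|exact: close].
Qed.
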